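(* Let $q\in(0,1)$ and $G\in\{B,C,D\}$. The minimal boundary $\Omega^G_q$ of the BC type $q$-Gelfand–Tsetlin graph (of type $G$) is equal to its Martin boundary $\Omega^{G,\mathrm{Martin}}_q$.
   Context: $\epsilon=\frac12,1,0$ for $G=B,C,D$. $\mathbb{GT}^+_N$ is the set of $\lambda=(\lambda_1\ge\cdots\ge\lambda_N\ge0)\in\mathbb Z^N$. With $V^s(z_1,\ldots,z_N)=\prod_{i<j}(z_i+z_i^{-1}-z_j-z_j^{-1})$, $\chi^G_\lambda(z_1,\ldots,z_N)$ is the Laurent polynomial equal to $1/V^s(z_1,\ldots,z_N)$ times $\det\big[\frac{z_j^{\lambda_i+N-i+1/2}-z_j^{-(\lambda_i+N-i+1/2)}}{z_j^{1/2}-z_j^{-1/2}}\big]$ for $G=B$, $\det\big[\frac{z_j^{\lambda_i+N-i+1}-z_j^{-(\lambda_i+N-i+1)}}{z_j-z_j^{-1}}\big]$ for $G=C$, $\det\big[z_j^{\lambda_i+N-i}+z_j^{-(\lambda_i+N-i)}\big]$ for $G=D$ (all $1\le i,j\le N$). BC type $q$-Gelfand–Tsetlin graph: the sequence $\{\mathbb{GT}^+_N,\Lambda^{N+1}_N\}_{N\ge1}$, where for $\lambda\in\mathbb{GT}^+_{N+1}$ the numbers $\Lambda^{N+1}_N(\lambda,\mu)$, $\mu\in\mathbb{GT}^+_N$, are the unique coefficients in $$\frac{\chi^G_\lambda(x_1,\ldots,x_N,q^{N+\epsilon})}{\chi^G_\lambda(q^\epsilon,q^{1+\epsilon},\ldots,q^{N+\epsilon})}=\sum_{\mu\in\mathbb{GT}^+_N}\Lambda^{N+1}_N(\lambda,\mu)\frac{\chi^G_\mu(x_1,\ldots,x_N)}{\chi^G_\mu(q^\epsilon,q^{1+\epsilon},\ldots,q^{N-1+\epsilon})}.$$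 These matrices are stochastic. For $N>k$, $\Lambda^N_k=\Lambda^N_{N-1}\cdots\Lambda^{k+1}_k$. A coherent system is a sequence of probability measures $M_N$ on $\mathbb{GT}^+_N$, $N\ge1$, with $\sum_\lambda M_{N+1}(\lambda)\Lambda^{N+1}_N(\lambda,\mu)=M_N(\mu)$ for all $N\ge1$, $\mu\in\mathbb{GT}^+_N$. Coherent systems form a convex set. The minimal boundary is the set of its extreme points. The Martin boundary is the set of coherent systems $\{M_k\}_{k\ge1}$ for which there exists a sequence $\{\lambda(N)\in\mathbb{GT}^+_N\}_{N\ge1}$ with $M_k(\mu)=\lim_{N\to\infty}\Lambda^N_k(\lambda(N),\mu)$ for all $k\ge1$, $\mu\in\mathbb{GT}^+_k$. *)

(* Defs.v *)
From HB Require Import structures.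
From mathcomp Require Import all_boot all_order all_algebra finmap.
From mathcomp Require Import all_classical all_reals all_analysis.

Set Implicit Arguments.
Unset Strict Implicit.
Unset Printing Implicit Defensive.

Import Order.TTheory GRing.Theory Num.Theory.
Import numFieldNormedType.Exports.

Local Open Scope classical_set_scope.
Local Open Scope ring_scope.

Inductive gtype := typeB | typeC | typeD.

Definition epsilon (R : realType) (G : gtype) : R :=
  match G with typeB => 2^-1 | typeC => 1 | typeD => 0 end.

(* Nonnegative signatures lambda_1 >= ... >= lambda_N >= 0. *)
Definition GT (N : nat) : choiceType := {l : N.-tuple nat | sorted geq l}.

Definition part (N : nat) (l : GT N) (i : 'I_N) : nat := tnth (val l) i.

(* Laurent polynomials in N variables, as finitely supported families of
   coefficients indexed by the exponents in Z^N. *)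
Definition laurent (R : realType) (N : nat) : choiceType :=
  {fsfun N.-tuple int -> R with 0}.

Definition laurent_eval (R : realType) (N : nat) (p : laurent R N)
    (z : N.-tuple R) : R :=
  \sum_(m <- finsupp p) p m * \prod_(j < N) tnth z j ^ tnth m j.

Definition Vs (R : realType) (N : nat) (z : N.-tuple R) : R :=
  \prod_(i < N) \prod_(j < N | (i < j)%N)
    (tnth z i + (tnth z i)^-1 - tnth z j - (tnth z j)^-1).

(* Ordinals are numbered from 0, so the paper's N - i is N - i.+1 here. *)
Definition char_entry (R : realType) (G : gtype) (N : nat) (l : GT N)
    (i : 'I_N) (x : R) : R :=
  let m : R := (part l i + (N - i.+1))%:R in
  match G with
  | typeB => (x `^ (m + 2^-1) - x `^ (- (m + 2^-1))) /
             (x `^ (2^-1) - x `^ (- 2^-1))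
  | typeC => (x `^ (m + 1) - x `^ (- (m + 1))) / (x - x^-1)
  | typeD => x `^ m + x `^ (- m)
  end.

Definition char_det (R : realType) (G : gtype) (N : nat) (l : GT N)
    (z : N.-tuple R) : R :=
  \det (\matrix_(i < N, j < N) char_entry G l i (tnth z j)).

(* A Laurent polynomial is determined by its values at the positive points
   where no denominator vanishes (at positive points the half-integer powers of
   type B are the usual real ones). *)
Definition is_char (R : realType) (G : gtype) (N : nat) (l : GT N)
    (p : laurent R N) : Prop :=
  forall z : N.-tuple R,
    (forall j, 0 < tnth z j /\ tnth z j != 1) -> Vs z != 0 ->
    laurent_eval p z = (Vs z)^-1 * char_det G l z.

(* Definite description: there is exactly one p with is_char G l p, so the
   default value is never used. *)
Definition chi (R : realType) (G : gtype) (N : nat) (l : GT N) : laurent R N :=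
  xget [fsfun] [set p : laurent R N | is_char G l p].

Definition chi_at (R : realType) (G : gtype) (N : nat) (l : GT N)
    (z : N.-tuple R) : R :=
  laurent_eval (chi R G l) z.

(* The point (q^epsilon, q^(1+epsilon), ..., q^(N-1+epsilon)). *)
Definition qpoint (R : realType) (G : gtype) (q : R) (N : nat) : N.-tuple R :=
  [tuple q `^ (i%:R + epsilon R G) | i < N].

(* The expansion is an identity of Laurent polynomials, stated through its
   values at all points with nonzero coordinates; expansions are finite. *)
Definition is_link_row (R : realType) (G : gtype) (q : R) (N : nat)
    (l : GT N.+1) (c : {fsfun GT N -> R with 0}) : Prop :=
  forall x : N.-tuple R, (forall j, tnth x j != 0) ->
    chi_at G l [tuple of rcons x (q `^ (N%:R + epsilon R G))] /
      chi_at G l (qpoint G q N.+1) =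
    \sum_(mu <- finsupp c)
      c mu * (chi_at G mu x / chi_at G mu (qpoint G q N)).

(* link G q l is the row Lambda^{N+1}_N(l, -); again a definite description. *)
Definition link (R : realType) (G : gtype) (q : R) (N : nat) (l : GT N.+1) :
    {fsfun GT N -> R with 0} :=
  xget [fsfun] [set c : {fsfun GT N -> R with 0} | is_link_row G q l c].

(* Levels N >= 1 are indexed by n = N - 1 from here on.
   links G q n d is Lambda^{N+d}_N for N = n + 1 (the identity for d = 0). *)
Fixpoint links (R : realType) (G : gtype) (q : R) (n d : nat) :
    GT (d + n).+1 -> GT n.+1 -> R :=
  match d with
  | 0%N => fun l mu => (l == mu)%:R
  | d'.+1 => fun l mu =>
      \sum_(nu <- finsupp (link G q l)) link G q l nu * links G q nu mu
  end.

(* The probability measure on a countable discrete set with weights p. *)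
Definition is_prob (R : realType) (T : choiceType) (p : T -> R) : Prop :=
  (forall x, 0 <= p x) /\ (\esum_(x in [set: T]) (p x)%:E = 1)%E.

(* M n is the paper's M_{n+1}. *)
Definition system (R : realType) : Type := forall n : nat, GT n.+1 -> R.

(* The terms of the sum are nonnegative since the matrices are stochastic, so
   esum is the ordinary sum of the series. *)
Definition coherent (R : realType) (G : gtype) (q : R) : set (system R) :=
  [set M | (forall n, is_prob (M n)) /\
    forall n (mu : GT n.+1),
      (\esum_(l in [set: GT n.+2]) (M n.+1 l * link G q l mu)%:E
        = (M n mu)%:E)%E].

Definition extreme_points (R : realType) (A : set (system R)) :
    set (system R) :=
  [set M | A M /\ forall (M1 M2 : system R) (t : R), A M1 -> A M2 ->
    0 < t < 1 -> (forall n mu, M n mu = t * M1 n mu + (1 - t) * M2 n mu) ->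
    M1 = M /\ M2 = M].

Definition minimal_boundary (R : realType) (G : gtype) (q : R) :
    set (system R) :=
  extreme_points (coherent G q).

Definition martin_boundary (R : realType) (G : gtype) (q : R) :
    set (system R) :=
  [set M | coherent G q M /\
    exists lam : forall n, GT n.+1, forall n (mu : GT n.+1),
      links G q (lam (d + n)%N) mu @[d --> \oo] --> M n mu].

(* Main.v *)
Require Import Defs.
From mathcomp Require Import all_boot all_order all_algebra finmap.
From mathcomp Require Import all_classical all_reals all_analysis.
From mathcomp Require Import perm.
From mathcomp Require Import ring lra zify.

Set Implicit Arguments.
Unset Strict Implicit.
Unset Printing Implicit Defensive.

Import Order.TTheory GRing.Theory Num.Theory.
Import numFieldNormedType.Exports.

Local Open Scope classical_set_scope.
Local Open Scope ring_scope.

(** The two inclusions hold for different reasons.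

    A minimal system is a Martin limit in any projective chain of stochastic
    matrices over countable levels (lemma [extreme_martin]). Tilt [M N] by the
    probability to reach a fixed point [mu0] and project the tilted measure to
    lower levels. Along an ultrafilter these projections converge, and since
    they are dominated by [M], no mass is lost and the limit is coherent. By
    minimality it is proportional to [M], which says that the variance under
    [M N] of the probability to reach [mu0] tends to 0. So for large [N] some
    point of level [N] reaches each of finitely many prescribed points with
    nearly the probability given by [M], and a diagonal choice of such points
    is the required sequence.

    A Martin limit is minimal because the last parts of a signature freeze
    (lemma [martin_extreme]). One link from signatures with [n.+1] parts to
    signatures with [n] parts preserves the last [s] parts with probability at
    least [exp (- C q ^ (n - s))], where [C] depends on [q] and [G] only (lemma
    [tail_prob_ge]). The exponents are summable, so under a Martin limit the
    last [s] parts of a signature with [n] parts agree with a fixed tail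
    [tau s] with a probability that tends to 1 with [n], and the signature with
    [n] parts given by [tau n] is an atom of mass at least some [d > 0] that
    does not depend on [n]. Every component of the limit inherits these bounds,
    with the same tails. Projecting the atoms down and passing to a limit gives
    one coherent system [m] such that [d m] is dominated by every system with
    these tails. Subtract [d m], normalize and repeat: every such system
    dominates [(1 - (1 - d) ^ k) m] for all [k], hence equals [m]. So the limit
    and all its components coincide.

    The estimate of one link rests on an explicit positive formula. In the
    variables [z + z^-1] the characters are determinants of Chebyshev
    polynomials divided by Vandermonde products. Expanding along the column of
    the last [q]-point, with row differences and the Christoffel-Darboux
    identity, writes the restricted character as a positive combination of
    characters, indexed by configurations of two interlacing rows (lemma
    [det_branch]). At the [q]-points degrees and nodes play symmetric roles
    (lemma [chp_duality]), so the normalizing character values are products of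
    differences again, and the link is a ratio of explicit products (lemma
    [link_sum]). Compared with the configuration that just deletes the largest
    part, any other one costs a factor [q ^ (i.+1)] for each unit by which row
    [i] moves, up to constants (lemma [conf_weight_le]). The costs are summable
    over all configurations, and those of the last [s] rows add up to
    [O (q ^ (n - s))]. *)

(** * Sums of nonnegative families *)

Section HasSum.
Variable R : realType.

Definition has_sum (T : choiceType) (f : T -> R) (s : R) : Prop :=
  (forall x, 0 <= f x) /\ (\esum_(x in [set: T]) (f x)%:E = s%:E)%E.

Definition sum_of (T : choiceType) (f : T -> R) : R :=
  fine (\esum_(x in [set: T]) (f x)%:E)%E.

Lemma sum_ofE (T : choiceType) (f : T -> R) s : has_sum f s -> sum_of f = s.
Proof. by case=> _; rewrite /sum_of => ->. Qed.

Lemma has_sum_uniq (T : choiceType) (f : T -> R) s t :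
  has_sum f s -> has_sum f t -> s = t.
Proof. by move=> /sum_ofE <- /sum_ofE <-. Qed.

Lemma eq_has_sum (T : choiceType) (f g : T -> R) s :
  f =1 g -> has_sum f s -> has_sum g s.
Proof.
move=> fg [f0 fs]; split=> [x|]; first by rewrite -fg.
by rewrite -fs; apply: eq_esum => x _; rewrite fg.
Qed.

Lemma has_sum_ge0 (T : choiceType) (f : T -> R) s : has_sum f s -> 0 <= s.
Proof.
by case=> f0 fs; rewrite -lee_fin -fs esum_ge0// => x _; rewrite lee_fin.
Qed.

Lemma has_sum_seq_le (T : choiceType) (f : T -> R) s (r : seq T) :
  has_sum f s -> uniq r -> \sum_(x <- r) f x <= s.
Proof.
move=> [f0 fs] ur; rewrite -lee_fin -fs; apply: esum_ge;
  exists [set` r]; first by split; [exact: finite_seq|by []].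
by rewrite -fsbig_seq// sumEFin.
Qed.

Lemma has_sum_le_at (T : choiceType) (f : T -> R) s x : has_sum f s -> f x <= s.
Proof. by move=> H; have := @has_sum_seq_le _ f s [:: x] H isT; rewrite big_seq1. Qed.

Lemma has_sum_bounded (T : choiceType) (f : T -> R) c :
  (forall x, 0 <= f x) -> (forall r, uniq r -> \sum_(x <- r) f x <= c) ->
  has_sum f (sum_of f) /\ sum_of f <= c.
Proof.
move=> f0 fc.
have le : (\esum_(x in [set: T]) (f x)%:E <= c%:E)%E.
  apply: ge_ereal_sup => _ [X [finX _]] <-.
  by rewrite fsbig_finite//= sumEFin lee_fin fc// fset_uniq.
have ge : (0 <= \esum_(x in [set: T]) (f x)%:E)%E.
  by apply: esum_ge0 => x _; rewrite lee_fin.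
have fin : (\esum_(x in [set: T]) (f x)%:E)%E \is a fin_num.
  rewrite fin_numE; apply/andP; split; apply/eqP => e; move: le ge; rewrite e //.
split; first by split => //; rewrite /sum_of fineK.
by rewrite -lee_fin /sum_of fineK.
Qed.

Lemma has_sum_compare (T : choiceType) (f g : T -> R) s :
  (forall x, 0 <= f x <= g x) -> has_sum g s ->
  has_sum f (sum_of f) /\ sum_of f <= s.
Proof.
move=> fg gs; apply: has_sum_bounded => [x|r ur]; first by have /andP[] := fg x.
apply: le_trans (has_sum_seq_le gs ur).
by apply: ler_sum => x _; have /andP[] := fg x.
Qed.

Lemma ler_has_sum (T : choiceType) (f g : T -> R) s t :
  (forall x, f x <= g x) -> has_sum f s -> has_sum g t -> s <= t.
Proof.
move=> fg fs gt; have fg' x : 0 <= f x <= g x by rewrite fg andbT; case: fs.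
by have [_] := has_sum_compare fg' gt; rewrite (sum_ofE fs).
Qed.

Lemma has_sumD (T : choiceType) (f g : T -> R) s t :
  has_sum f s -> has_sum g t -> has_sum (fun x => f x + g x) (s + t).
Proof.
move=> [f0 fs] [g0 gt]; split=> [x|]; first by rewrite addr_ge0.
rewrite EFinD -fs -gt -esumD//; first by move=> x _; rewrite lee_fin.
by move=> x _; rewrite lee_fin.
Qed.

Lemma has_sum0 (T : choiceType) : has_sum (fun _ : T => 0) 0.
Proof. by split=> //; rewrite esum1. Qed.

Lemma has_sumZ (T : choiceType) (f : T -> R) s c :
  0 <= c -> has_sum f s -> has_sum (fun x => c * f x) (c * s).
Proof.
move=> c0 fs; have [f0 _] := fs.
have cf0 x : 0 <= c * f x by rewrite mulr_ge0.
have [H1 le1] : has_sum (fun x => c * f x) (sum_of (fun x => c * f x)) /\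
    sum_of (fun x => c * f x) <= c * s.
  apply: has_sum_bounded => // r ur; rewrite -mulr_sumr ler_wpM2l//.
  exact: has_sum_seq_le.
suff le2 : c * s <= sum_of (fun x => c * f x).
  by have -> : c * s = sum_of (fun x => c * f x) by apply/eqP; rewrite eq_le le2.
move: c0; rewrite le_eqVlt => /orP[/eqP c0|{}c0].
  by rewrite -{1}c0 mul0r; exact: has_sum_ge0 H1.
rewrite -ler_pdivlMl//.
have [_] : has_sum f (sum_of f) /\ sum_of f <= c^-1 * sum_of (fun x => c * f x).
  apply: has_sum_bounded => // r ur; rewrite ler_pdivlMl// mulr_sumr.
  exact: (has_sum_seq_le H1).
by rewrite (sum_ofE fs).
Qed.

Lemma has_sumB (T : choiceType) (f g : T -> R) s t :
  (forall x, g x <= f x) -> has_sum f s -> has_sum g t ->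
  has_sum (fun x => f x - g x) (s - t).
Proof.
move=> gf fs gt.
have fg x : 0 <= f x - g x <= f x.
  by rewrite subr_ge0 gf lerBlDr lerDl; case: gt => ->.
have [H _] := has_sum_compare fg fs; have E := has_sumD H gt.
suff -> : s - t = sum_of (fun x => f x - g x) by [].
apply/eqP; rewrite subr_eq; apply/eqP; apply: has_sum_uniq fs _.
by apply: eq_has_sum E => x /=; rewrite subrK.
Qed.

Lemma has_sum_sum (T : choiceType) (I : Type) (r : seq I)
    (f : I -> T -> R) (s : I -> R) :
  (forall i, has_sum (f i) (s i)) ->
  has_sum (fun x => \sum_(i <- r) f i x) (\sum_(i <- r) s i).
Proof.
move=> fs; elim: r => [|i r IH].
  rewrite big_nil; apply: eq_has_sum (has_sum0 T) => x.
  by rewrite big_nil.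
rewrite big_cons; apply: eq_has_sum (has_sumD (fs i) IH) => x.
by rewrite big_cons.
Qed.

Lemma has_sum_supp (T : choiceType) (f : T -> R) (A : {fset T}) :
  (forall x, 0 <= f x) -> (forall x, x \notin A -> f x = 0) ->
  has_sum f (\sum_(x <- A) f x).
Proof.
move=> f0 fA.
have [H le1] : has_sum f (sum_of f) /\ sum_of f <= \sum_(x <- A) f x.
  apply: has_sum_bounded => // r ur.
  rewrite (bigID (mem A)) /= [X in _ + X]big1 ?addr0; last by move=> x /fA.
  rewrite -big_filter (perm_big [seq x <- A | x \in r]) /=; last first.
    apply: uniq_perm; rewrite ?filter_uniq// ?fset_uniq// => x.
    by rewrite !mem_filter andbC.
  rewrite big_filter [leRHS](bigID (mem r)) /= lerDl sumr_ge0//.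
by rewrite (_ : \sum_(x <- A) f x = sum_of f)//; apply/eqP; rewrite eq_le le1 andbT;
  apply: (has_sum_seq_le H); rewrite fset_uniq.
Qed.

Lemma has_sum_delta (T : choiceType) (y : T) (c : R) :
  0 <= c -> has_sum (fun x => (x == y)%:R * c) c.
Proof.
move=> c0; have := @has_sum_supp T (fun x => (x == y)%:R * c) [fset y]%fset.
rewrite big_seq_fset1 eqxx mul1r; apply=> x; first by rewrite mulr_ge0.
by rewrite inE => /negPf ->; rewrite mul0r.
Qed.

(** Tonelli's theorem, read as an exchange of summations: each side dominates
    the finite partial sums of the other. *)
Lemma has_sum_exchange (T U : choiceType) (F : T -> U -> R)
    (s : T -> R) (t : U -> R) S :
  (forall x, has_sum (F x) (s x)) -> (forall y, has_sum (F^~ y) (t y)) ->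
  has_sum s S -> has_sum t S.
Proof.
have half (T1 U1 : choiceType) (F1 : T1 -> U1 -> R) s1 t1 S1 :
    (forall x, has_sum (F1 x) (s1 x)) -> (forall y, has_sum (F1^~ y) (t1 y)) ->
    has_sum s1 S1 -> has_sum t1 (sum_of t1) /\ sum_of t1 <= S1.
  move=> Fs Ft sS; apply: has_sum_bounded => [y|r ur].
    exact: has_sum_ge0 (Ft y).
  apply: (ler_has_sum _ (has_sum_sum r Ft) sS) => x /=.
  exact: has_sum_seq_le (Fs x) ur.
move=> Fs Ft sS; have [H le1] := half _ _ _ _ _ _ Fs Ft sS.
have [H' ] := half _ _ (fun y x => F x y) _ _ _ Ft Fs H.
rewrite (sum_ofE sS) => le2.
by have -> : S = sum_of t by apply/eqP; rewrite eq_le le2.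
Qed.

End HasSum.

(** * Limits along an ultrafilter *)

Lemma cvg_sum_seq (R : realType) (F : set_system nat) (FF : Filter F)
    (I : Type) (r : seq I) (g : I -> nat -> R) (l : I -> R) :
  (forall i, g i N @[N --> F] --> l i) ->
  (\sum_(i <- r) g i N) @[N --> F] --> \sum_(i <- r) l i.
Proof.
move=> gl; elim: r => [|i r IH].
  by rewrite big_nil; under eq_fun do rewrite big_nil; exact: cvg_cst.
rewrite big_cons; under eq_fun do rewrite big_cons.
exact: cvgD.
Qed.

Section UltraLimit.
Variables (R : realType) (U : set_system nat).
Hypothesis UU : UltraFilter U.

(** The limit is the supremum of the reals that the sequence eventually
    exceeds: an ultrafilter decides every such comparison. *)
Definition ulim (g : nat -> R) : R := sup [set x | U [set n | x <= g n]].

Lemma cvg_ulim (g : nat -> R) c :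
  (\forall n \near U, `|g n| <= c) -> g n @[n --> U] --> ulim g.
Proof.
move=> gc; have UP : ProperFilter U by exact: ultra_proper.
set E := [set x | U [set n | x <= g n]].
have ubE : ubound E c.
  move=> x Ex; have [n [/= xn]] := filter_ex (filterI Ex gc).
  by move/(le_trans (ler_norm _)); exact: le_trans.
have hE : has_sup E.
  split; last by exists c.
  by exists (- c); apply: filterS gc => n /=; rewrite ler_norml => /andP[].
apply/cvgrPdist_le => e e0.
have [x Ex xs] := sup_adherent e0 hE.
have nE : ~ E (ulim g + e).
  move=> /(ub_le_sup (ex_intro _ c ubE)); rewrite /ulim -/E; lra.
have [//|nE'] := in_ultra_setVsetC [set n | ulim g + e <= g n] UU.
apply: filterS (filterI Ex nE') => n [/= xn /negP]; rewrite -ltNge => ng.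
rewrite ler_norml; apply/andP; split; rewrite -/E in xs; rewrite /ulim -/E in ng *; lra.
Qed.

End UltraLimit.

(** A sequence converges as soon as it converges along all free ultrafilters. *)
Lemma cvg_all_ultra (R : realType) (g : nat -> R) (l : R) :
  (forall U, UltraFilter U -> \oo `<=` U -> g n @[n --> U] --> l) ->
  g n @[n --> \oo] --> l.
Proof.
move=> H; apply/cvgrPdist_le => e e0; apply: contrapT => nF.
set B := [set n | `|l - g n| <= e] in nF *.
have FF : ProperFilter (within (~` B) \oo).
  split; last exact: within_filter.
  by rewrite /within /= => W; apply: nF; move: W; apply: filterS => n /= Hn; apply: contrapT.
have [U [UU sU]] := ultraFilterLemma FF.
have UP : ProperFilter U by exact: ultra_proper.
have ooU : \oo `<=` U.
  by move=> A ooA; apply: sU; rewrite /within /=; move: ooA; apply: filterS => n An _.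
have /cvgrPdist_le /(_ e e0) UB := H U UU ooU.
have UnB : U (~` B) by apply: sU; exact: nearW.
by have [n [/= ]] := filter_ex (filterI UB UnB).
Qed.

(** * Projective chains of stochastic matrices *)

Section Chain.
Variables (R : realType) (V : nat -> choiceType).
Variable P : forall n, V n.+1 -> {fsfun V n -> R with 0}.
Hypothesis P_ge0 : forall n (l : V n.+1) mu, 0 <= P l mu.
Hypothesis P_sum1 :
  forall n (l : V n.+1), \sum_(mu <- finsupp (P l)) P l mu = 1.

(** The composite of the matrices from level [N] down to level [n]; points of
    different levels are compared in the total space, so that no transport
    along an equation between levels is needed. *)
Fixpoint ker (N n : nat) {struct N} : V N -> V n -> R :=
  match N return V N -> V n -> R with
  | 0 => fun l mu => (Tagged V l == Tagged V mu)%:R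
  | N'.+1 => fun l mu =>
      if n == N'.+1 then (Tagged V l == Tagged V mu)%:R
      else \sum_(nu <- finsupp (P l)) P l nu * @ker N' n nu mu
  end.

Lemma ker_diag n (l mu : V n) : ker l mu = (l == mu)%:R.
Proof. by case: n l mu => [|n] l mu /=; rewrite ?eqxx eq_Tagged. Qed.

Lemma ker_top N n (l : V N.+1) (mu : V n) : (n <= N)%N ->
  ker l mu = \sum_(nu <- finsupp (P l)) P l nu * ker nu mu.
Proof. by move=> nN; rewrite /= ltn_eqF. Qed.

Lemma ker_ge0 N n (l : V N) (mu : V n) : 0 <= ker l mu.
Proof.
elim: N l => [|N IH] l /=; first exact: ler0n.
case: eqP => _; first exact: ler0n.
by apply: sumr_ge0 => nu _; rewrite mulr_ge0.
Qed.

Lemma has_sum_row n (l : V n.+1) (f : V n -> R) : (forall mu, 0 <= f mu) ->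
  has_sum (fun mu => P l mu * f mu) (\sum_(mu <- finsupp (P l)) P l mu * f mu).
Proof.
move=> f0; apply: has_sum_supp => mu; first by rewrite mulr_ge0.
by move=> /fsfun_dflt ->; rewrite mul0r.
Qed.

Lemma sum_row1 n (l : V n.+1) (f : V n -> R) mu0 :
  (forall mu, mu != mu0 -> f mu = 0) ->
  \sum_(mu <- finsupp (P l)) P l mu * f mu = P l mu0 * f mu0.
Proof.
move=> f0; have [i|i] := boolP (mu0 \in finsupp (P l)).
  rewrite (big_fsetD1 mu0)//= big_seq big1 ?addr0// => mu.
  by rewrite !inE => /andP[m _]; rewrite f0// mulr0.
rewrite (fsfun_dflt i) mul0r big_seq big1// => mu im.
by rewrite f0 ?mulr0//; apply: contraNneq i => <-.
Qed.

Lemma ker_succ n (l : V n.+1) (mu : V n) : ker l mu = P l mu.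
Proof.
rewrite ker_top// (@sum_row1 _ _ (fun nu => ker nu mu) mu).
  by rewrite ker_diag eqxx mulr1.
by move=> nu nm; rewrite ker_diag (negPf nm).
Qed.

Lemma has_sum_ker_top N n (l : V N.+1) (g : V n -> R) (s : V N -> R) :
  (n <= N)%N -> (forall nu : V N, has_sum (fun mu => ker nu mu * g mu) (s nu)) ->
  has_sum (fun mu => ker l mu * g mu)
    (\sum_(nu <- finsupp (P l)) P l nu * s nu).
Proof.
move=> nN gs.
have := @has_sum_sum _ _ _ (finsupp (P l))
  (fun nu mu => P l nu * (ker nu mu * g mu)) (fun nu => P l nu * s nu).
move=> /(_ (fun nu => has_sumZ (P_ge0 l nu) (gs nu))).
apply: eq_has_sum => mu; rewrite ker_top// mulr_suml.
by apply: eq_bigr => nu _; rewrite mulrA.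
Qed.

Lemma has_sum_ker N n (l : V N) : (n <= N)%N ->
  has_sum (fun mu : V n => ker l mu) 1.
Proof.
elim: N l => [|N IH] l.
  rewrite leqn0 => /eqP n0; subst n.
  apply: eq_has_sum (has_sum_delta l ler01) => mu.
  by rewrite mulr1 ker_diag eq_sym.
rewrite leq_eqVlt => /orP[/eqP e|nN].
  subst n; apply: eq_has_sum (has_sum_delta l ler01) => mu.
  by rewrite mulr1 ker_diag eq_sym.
have := @has_sum_ker_top N n l (fun _ => 1) (fun _ => 1) nN.
under eq_bigr do rewrite mulr1; rewrite P_sum1 => H.
apply: eq_has_sum (H _) => [mu|nu]; first by rewrite mulr1.
by apply: eq_has_sum (IH nu nN) => mu; rewrite mulr1.
Qed.

Lemma has_sum_ker_bottom N n (l : V N) (mu : V n) : (n < N)%N ->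
  has_sum (fun nu : V n.+1 => ker l nu * P nu mu) (ker l mu).
Proof.
elim: N l => [//|N IH] l; rewrite ltnS leq_eqVlt => /orP[/eqP e|nN].
  subst n; rewrite ker_succ.
  apply: eq_has_sum (has_sum_delta l (P_ge0 l mu)) => nu.
  by rewrite ker_diag eq_sym; case: eqP => [->//|_]; rewrite !mul0r.
rewrite (ker_top _ _ (ltnW nN)).
exact: (has_sum_ker_top l nN (fun nu => IH nu nN)).
Qed.

Definition harmonic (M : forall n, V n -> R) : Prop :=
  forall n (mu : V n), has_sum (fun l : V n.+1 => M n.+1 l * P l mu) (M n mu).

Definition coh (M : forall n, V n -> R) : Prop :=
  (forall n, has_sum (M n) 1) /\ harmonic M.

Lemma harmonic_ge0 M : harmonic M -> forall n mu, 0 <= M n mu.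
Proof. by move=> hM n mu; exact: has_sum_ge0 (hM n mu). Qed.

Lemma harmonic_ker M N n (mu : V n) : harmonic M -> (n <= N)%N ->
  has_sum (fun l : V N => M N l * ker l mu) (M n mu).
Proof.
move=> hM; elim: N => [|N IH].
  rewrite leqn0 => /eqP n0; subst n.
  apply: eq_has_sum (has_sum_delta mu (harmonic_ge0 hM mu)) => l.
  by rewrite ker_diag mulrC; case: eqP => [->|]; rewrite ?mulr1 ?mulr0.
rewrite leq_eqVlt => /orP[/eqP e|nN].
  subst n; apply: eq_has_sum (has_sum_delta mu (harmonic_ge0 hM mu)) => l.
  by rewrite ker_diag mulrC; case: eqP => [->|]; rewrite ?mulr1 ?mulr0.
apply: (@has_sum_exchange _ _ _
  (fun (k : V N) (l : V N.+1) => M N.+1 l * P l k * ker k mu) _ _ _ _ _ (IH nN)).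
  move=> k; rewrite mulrC; apply: eq_has_sum (has_sumZ (ker_ge0 k mu) (hM N k)).
  by move=> l; rewrite mulrC.
move=> l; rewrite ker_top//.
have := has_sumZ (harmonic_ge0 hM l)
  (has_sum_row l (fun k => ker_ge0 k mu)).
by apply: eq_has_sum => k; rewrite mulrA.
Qed.

Lemma harmonic_lin M1 M2 a b : 0 <= a -> 0 <= b -> harmonic M1 -> harmonic M2 ->
  harmonic (fun n mu => a * M1 n mu + b * M2 n mu).
Proof.
move=> a0 b0 h1 h2 n mu.
apply: eq_has_sum (has_sumD (has_sumZ a0 (h1 n mu)) (has_sumZ b0 (h2 n mu))) => l.
by rewrite mulrDl !mulrA.
Qed.

Lemma harmonic_sub M1 M2 a b : 0 <= a -> 0 <= b ->
  (forall n (mu : V n), b * M2 n mu <= a * M1 n mu) ->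
  harmonic M1 -> harmonic M2 -> harmonic (fun n mu => a * M1 n mu - b * M2 n mu).
Proof.
move=> a0 b0 le h1 h2 n mu.
apply: eq_has_sum (has_sumB _ (has_sumZ a0 (h1 n mu)) (has_sumZ b0 (h2 n mu))) => l.
  by rewrite mulrBl !mulrA.
by rewrite !mulrA ler_wpM2r.
Qed.

(** ** Projecting a measure from a high level *)

Definition push N (f : V N -> R) n (mu : V n) : R :=
  sum_of (fun l => f l * ker l mu).

Section Push.
Variables (M : forall n, V n -> R) (c : R) (N : nat) (f : V N -> R).
Hypothesis hM : harmonic M.
Hypothesis c0 : 0 <= c.
Hypothesis fM : forall l, 0 <= f l <= c * M l.

Let f0 l : 0 <= f l. Proof. by case/andP: (fM l). Qed.

(** Domination by the coherent system [c M] makes all the sums converge. *)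
Lemma has_sum_push n (mu : V n) : (n <= N)%N ->
  has_sum (fun l => f l * ker l mu) (push f mu) /\ push f mu <= c * M mu.
Proof.
move=> nN; apply: (has_sum_compare _ (has_sumZ c0 (harmonic_ker mu hM nN))) => l.
rewrite mulr_ge0 ?ker_ge0//= mulrA ler_wpM2r ?ker_ge0//.
by case/andP: (fM l).
Qed.

Lemma push_ge0 n (mu : V n) : (n <= N)%N -> 0 <= push f mu.
Proof. by move=> /(has_sum_push mu)[H _]; exact: has_sum_ge0 H. Qed.

Lemma push_step n (mu : V n) : (n < N)%N ->
  has_sum (fun nu : V n.+1 => push f nu * P nu mu) (push f mu).
Proof.
move=> nN; have [H _] := has_sum_push mu (ltnW nN).
apply: (@has_sum_exchange _ _ _
  (fun (l : V N) (nu : V n.+1) => f l * ker l nu * P nu mu) _ _ _ _ _ H).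
  move=> l; apply: eq_has_sum (has_sumZ (f0 l) (has_sum_ker_bottom l mu nN)).
  by move=> nu; rewrite mulrA.
move=> nu; have [H' _] := has_sum_push nu nN.
rewrite mulrC; apply: eq_has_sum (has_sumZ (P_ge0 nu mu) H') => l.
by rewrite mulrC.
Qed.

Lemma push_mass n s : (n <= N)%N -> has_sum f s -> has_sum (push f (n := n)) s.
Proof.
move=> nN fs.
apply: (@has_sum_exchange _ _ _
  (fun (l : V N) (mu : V n) => f l * ker l mu) _ _ _ _ _ fs).
  by move=> l; have := has_sumZ (f0 l) (has_sum_ker l nN); rewrite mulr1.
by move=> mu; have [] := has_sum_push mu nN.
Qed.

Lemma push_compl n (mu : V n) : (n <= N)%N ->
  push (fun l => c * M l - f l) mu = c * M mu - push f mu.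
Proof.
move=> nN; have [H _] := has_sum_push mu nN.
apply: sum_ofE.
apply: eq_has_sum (has_sumB _ (has_sumZ c0 (harmonic_ker mu hM nN)) H) => l.
  by rewrite mulrBl mulrA.
by rewrite mulrA ler_wpM2r ?ker_ge0//; case/andP: (fM l).
Qed.

End Push.

(** ** Limits of projected measures *)

Definition limsys (U : set_system nat) (f : forall N, V N -> R) n (mu : V n) : R :=
  ulim U (fun N => push (f N) mu).

Section LimitSystem.
Variable U : set_system nat.
Hypothesis UU : UltraFilter U.
Hypothesis ooU : \oo `<=` U.
Variables (M : forall n, V n -> R) (c : R).
Hypothesis cohM : coh M.
Hypothesis c0 : 0 <= c.

Let hM : harmonic M := proj2 cohM.
Let UP : ProperFilter U := ultra_proper.

Lemma near_ge n : \forall N \near U, (n <= N)%N.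
Proof. by apply: ooU; exact: nbhs_infty_ge. Qed.

Let ler_lim (g1 g2 : nat -> R) (l1 l2 : R) : g1 N @[N --> U] --> l1 ->
  g2 N @[N --> U] --> l2 -> (\forall N \near U, g1 N <= g2 N) -> l1 <= l2.
Proof. exact: ler_cvg_to. Qed.

Let cst_lim (a : R) : a @[_ --> U] --> a.
Proof. exact: cvg_cst. Qed.

Definition dominated (f : forall N, V N -> R) :=
  forall N (l : V N), 0 <= f N l <= c * M l.

Lemma dominated_compl f : dominated f ->
  dominated (fun N l => c * M l - f N l).
Proof.
move=> fM N l; have /andP[f0 fc] := fM N l.
by rewrite subr_ge0 fc lerBlDr lerDl f0.
Qed.

Lemma cvg_limsys f n (mu : V n) : dominated f ->
  push (f N) mu @[N --> U] --> limsys U f mu.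
Proof.
move=> fM; apply: (@cvg_ulim _ _ UU _ (c * M mu)).
apply: filterS (near_ge n) => N nN.
have [_ le] := has_sum_push hM c0 (fM N) mu nN.
by rewrite ger0_norm// (push_ge0 hM c0 (fM N)).
Qed.

Lemma limsys_ge0 f n (mu : V n) : dominated f -> 0 <= limsys U f mu.
Proof.
move=> fM; apply: (ler_lim (@cst_lim 0) (@cvg_limsys _ _ mu fM)).
by apply: filterS (near_ge n) => N nN; exact: (push_ge0 hM c0 (fM N)).
Qed.

Lemma limsys_compl f n (mu : V n) : dominated f ->
  limsys U (fun N l => c * M l - f N l) mu = c * M mu - limsys U f mu.
Proof.
move=> fM; have c1 := @cvg_limsys _ _ mu (dominated_compl fM).
have c2 := cvgB (@cst_lim (c * M mu)) (@cvg_limsys _ _ mu fM).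
have E : {near U, (fun N => c * M mu - push (f N) mu) =1
                  (fun N => push (fun l => c * M l - f N l) mu)}.
  apply: filterS (near_ge n) => N nN /=.
  by rewrite (push_compl hM c0 (fM N)).
have c3 : push (fun l => c * M l - f N l) mu @[N --> U] -->
    c * M mu - limsys U f mu.
  exact: cvg_trans (near_eq_cvg E) (c2 _).
exact: (norm_cvg_unique c1 c3).
Qed.

Lemma limsys_le f n (mu : V n) : dominated f -> limsys U f mu <= c * M mu.
Proof.
move=> fM; rewrite -subr_ge0 -limsys_compl//.
exact/limsys_ge0/dominated_compl.
Qed.

(** A Fatou inequality: mass may only be lost in the limit. *)
Lemma limsys_step_le f n (mu : V n) : dominated f ->
  let g := fun nu : V n.+1 => limsys U f nu * P nu mu in
  has_sum g (sum_of g) /\ sum_of g <= limsys U f mu.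
Proof.
move=> fM g; apply: has_sum_bounded => [nu|r ur].
  by rewrite mulr_ge0// limsys_ge0.
apply: (ler_lim (@cvg_sum_seq R U _ _ r _ _
  (fun nu => cvgMr_tmp (b := P nu mu) (@cvg_limsys _ _ nu fM))) (@cvg_limsys _ _ mu fM)).
apply: filterS (near_ge n.+1) => N nN.
exact: has_sum_seq_le (push_step hM c0 (fM N) mu nN) ur.
Qed.

Lemma limsys_mass_le f (s : nat -> R) S n : dominated f ->
  (forall N, has_sum (f N) (s N)) -> s N @[N --> U] --> S ->
  let g := fun mu : V n => limsys U f mu in
  has_sum g (sum_of g) /\ sum_of g <= S.
Proof.
move=> fM fs sS g; apply: has_sum_bounded => [mu|r ur]; first exact: limsys_ge0.
apply: (ler_lim (@cvg_sum_seq R U _ _ r _ _ (fun mu => @cvg_limsys _ _ mu fM)) sS).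
apply: filterS (near_ge n) => N nN.
exact: has_sum_seq_le (push_mass hM c0 (fM N) nN (fs N)) ur.
Qed.

(** Domination excludes a loss of mass: the Fatou inequalities for [f] and for
    its complement [c M - f] add up to an equality. *)
Lemma harmonic_limsys f : dominated f -> harmonic (fun n (mu : V n) => limsys U f mu).
Proof.
move=> fM n mu; have [H1 le1] := limsys_step_le mu fM.
have [H2] := limsys_step_le mu (dominated_compl fM).
rewrite limsys_compl// => le2.
have E : c * M mu = sum_of (fun nu : V n.+1 => limsys U f nu * P nu mu) +
    sum_of (fun nu : V n.+1 => limsys U (fun N l => c * M l - f N l) nu * P nu mu).
  apply: (has_sum_uniq (has_sumZ c0 (hM mu))).
  apply: eq_has_sum (has_sumD H1 H2) => nu.
  by rewrite limsys_compl// mulrBl [LHS]addrC subrK mulrA.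
suff -> : limsys U f mu = sum_of (fun nu : V n.+1 => limsys U f nu * P nu mu) by [].
by apply/eqP; rewrite eq_le le1 andbT; lra.
Qed.

Lemma limsys_mass f (s : nat -> R) S n : dominated f ->
  (forall N, has_sum (f N) (s N)) -> s N @[N --> U] --> S ->
  has_sum (fun mu : V n => limsys U f mu) S.
Proof.
move=> fM fs sS; have [H1 le1] := limsys_mass_le n fM fs sS.
have fs' N : has_sum (fun l => c * M l - f N l) (c - s N).
  apply: has_sumB (fs N) => [l|]; first by case/andP: (fM N l).
  by have := has_sumZ c0 (proj1 cohM N); rewrite mulr1.
have sS' := cvgB (@cst_lim c) sS.
have [H2 le2] := limsys_mass_le n (dominated_compl fM) fs' (sS' _).
have E : c = sum_of (fun mu : V n => limsys U f mu) +
    sum_of (fun mu : V n => limsys U (fun N l => c * M l - f N l) mu).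
  have := has_sumZ c0 (proj1 cohM n); rewrite mulr1 => H3.
  apply: (has_sum_uniq H3); apply: eq_has_sum (has_sumD H1 H2) => mu.
  by rewrite limsys_compl// addrC subrK.
suff -> : S = sum_of (fun mu : V n => limsys U f mu) by [].
by apply/eqP; rewrite eq_le le1 andbT; lra.
Qed.

End LimitSystem.

(** ** Extreme systems are limits along single points *)

Lemma ker_le1 N n (l : V N) (mu : V n) : ker l mu <= 1.
Proof.
elim: N l => [|N IH] l /=; first by case: eqP.
case: eqP => _; first by case: eqP.
rewrite -(P_sum1 l); apply: ler_sum => nu _.
by rewrite -[leRHS]mulr1 ler_wpM2l.
Qed.

Definition extreme (M : forall n, V n -> R) : Prop :=
  coh M /\ forall M1 M2 t, coh M1 -> coh M2 -> 0 < t < 1 ->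
    (forall n mu, M n mu = t * M1 n mu + (1 - t) * M2 n mu) ->
    (forall n mu, M1 n mu = M n mu) /\ (forall n mu, M2 n mu = M n mu).

Definition martin (M : forall n, V n -> R) : Prop :=
  coh M /\ exists lam : forall N, V N,
    forall n (mu : V n), ker (lam N) mu @[N --> \oo] --> M n mu.

Lemma exists_lt_mean n (M g : V n -> R) v e : (forall l, 0 <= M l) ->
  has_sum M 1 -> has_sum (fun l => M l * g l) v -> v < e -> exists l, g l < e.
Proof.
move=> M0 M1 Mg ve; apply: contrapT => nex.
have ge l : e <= g l by rewrite leNgt; apply/negP => H; apply: nex; exists l.
have e0 : 0 <= e by rewrite (le_trans (has_sum_ge0 Mg))// ltW.
have := has_sumZ e0 M1; rewrite mulr1 => He.
suff : e <= v by lra.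
by apply: (ler_has_sum _ He Mg) => l; rewrite mulrC ler_wpM2l.
Qed.

Section Extreme.
Variable M : forall n, V n -> R.
Hypothesis exM : extreme M.

Let cohM : coh M := proj1 exM.
Let hM : harmonic M := proj2 cohM.
Let M_ge0 := harmonic_ge0 hM.
Variables (k : nat) (mu0 : V k).
Let th := M mu0.
Let f N (l : V N) := M l * ker l mu0.

Let th01 : 0 <= th <= 1.
Proof. by rewrite M_ge0 (has_sum_le_at _ (proj1 cohM k)). Qed.

Let fdom : dominated M 1 f.
Proof.
move=> N l; rewrite /f mul1r mulr_ge0 ?ker_ge0//=.
by rewrite -[leRHS]mulr1 ler_wpM2l// ker_le1.
Qed.

(** The measures tilted by the probability to reach [mu0] have a coherent limit
    [T] with [0 <= T <= M], so [M] is the midpoint of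
    [(1 - th / 2) M + T / 2] and [(1 + th / 2) M - T / 2]. *)
Let tilted U : UltraFilter U -> \oo `<=` U ->
  forall n (mu : V n), limsys U f mu = th * M mu.
Proof.
move=> UU ooU; have UP : ProperFilter U by exact: ultra_proper.
have hT := harmonic_limsys UU ooU cohM ler01 fdom.
have fs N : has_sum (@f N) (sum_of (@f N)).
  apply: (proj1 (has_sum_compare _ (proj1 cohM N))) => l.
  by have := fdom l; rewrite mul1r.
have sT : sum_of (@f N) @[N --> U] --> th.
  have E : {near U, (fun _ => th) =1 (fun N => sum_of (@f N))}.
    by apply: filterS (near_ge ooU k) => N kN; rewrite (sum_ofE (harmonic_ker mu0 hM kN)).
  exact: cvg_trans (near_eq_cvg E) (cvg_cst _).
have mT n : has_sum (fun mu : V n => limsys U f mu) th.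
  exact: (limsys_mass UU ooU cohM ler01 n fdom fs sT).
have T0 n (mu : V n) : 0 <= limsys U f mu.
  exact: (limsys_ge0 UU ooU cohM ler01 mu fdom).
have TM n (mu : V n) : limsys U f mu <= M mu.
  by rewrite -[leRHS]mul1r; exact: (limsys_le UU ooU cohM ler01 mu fdom).
have /andP[th0 th1] := th01.
pose M1 n (mu : V n) := (1 - th / 2) * M mu + 2^-1 * limsys U f mu.
pose M2 n (mu : V n) := (1 + th / 2) * M mu - 2^-1 * limsys U f mu.
have a1 : 0 <= 1 - th / 2 by lra.
have a2 : 0 <= 1 + th / 2 by lra.
have b0 : 0 <= 2^-1 :> R by lra.
have c1 : coh M1.
  split=> [n|]; last exact: harmonic_lin.
  have := has_sumD (has_sumZ a1 (proj1 cohM n)) (has_sumZ b0 (mT n)).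
  by rewrite (_ : (1 - th / 2) * 1 + 2^-1 * th = 1)//; lra.
have le n (mu : V n) : 2^-1 * limsys U f mu <= (1 + th / 2) * M mu.
  have := TM n mu; have := M_ge0 mu; have := T0 n mu; nra.
have c2 : coh M2.
  split=> [n|]; last exact: harmonic_sub.
  have := has_sumB (le n) (has_sumZ a2 (proj1 cohM n)) (has_sumZ b0 (mT n)).
  by rewrite (_ : (1 + th / 2) * 1 - 2^-1 * th = 1)//; lra.
have [] := proj2 exM M1 M2 2^-1 c1 c2.
- by apply/andP; split; lra.
- by move=> n mu; rewrite /M1 /M2; lra.
by move=> eq1 _ n mu; have := eq1 n mu; rewrite /M1; lra.
Qed.

Let mean_sq N := sum_of (fun l : V N => M l * ker l mu0 ^+ 2).

Let cvg_mean_sq : mean_sq N @[N --> \oo] --> th ^+ 2.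
Proof.
apply: cvg_all_ultra => U UU ooU.
rewrite expr2 -[th * th](tilted UU ooU mu0).
rewrite (_ : (fun N => mean_sq N) = fun N => push (@f N) mu0).
  exact: (cvg_limsys UU ooU cohM ler01 (mu := mu0) fdom).
apply/funext => N; rewrite /mean_sq /push; congr sum_of.
by apply/funext => l; rewrite /f expr2 mulrA.
Qed.

(** The variance at level [N] of the probability to reach [mu0] tends to 0. *)
Lemma extreme_variance : exists2 v : nat -> R, v N @[N --> \oo] --> (0 : R) &
  forall N, (k <= N)%N ->
    has_sum (fun l : V N => M l * (ker l mu0 - th) ^+ 2) (v N).
Proof.
exists (fun N => mean_sq N - th ^+ 2).
  rewrite -[X in _ --> X](subrr (th ^+ 2)).
  by apply: cvgB => //; exact: cvg_cst.
move=> N kN.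
have /andP[th0 th1] := th01.
have H2 : has_sum (fun l : V N => M l * ker l mu0 ^+ 2) (mean_sq N).
  apply: (proj1 (has_sum_compare _ (proj1 cohM N))) => l.
  rewrite mulr_ge0 ?exprn_ge0 ?ker_ge0//= -[leRHS]mulr1 ler_wpM2l//.
  by rewrite exprn_ile1 ?ker_ge0 ?ker_le1.
have H1 := has_sumZ (_ : 0 <= 2 * th) (harmonic_ker mu0 hM kN).
have H0 := has_sumZ (_ : 0 <= th ^+ 2) (proj1 cohM N).
have p1 : 0 <= 2 * th by lra.
have p2 : 0 <= th ^+ 2 by nra.
have := has_sumB _ (has_sumD H2 (H0 p2)) (H1 p1).
rewrite (_ : mean_sq N + _ - _ = mean_sq N - th ^+ 2); last by rewrite -/th; ring.
move=> H; apply: eq_has_sum (H _) => l; first by ring.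
have := M_ge0 l; have := sqr_ge0 (ker l mu0 - th); nra.
Qed.

End Extreme.

(** A countable choice of levels and points at which all the variances are
    simultaneously small produces the approximating sequence. *)
Theorem extreme_martin (en : nat -> option {n & V n}) M :
  (forall x, exists i, en i = Some x) -> extreme M -> martin M.
Proof.
move=> enP exM; have cohM := proj1 exM; have hM := proj2 cohM.
have M_ge0 := harmonic_ge0 hM.
split=> //.
pose dev N (i : nat) (l : V N) : R := if en i is Some (existT k mu)
  then (ker l mu - M k mu) ^+ 2 else 0.
have dev0 N i (l : V N) : 0 <= dev N i l.
  by rewrite /dev; case: (en i) => [[k mu]|//]; exact: sqr_ge0.
have vdev i : exists2 v : nat -> R, v N @[N --> \oo] --> (0 : R) &
    \forall N \near \oo, has_sum (fun l : V N => M N l * dev N i l) (v N).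
  rewrite /dev; case: (en i) => [[k mu]|]; last first.
    exists (fun _ => 0); first exact: cvg_cst.
    apply: nearW => N; apply: eq_has_sum (has_sum0 _ (V N)) => l.
    by rewrite mulr0.
  have [v v0 Hv] := extreme_variance exM mu; exists v => //.
  by apply: filterS (nbhs_infty_ge k) => N; exact: Hv.
pose good p N (l : V N) := forall i, (i < p)%N -> dev N i l <= p.+1%:R^-1.
have goodP p : \forall N \near \oo, exists l, good p N l.
  have [v v0 Hv] : exists2 v : nat -> R, v N @[N --> \oo] --> (0 : R) &
      \forall N \near \oo,
        has_sum (fun l : V N => M N l * \sum_(i < p) dev N i l) (v N).
    elim: p => [|p [v v0 Hv]].
      exists (fun _ => 0); first exact: cvg_cst.
      apply: nearW => N; apply: eq_has_sum (has_sum0 _ (V N)) => l.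
      by rewrite big_ord0 mulr0.
    have [w w0 Hw] := vdev p; exists (fun N => v N + w N).
      by rewrite -[X in _ --> X](addr0 0); apply: cvgD.
    apply: filterS2 Hv Hw => N Hv Hw.
    apply: eq_has_sum (has_sumD Hv Hw) => l.
    by rewrite big_ord_recr /= mulrDr.
  have p0 : 0 < p.+1%:R^-1 :> R by rewrite invr_gt0.
  have v1 : \forall N \near \oo, v N < p.+1%:R^-1 by exact: (cvgr_lt _ v0).
  apply: filterS2 Hv v1 => N Hv v1.
  have [l Hl] := exists_lt_mean (@M_ge0 N) (proj1 cohM N) Hv v1.
  exists l => i ip; apply: le_trans (ltW Hl).
  by rewrite (bigD1 (Ordinal ip))//= lerDl sumr_ge0.
have V0 N : exists l : V N, True.
  have [l _] := exists_lt_mean (@M_ge0 N) (proj1 cohM N) (g := fun _ => 0) (v := 0)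
    (e := 1) (eq_has_sum (fun l => esym (mulr0 (M N l))) (has_sum0 _ (V N))) ltr01.
  by exists l.
(* [lam N] is good for the largest [p <= N] for which a good point exists. *)
have lamP N : exists l : V N, exists2 p, good p N l &
    forall p', (p' <= N)%N -> (exists l', good p' N l') -> (p' <= p)%N.
  pose b p := `[< exists l, good p N l >] && (p <= N)%N.
  have b0 : exists p, b p.
    by exists 0%N; rewrite /b leq0n andbT; apply/asboolP; have [l _] := V0 N; exists l.
  have bN p : b p -> (p <= N)%N by case/andP.
  case: (ex_maxnP b0 bN) => p /andP[/asboolP[l gl] _] pmax.
  exists l, p => // p' p'N ex'; apply: pmax; rewrite /b p'N andbT.
  exact/asboolP.
pose lam N := projT1 (cid (lamP N)).
exists lam => k mu.
have [i ei] := enP (existT _ k mu).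
apply/cvgrPdist_le => e e0.
(* [p] exceeds the number of [mu] in the enumeration, and [p.+1^-1 < e ^ 2]. *)
pose p := maxn i.+1 (Num.truncn (e ^- 2)).
apply: filterS2 (goodP p) (nbhs_infty_ge p) => N gp pN.
rewrite /lam; case: (cid (lamP N)) => l /= [p1 gl pmax].
have pp1 := pmax p pN gp.
have ip1 : (i < p1)%N by apply: leq_trans pp1; rewrite leq_maxl.
have le1 : (ker l mu - M k mu) ^+ 2 <= p1.+1%:R^-1 by have := gl i ip1; rewrite /dev ei.
rewrite distrC -ler_sqr ?nnegrE//; last exact: ltW.
rewrite real_normK ?num_real//.
apply: le_trans le1 _; rewrite -[leRHS]invrK lef_pV2 ?posrE ?invr_gt0 ?exprn_gt0//.
apply: ltW; apply: lt_le_trans (Num.Theory.truncnS_gt _) _.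
by rewrite ler_nat ltnS; apply: leq_trans pp1; rewrite leq_maxr.
Qed.

(** ** Limits along points are extreme *)

Section Events.
Variables (T : choiceType) (M : T -> R).
Hypothesis M1 : has_sum M 1.

Definition mass_on (B : pred T) : R := sum_of (fun x => M x * (B x)%:R).

Lemma has_sum_mass_on (B : pred T) : has_sum (fun x => M x * (B x)%:R) (mass_on B).
Proof.
apply: (proj1 (has_sum_compare _ M1)) => x; have [M0 _] := M1.
by case: (B x); rewrite ?mulr1 ?mulr0 ?lexx M0.
Qed.

Lemma mass_on_compl (B : pred T) : has_sum (fun x => M x * (~~ B x)%:R) (1 - mass_on B).
Proof.
have [M0 _] := M1.
apply: eq_has_sum (has_sumB _ M1 (has_sum_mass_on B)) => x.
  by case: (B x); rewrite ?mulr1 ?mulr0 ?subrr ?subr0.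
by case: (B x); rewrite ?mulr1 ?mulr0 ?lexx.
Qed.

Lemma mass_on_seq (B : pred T) (A : {fset T}) : mass_on B <=
  \sum_(x <- A) M x * (B x)%:R + (1 - \sum_(x <- A) M x).
Proof.
have [M0 _] := M1.
have HA : has_sum (fun x => M x * (x \in A)%:R) (\sum_(x <- A) M x).
  have := @has_sum_supp _ _ (fun x => M x * (x \in A)%:R) A.
  rewrite (eq_big_seq (fun x => M x)); last by move=> x ->; rewrite mulr1.
  by apply=> x; [rewrite mulr_ge0|move/negPf->; rewrite mulr0].
have HB : has_sum (fun x => M x * ((x \in A) && B x)%:R)
    (\sum_(x <- A) M x * (B x)%:R).
  have := @has_sum_supp _ _ (fun x => M x * ((x \in A) && B x)%:R) A.
  rewrite (eq_big_seq (fun x => M x * (B x)%:R)); last by move=> x ->.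
  by apply=> x; [rewrite mulr_ge0|move/negPf->; rewrite mulr0].
have HC := has_sumB _ M1 HA.
apply: (ler_has_sum _ (has_sum_mass_on B) (has_sumD HB (HC _))) => x.
  have := M0 x; case: (x \in A); case: (B x); rewrite /= ?mulr1 ?mulr0; lra.
by have := M0 x; case: (x \in A); rewrite ?mulr1 ?mulr0; lra.
Qed.

End Events.

Lemma has_sum_approx (T : choiceType) (f : T -> R) s e : has_sum f s -> 0 < e ->
  exists A : {fset T}, s - e < \sum_(x <- A) f x.
Proof.
move=> fs e0; apply: contrapT => nA.
have [H le1] : has_sum f (sum_of f) /\ sum_of f <= s - e.
  apply: has_sum_bounded => [x|r ur]; first by case: fs.
  rewrite leNgt; apply/negP => lt; apply: nA; exists [fset x in r]%fset.
  rewrite (perm_big r)//=; apply: uniq_perm => // x.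
  by rewrite !inE.
by have := has_sum_uniq fs H; lra.
Qed.

(** Scheffe's lemma: pointwise convergence of probability weights is uniform
    over all events. *)
Lemma mass_on_cvg (T : choiceType) (f : nat -> T -> R) (M : T -> R) e :
  (forall N, has_sum (f N) 1) -> has_sum M 1 ->
  (forall x, f N x @[N --> \oo] --> M x) -> 0 < e ->
  \forall N \near \oo, forall B, mass_on (f N) B <= mass_on M B + e.
Proof.
move=> f1 M1 fM e0; have e30 : 0 < e / 3 by lra.
have [A HA] := has_sum_approx M1 e30.
have d0 : (\sum_(x <- A) `|f N x - M x|) @[N --> \oo] --> (0 : R).
  rewrite -[X in _ --> X](_ : \sum_(x <- A) (0 : R) = 0); last by rewrite big1.
  apply: cvg_sum_seq => x.
  rewrite -[X in _ --> X](@normr0 _ R); apply: cvg_norm.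
  rewrite -[X in _ --> X](subrr (M x)); apply: cvgB => //; exact: cvg_cst.
have : \forall N \near \oo, \sum_(x <- A) `|f N x - M x| < e / 3.
  exact: (cvgr_lt _ d0).
apply: filterS => N dN B; apply: le_trans (mass_on_seq (f1 N) B A) _.
have le1 : \sum_(x <- A) f N x * (B x)%:R <=
    \sum_(x <- A) M x * (B x)%:R + \sum_(x <- A) `|f N x - M x|.
  rewrite -big_split /=; apply: ler_sum => x _.
  have := ler_norm (f N x - M x); have := normr_ge0 (f N x - M x).
  by case: (B x); rewrite /= ?mulr1 ?mulr0; lra.
have le2 : \sum_(x <- A) M x <=
    \sum_(x <- A) f N x + \sum_(x <- A) `|f N x - M x|.
  rewrite -big_split /=; apply: ler_sum => x _.
  by have := ler_norm (- (f N x - M x)); rewrite normrN; lra.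
have le3 : \sum_(x <- A) M x * (B x)%:R <= mass_on M B.
  by apply: has_sum_seq_le (has_sum_mass_on M1 B) _; exact: fset_uniq.
lra.
Qed.

(** In the application, [tail s mu] consists of the last [s] parts of [mu], and
    one step of the chain preserves it with a probability that tends to 1 fast
    enough with the level. *)
Section Concentration.
Variables (S : eqType) (tail : nat -> forall n, V n -> S) (C q : R).
Hypothesis C_gt0 : 0 < C.
Hypothesis q01 : 0 < q < 1.
Hypothesis tail_inj : forall n (mu mu' : V n),
  tail n.+1 mu = tail n.+1 mu' -> mu = mu'.
Hypothesis tail_row : forall n s (l : V n.+1), (s <= n.+1)%N ->
  expR (- (C * q ^+ (n.+1 - s))) <=
  \sum_(mu <- finsupp (P l)) P l mu * (tail s mu == tail s l)%:R.

Let q0 : 0 < q. Proof. by case/andP: q01. Qed.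
Let q1 : 0 < 1 - q. Proof. by case/andP: q01; rewrite subr_gt0. Qed.

(** The product of the bounds [exp (- C q ^ j)], [r <= j]: with [r = n.+1 - s],
    it bounds the probability that the tail of length [s] survives all the steps
    from an arbitrarily high level down to level [n]. *)
Definition kap (r : nat) : R := expR (- (C / (1 - q) * q ^+ r)).

Lemma kap_gt0 r : 0 < kap r. Proof. exact: expR_gt0. Qed.

Lemma kap_lt1 r : kap r < 1.
Proof. by rewrite /kap expR_lt1 oppr_lt0 mulr_gt0 ?divr_gt0// exprn_gt0. Qed.

Lemma cvg_kap : kap r @[r --> \oo] --> (1 : R).
Proof.
have qr : q ^+ r @[r --> \oo] --> (0 : R).
  by apply: cvg_expr; rewrite ger0_norm ?ltW//; case/andP: q01.
have H : - (C / (1 - q) * q ^+ r) @[r --> \oo] --> - (C / (1 - q) * 0).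
  by apply: cvgN; apply: cvgMr.
have := cvg_comp _ _ H (@continuous_expR R _).
by rewrite mulr0 oppr0 expR0.
Qed.

Definition tail_eq s (t : S) n (mu : V n) : bool := tail s mu == t.
Arguments tail_eq s t {n} mu.

(** The exponents of the single steps form a geometric series, so the bound does
    not depend on the height of the starting level. *)
Lemma tail_ker N n s (l : V N) : (n <= N)%N -> (s <= n.+1)%N ->
  kap (n.+1 - s) <=
  mass_on (fun mu : V n => ker l mu) (tail_eq s (tail s l)).
Proof.
move=> nN sn; pose b N := expR (- (C / (1 - q) * (q ^+ (n.+1 - s) - q ^+ (N.+1 - s)))).
suff H : b N <= mass_on (fun mu : V n => ker l mu) (tail_eq s (tail s l)).
  apply: le_trans H; rewrite /kap /b ler_expR lerN2 ler_wpM2l//.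
    by rewrite divr_ge0 ?ltW.
  by rewrite gerBl exprn_ge0// ltW.
elim: N nN l => [|N IH] nN l.
  move: nN; rewrite leqn0 => /eqP n0; subst n.
  rewrite /b subrr mulr0 oppr0 expR0.
  have := has_sum_le_at l (has_sum_mass_on (has_sum_ker l (leqnn 0)) (tail_eq s (tail s l))).
  by rewrite ker_diag /tail_eq !eqxx mulr1.
move: nN; rewrite leq_eqVlt => /orP[/eqP e|nN].
  subst n; rewrite /b subrr mulr0 oppr0 expR0.
  have := has_sum_le_at l (has_sum_mass_on (has_sum_ker l (leqnn N.+1)) (tail_eq s (tail s l))).
  by rewrite ker_diag /tail_eq !eqxx mulr1.
have H := has_sum_ker_top l nN (fun nu =>
  has_sum_mass_on (has_sum_ker nu nN) (tail_eq s (tail s l))).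
rewrite {1}/mass_on (sum_ofE H).
have sN : (s <= N.+1)%N by rewrite (leq_trans sn).
apply: (@le_trans _ _ (\sum_(nu <- finsupp (P l)) P l nu * (tail s nu == tail s l)%:R * b N)).
  rewrite -mulr_suml.
  apply: (@le_trans _ _ (expR (- (C * q ^+ (N.+1 - s))) * b N)); last first.
    by rewrite ler_wpM2r ?expR_ge0// tail_row.
  rewrite /b -expRD ler_expR.
  rewrite (subSn sN) exprS.
  rewrite le_eqVlt; apply/orP; left; apply/eqP; field.
  by rewrite gt_eqF.
apply: ler_sum => nu _; rewrite -mulrA ler_wpM2l//.
case: eqP => [e|_].
  by rewrite mul1r -e; exact: IH.
by rewrite mul0r; exact: has_sum_ge0 (has_sum_mass_on (has_sum_ker nu nN) _).
Qed.

Lemma tail_mass M N n s t : coh M -> (n <= N)%N -> (s <= n.+1)%N ->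
  kap (n.+1 - s) * mass_on (M N) (tail_eq s t) <= mass_on (M n) (tail_eq s t).
Proof.
move=> [M1 hM] nN sn.
have M0 := harmonic_ge0 hM.
have H : has_sum (fun l : V N => M N l *
    mass_on (fun mu : V n => ker l mu) (tail_eq s t)) (mass_on (M n) (tail_eq s t)).
  apply: (@has_sum_exchange _ _ _
    (fun (mu : V n) (l : V N) => M N l * (ker l mu * (tail_eq s t mu)%:R))
    _ _ _ _ _ (has_sum_mass_on (M1 n) (tail_eq s t))).
    move=> mu; rewrite mulrC.
    apply: eq_has_sum (has_sumZ (ler0n _ _) (harmonic_ker mu hM nN)) => l.
    by ring.
  by move=> l; exact: has_sumZ (M0 N l) (has_sum_mass_on (has_sum_ker l nN) _).
apply: (ler_has_sum _
  (has_sumZ (ltW (kap_gt0 _)) (has_sum_mass_on (M1 N) (tail_eq s t))) H) => l.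
rewrite mulrCA ler_wpM2l//; rewrite {1}/tail_eq; case: eqP => [<-|_].
  by rewrite mulr1; exact: tail_ker.
by rewrite mulr0; exact: has_sum_ge0 (has_sum_mass_on (has_sum_ker l nN) _).
Qed.

(** Bounds at all levels at once are what makes the class pass to components:
    since they tend to 1 with the level, no component can escape them. *)
Definition tail_class (tau : nat -> S) (M : forall n, V n -> R) : Prop :=
  coh M /\ forall n s, (s <= n.+1)%N ->
    kap (n.+1 - s) <= mass_on (M n) (tail_eq s (tau s)).

Lemma cvg_kap_shift s : kap (N.+1 - s) @[N --> \oo] --> (1 : R).
Proof.
rewrite -(cvg_shiftn s); have := cvg_kap; rewrite -(cvg_shiftS kap).
apply: cvg_trans; apply: near_eq_cvg; apply: nearW => N /=.
by rewrite -addSn addnK.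
Qed.

(** A component of [M] inherits asymptotically certain events from [M], and the
    estimate for one matrix step turns these into quantitative bounds. *)
Lemma tail_class_component tau M M1 t : tail_class tau M -> coh M1 -> 0 < t ->
  (forall n (mu : V n), t * M1 n mu <= M n mu) -> tail_class tau M1.
Proof.
move=> [cM HM] c1 t0 le; split=> // n s sn.
have near N : (n <= N)%N ->
    kap (n.+1 - s) * (1 - (1 - kap (N.+1 - s)) / t) <= mass_on (M1 n) (tail_eq s (tau s)).
  move=> nN; apply: le_trans (tail_mass (tau s) c1 nN sn).
  apply: ler_wpM2l; first exact: ltW (kap_gt0 _).
  have sN : (s <= N.+1)%N by apply: leq_trans sn _.
  suff : t * (1 - mass_on (M1 N) (tail_eq s (tau s))) <= 1 - kap (N.+1 - s).
    by rewrite mulrC -ler_pdivlMr// => H; lra.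
  apply: (@le_trans _ _ (1 - mass_on (M N) (tail_eq s (tau s)))); last first.
    by have := HM N s sN; lra.
  apply: (ler_has_sum _ (has_sumZ (ltW t0) (mass_on_compl (proj1 c1 N) (tail_eq s (tau s))))
    (mass_on_compl (proj1 cM N) (tail_eq s (tau s)))) => mu.
  by rewrite mulrA ler_wpM2r.
have lim : kap (n.+1 - s) * (1 - (1 - kap (N.+1 - s)) / t) @[N --> \oo] -->
    kap (n.+1 - s) * (1 - (1 - 1) / t).
  apply: cvgMr; apply: cvgB; first exact: cvg_cst.
  by apply: cvgMl; apply: cvgB; [exact: cvg_cst|exact: cvg_kap_shift].
have := ler_cvg_to lim (cvg_cst (mass_on (M1 n) (tail_eq s (tau s)))).
rewrite subrr mul0r subr0 mulr1; apply.
by apply: filterS (nbhs_infty_ge n) => N; exact: near.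
Qed.

(** At level [n] the tail of length [n.+1] determines the point, so the bound for
    this tail is a bound for a single atom. *)
Lemma tail_class_atom tau M n nu : tail_class tau M -> tail n.+1 nu = tau n.+1 ->
  kap 0 <= M n nu.
Proof.
move=> [cM HM] nut; have := HM n n.+1 (leqnn _); rewrite subnn => /le_trans; apply.
have M0 := harmonic_ge0 (proj2 cM).
apply: (ler_has_sum _ (has_sum_mass_on (proj1 cM n) _) (has_sum_delta nu (M0 n nu))) => mu.
rewrite /tail_eq -nut; case: (eqVneq mu nu) => [->|ne]; first by rewrite eqxx mulr1 mul1r.
by case: eqP => [/tail_inj e|_]; [rewrite e eqxx in ne|rewrite mulr0 mul0r].
Qed.

Lemma tail_class_point tau M n : tail_class tau M ->
  exists nu : V n, tail n.+1 nu = tau n.+1.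
Proof.
move=> [cM HM]; apply: contrapT => nex.
have := HM n n.+1 (leqnn _); apply/negP; rewrite -ltNge subnn.
rewrite (_ : mass_on _ _ = 0) ?kap_gt0//; apply: sum_ofE.
apply: eq_has_sum (has_sum0 _ (V n)) => mu; rewrite /tail_eq.
by case: eqP => [e|_]; [case: nex; exists mu|rewrite mulr0].
Qed.

(** All members of a class dominate a multiple of one and the same coherent
    system; removing it repeatedly exhausts the whole mass. *)
Lemma tail_class_unique tau M M' : tail_class tau M -> tail_class tau M' ->
  forall n (mu : V n), M n mu = M' n mu.
Proof.
move=> KM KM'.
pose nu N := projT1 (cid (tail_class_point N KM)).
have nuE N : tail N.+1 (nu N) = tau N.+1 by rewrite /nu; case: cid.
have [U [UU ooU]] := @ultraFilterLemma _ (\oo) _.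
have UP : ProperFilter U by exact: ultra_proper.
pose f N (l : V N) : R := (l == nu N)%:R.
pose m n (mu : V n) := limsys U f mu.
set d := kap 0; have d0 : 0 < d := kap_gt0 0; have d1 : d < 1 := kap_lt1 0.
have fdom M1 : tail_class tau M1 -> dominated M1 d^-1 f.
  move=> K1 N l; rewrite /f ler0n /=; have M0 := harmonic_ge0 (proj2 (proj1 K1)).
  case: eqP => [->|_]; last by rewrite mulr_ge0// invr_ge0 ltW.
  by rewrite ler_pdivlMl// mulr1; exact: tail_class_atom K1 (nuE N).
have dV0 : 0 <= d^-1 by rewrite invr_ge0 ltW.
have cm : coh m.
  split; last exact: (harmonic_limsys UU ooU (proj1 KM) dV0 (fdom _ KM)).
  move=> n; have f1 N : has_sum (f N) 1.
    by apply: eq_has_sum (has_sum_delta (nu N) ler01) => l; rewrite mulr1.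
  apply: (limsys_mass UU ooU (proj1 KM) dV0 n (fdom _ KM) f1).
  exact: cvg_cst.
have m0 := harmonic_ge0 (proj2 cm).
have dm M1 : tail_class tau M1 -> forall n (mu : V n), d * m n mu <= M1 n mu.
  move=> K1 n mu; rewrite -ler_pdivlMl//.
  exact: (limsys_le UU ooU (proj1 K1) dV0 mu (fdom _ K1)).
have iter k : forall M1, tail_class tau M1 -> forall n (mu : V n),
    (1 - (1 - d) ^+ k) * m n mu <= M1 n mu.
  elim: k => [|k IH] M1 K1 n mu.
    by rewrite expr0 subrr mul0r; exact: harmonic_ge0 (proj2 (proj1 K1)) _ _.
  pose M2 n (mu : V n) := (1 - d)^-1 * M1 n mu - ((1 - d)^-1 * d) * m n mu.
  have e0 : 0 < 1 - d by lra.
  have a0 : 0 <= (1 - d)^-1 by rewrite invr_ge0 ltW.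
  have b0 : 0 <= (1 - d)^-1 * d by rewrite mulr_ge0// ltW.
  have le i (x : V i) : (1 - d)^-1 * d * m i x <= (1 - d)^-1 * M1 i x.
    by rewrite -mulrA ler_wpM2l// dm.
  have c2 : coh M2.
    split=> [i|]; last by apply: harmonic_sub => //; [case: K1 => [[]]|case: cm].
    have := has_sumB (le i) (has_sumZ a0 (proj1 (proj1 K1) i)) (has_sumZ b0 (proj1 cm i)).
    by rewrite (_ : (1 - d)^-1 * 1 - (1 - d)^-1 * d * 1 = 1)//; field; rewrite gt_eqF.
  have M1E i (x : V i) : M1 i x = (1 - d) * M2 i x + d * m i x.
    by rewrite /M2; field; rewrite gt_eqF.
  have K2 : tail_class tau M2.
    apply: (tail_class_component K1 c2 e0) => i x.
    by rewrite [leRHS]M1E lerDl mulr_ge0// ltW.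
  have := IH M2 K2 n mu; rewrite M1E exprS => H.
  have : (1 - d) * ((1 - (1 - d) ^+ k) * m n mu) <= (1 - d) * M2 n mu.
    by rewrite ler_wpM2l// ltW.
  lra.
have mle M1 : tail_class tau M1 -> forall n (mu : V n), m n mu <= M1 n mu.
  move=> K1 n mu.
  have lim : (1 - (1 - d) ^+ k) * m n mu @[k --> \oo] --> (1 - 0) * m n mu.
    apply: cvgMl; apply: cvgB; first exact: cvg_cst.
    by apply: cvg_expr; rewrite ger0_norm; lra.
  have := ler_cvg_to lim (cvg_cst (M1 n mu)).
  by rewrite subr0 mul1r; apply; apply: nearW => k; exact: iter.
have eqm M1 : tail_class tau M1 -> forall n (mu : V n), M1 n mu = m n mu.
  move=> K1 n mu; have := has_sumB (mle _ K1 n) (proj1 (proj1 K1) n) (proj1 cm n).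
  rewrite subrr => /(has_sum_le_at mu); rewrite subr_le0 => H.
  by apply/eqP; rewrite eq_le H mle.
by move=> n mu; rewrite (eqm _ KM) (eqm _ KM').
Qed.

(** For a suitable level [n] and all large [N], the tail of length [s] of the
    point [lam N] has probability above 1/2 under [M n]; two different tails
    cannot both have this, so the tails of the points stabilize. *)
Lemma martin_tail_class M : martin M -> exists tau, tail_class tau M.
Proof.
move=> [cM [lam lamM]].
suff H s : exists t, forall n, (s <= n.+1)%N ->
    kap (n.+1 - s) <= mass_on (M n) (tail_eq s t).
  exists (fun s => projT1 (cid (H s))); split=> // n s sn.
  by case: (cid (H s)) => t /= /(_ n sn).
have close n e : (s <= n.+1)%N -> 0 < e -> \forall N \near \oo,
    kap (n.+1 - s) <= mass_on (M n) (tail_eq s (tail s (lam N))) + e.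
  move=> sn e0.
  pose g N : V n -> R := if (n <= N)%N then (fun mu => ker (lam N) mu) else M n.
  have g1 N : has_sum (g N) 1.
    by rewrite /g; case: ifP => [/has_sum_ker//|_]; exact: (proj1 cM).
  have gM mu : g N mu @[N --> \oo] --> M n mu.
    apply: cvg_trans (lamM n mu); apply: near_eq_cvg.
    by apply: filterS (nbhs_infty_ge n) => N /= nN; rewrite /g nN.
  apply: filterS2 (nbhs_infty_ge n) (mass_on_cvg g1 (proj1 cM n) gM e0) => N nN.
  move=> /(_ (tail_eq s (tail s (lam N)))); apply: le_trans.
  by rewrite /g nN; exact: tail_ker.
have [n /andP[sn kn]] : exists n, (s <= n.+1)%N && (3 / 4 < kap (n.+1 - s)).
  have kn : \forall N \near \oo, 3 / 4 < kap (N.+1 - s).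
    by apply: (cvgr_gt _ (cvg_kap_shift s)); lra.
  have [n []] := filter_ex (filterI kn (nbhs_infty_ge s)).
  by move=> /= kn' sn; exists n; rewrite kn' (leq_trans sn).
have e0 : 0 < 1 / 8 :> R by lra.
have half : \forall N \near \oo, 1 / 2 < mass_on (M n) (tail_eq s (tail s (lam N))).
  by apply: filterS (close n _ sn e0) => N; lra.
have uniq t t' : 1 / 2 < mass_on (M n) (tail_eq s t) ->
    1 / 2 < mass_on (M n) (tail_eq s t') -> t = t'.
  move=> ht ht'; apply/eqP; apply: contraT => ne.
  suff : mass_on (M n) (tail_eq s t') <= 1 - mass_on (M n) (tail_eq s t) by lra.
  apply: (ler_has_sum _ (has_sum_mass_on (proj1 cM n) _) (mass_on_compl (proj1 cM n) _)) => mu.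
  rewrite ler_wpM2l//; first exact: harmonic_ge0 (proj2 cM) _ _.
  rewrite /tail_eq ler_nat; case: (eqVneq (tail s mu) t) => [->|_]; last by case: eqP.
  by rewrite (negPf ne).
have [N0 hN0] := filter_ex half.
exists (tail s (lam N0)) => n' sn'.
apply/ler_addgt0Pr => e e1.
have [N [hN cN]] := filter_ex (filterI half (close n' e sn' e1)).
by rewrite (uniq _ _ hN0 hN).
Qed.

Theorem martin_extreme M : martin M -> extreme M.
Proof.
move=> mM; have [tau KM] := martin_tail_class mM; split; first by case: mM.
move=> M1 M2 t c1 c2 /andP[t0 t1] ME.
have p1 := harmonic_ge0 (proj2 c1); have p2 := harmonic_ge0 (proj2 c2).
have t1' : 0 < 1 - t by lra.
have K1 : tail_class tau M1.
  apply: (tail_class_component KM c1 t0) => n mu.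
  by rewrite ME lerDl mulr_ge0// ltW.
have K2 : tail_class tau M2.
  apply: (tail_class_component KM c2 t1') => n mu.
  by rewrite ME lerDr mulr_ge0// ltW.
by split; [exact: tail_class_unique K1 KM|exact: tail_class_unique K2 KM].
Qed.

End Concentration.

End Chain.

(** * Laurent polynomial functions *)

(** Collects the terms of an expansion whose index set has repetitions. *)
Lemma fsfun_of_family (R : realType) (T : choiceType) (I : Type) (r : seq I)
    (w : I -> R) (k : I -> T) :
  exists c : {fsfun T -> R with 0},
    (forall t, c t = \sum_(i <- r | k i == t) w i) /\
    forall g : T -> R,
      \sum_(t <- finsupp c) c t * g t = \sum_(i <- r) w i * g (k i).
Proof.
pose A := [fset t | t in [seq k i | i <- r]]%fset.
pose c : {fsfun T -> R with 0} := [fsfun t in A => \sum_(i <- r | k i == t) w i].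
have cE t : c t = \sum_(i <- r | k i == t) w i.
  rewrite fsfunE; case: ifPn => //; rewrite !inE => tA.
  by rewrite big_hasC//; rewrite -has_pred1 has_map in tA.
exists c; split=> // g.
transitivity (\sum_(t <- A) c t * g t).
  apply: big_fset_incl => [|t _ /fsfun_dflt ->]; last by rewrite mul0r.
  by apply/fsubsetP => t; rewrite mem_finsupp fsfunE; case: ifP => //; rewrite eqxx.
under eq_bigr => t _ do rewrite cE mulr_suml.
rewrite (exchange_big_dep xpredT)//=.
have : {subset [seq k i | i <- r] <= A} by move=> t tr; rewrite !inE.
elim: r {c cE} A => [|i r IH] A sA; first by rewrite !big_nil.
rewrite !big_cons IH; last by move=> t tr; apply: sA; rewrite /= inE tr orbT.
congr (_ + _); rewrite -big_filter (perm_big [:: k i]) ?big_seq1//.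
apply: uniq_perm; rewrite ?filter_uniq ?fset_uniq// => t.
rewrite mem_filter inE eq_sym; case: eqP => //= ->.
by apply: sA; rewrite /= mem_head.
Qed.

Section Laurent.
Variables (R : realType) (N : nat).
Implicit Types (z : N.-tuple R) (f g : N.-tuple R -> R).

Definition nonzero z : Prop := forall j, tnth z j != 0.

Definition mono (m : N.-tuple int) z : R := \prod_(j < N) tnth z j ^ tnth m j.

Definition is_laurent f : Prop := exists r : seq (R * N.-tuple int),
  forall z, nonzero z -> f z = \sum_(t <- r) t.1 * mono t.2 z.

Lemma eq_is_laurent f g : (forall z, nonzero z -> f z = g z) ->
  is_laurent f -> is_laurent g.
Proof. by move=> fg [r fr]; exists r => z z0; rewrite -fg// fr. Qed.

Lemma is_laurent_eval (p : laurent R N) : is_laurent (laurent_eval p).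
Proof.
exists [seq (p m, m) | m <- finsupp p] => z _.
by rewrite big_map.
Qed.

Lemma is_laurent_mono c m : is_laurent (fun z => c * mono m z).
Proof. by exists [:: (c, m)] => z _; rewrite big_seq1. Qed.

Lemma is_laurent_cst c : is_laurent (fun=> c).
Proof.
apply: eq_is_laurent (is_laurent_mono c [tuple 0 | j < N]) => z _.
by rewrite /mono big1 ?mulr1// => j _; rewrite tnth_mktuple expr0z.
Qed.

Lemma is_laurent_var j (a : int) : is_laurent (fun z => tnth z j ^ a).
Proof.
apply: eq_is_laurent (is_laurent_mono 1 [tuple if i == j then a else 0 | i < N]) => z _.
rewrite mul1r /mono (bigD1 j)//= tnth_mktuple eqxx big1 ?mulr1// => i ij.
by rewrite tnth_mktuple (negPf ij) expr0z.
Qed.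

Lemma is_laurentD f g : is_laurent f -> is_laurent g ->
  is_laurent (fun z => f z + g z).
Proof.
move=> [r fr] [s gs]; exists (r ++ s) => z z0.
by rewrite big_cat /= fr// gs.
Qed.

Lemma is_laurentM f g : is_laurent f -> is_laurent g ->
  is_laurent (fun z => f z * g z).
Proof.
move=> [r fr] [s gs].
exists [seq (x.1 * y.1, [tuple tnth x.2 j + tnth y.2 j | j < N]) | x <- r, y <- s].
move=> z z0; rewrite fr// gs// big_allpairs_dep /= mulr_suml.
apply: eq_bigr => x _; rewrite mulr_sumr; apply: eq_bigr => y _ /=.
rewrite mulrACA; congr (_ * _); rewrite /mono -big_split /=.
by apply: eq_bigr => j _; rewrite tnth_mktuple expfzDr.
Qed.

Lemma is_laurentZ c f : is_laurent f -> is_laurent (fun z => c * f z).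
Proof. by apply: is_laurentM; exact: is_laurent_cst. Qed.

Lemma is_laurentB f g : is_laurent f -> is_laurent g ->
  is_laurent (fun z => f z - g z).
Proof.
move=> lf /(is_laurentZ (-1)) /(is_laurentD lf); apply: eq_is_laurent => z _.
by rewrite mulN1r.
Qed.

Lemma is_laurent_sum (I : Type) (r : seq I) (P : pred I) (F : I -> N.-tuple R -> R) :
  (forall i, is_laurent (F i)) -> is_laurent (fun z => \sum_(i <- r | P i) F i z).
Proof.
move=> lF; elim: r => [|i r IH].
  by apply: eq_is_laurent (is_laurent_cst 0) => z _; rewrite big_nil.
case Pi : (P i).
  by apply: eq_is_laurent (is_laurentD (lF i) IH) => z _; rewrite big_cons Pi.
by apply: eq_is_laurent IH => z _; rewrite big_cons Pi.
Qed.

Lemma is_laurent_prod (I : Type) (r : seq I) (P : pred I) (F : I -> N.-tuple R -> R) :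
  (forall i, is_laurent (F i)) -> is_laurent (fun z => \prod_(i <- r | P i) F i z).
Proof.
move=> lF; elim: r => [|i r IH].
  by apply: eq_is_laurent (is_laurent_cst 1) => z _; rewrite big_nil.
case Pi : (P i).
  by apply: eq_is_laurent (is_laurentM (lF i) IH) => z _; rewrite big_cons Pi.
by apply: eq_is_laurent IH => z _; rewrite big_cons Pi.
Qed.

Lemma is_laurentX f k : is_laurent f -> is_laurent (fun z => f z ^+ k).
Proof.
move=> lf; elim: k => [|k IH]; first exact: is_laurent_cst.
by apply: eq_is_laurent (is_laurentM lf IH) => z _; rewrite exprS.
Qed.

Lemma is_laurent_det n (A : 'I_n -> 'I_n -> N.-tuple R -> R) :
  (forall i j, is_laurent (A i j)) ->
  is_laurent (fun z => \det (\matrix_(i, j) A i j z)).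
Proof.
move=> lA; apply: is_laurent_sum => s; apply: is_laurentZ.
have := @is_laurent_prod _ (index_enum 'I_n) xpredT (fun i => A i (s i)) (fun i => lA i _).
by apply: eq_is_laurent => z _; apply: eq_bigr => i _; rewrite mxE.
Qed.

Lemma laurent_of_is_laurent f : is_laurent f ->
  exists p : laurent R N, forall z, nonzero z -> laurent_eval p z = f z.
Proof.
move=> [r fr].
have [p [_ pE]] := fsfun_of_family r (fun t => t.1) (fun t => t.2).
by exists p => z z0; rewrite fr// -(pE (mono ^~ z)).
Qed.

(** The slopes are positive and pairwise different, so far out on the ray the
    coordinates are large and strictly increasing, and no denominator in the
    formulas for the characters vanishes there. *)
Definition ray (x : N.-tuple R) (t : R) : N.-tuple R :=
  [tuple tnth x j + t * j.+1%:R | j < N].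

Lemma poly_eq0_large (p : {poly R}) T :
  (forall t, T < t -> p.[t] = 0) -> p = 0.
Proof.
move=> pT; apply/eqP; apply: contraT => p0.
pose s := [seq T + i.+1%:R | i <- iota 0 (size p)].
have us : uniq s.
  by rewrite map_inj_uniq ?iota_uniq// => i j /addrI/eqP; rewrite eqr_nat => /eqP[].
have rs : all (root p) s.
  by apply/allP => _ /mapP[i _ ->]; apply/rootP/pT; rewrite ltrDl.
by have := max_poly_roots p0 rs us; rewrite size_map size_iota ltnn.
Qed.

(** Multiplied by a monomial, [f] becomes a polynomial in the parameter of the
    ray through [x], and it is the value of that polynomial at 0 which matters. *)
Lemma laurent_ray0 f x : is_laurent f -> nonzero x ->
  (exists T, forall t, T < t -> f (ray x t) = 0) -> f x = 0.
Proof.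
move=> [r fr] x0 [T fT].
pose K := (\sum_(t <- r) \sum_(j < N) `|tnth t.2 j|)%N.
have HK t : t \in r -> forall j, 0 <= tnth t.2 j + K%:Z.
  move=> tr j.
  suff : (`|tnth t.2 j| <= K)%N by lia.
  rewrite /K (big_rem t)//= (bigD1 j)//=; lia.
pose e (m : N.-tuple int) j := absz (tnth m j + K%:Z).
pose Q : {poly R} := \sum_(t <- r) t.1 *: \prod_(j < N)
   ((tnth x j)%:P + (j.+1%:R) *: 'X) ^+ e t.2 j.
have QE t : nonzero (ray x t) -> Q.[t] = f (ray x t) * \prod_(j < N) tnth (ray x t) j ^+ K.
  move=> rt; rewrite fr// mulr_suml horner_sum; apply: eq_big_seq => y yr.
  rewrite hornerZ horner_prod -mulrA; congr (_ * _).
  rewrite /mono -big_split /=; apply: eq_bigr => j _.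
  rewrite horner_exp !hornerE tnth_mktuple.
  rewrite (_ : _ ^+ K = (tnth x j + t * j.+1%:R) ^ K%:Z)//.
  rewrite -expfzDr; last by have := rt j; rewrite tnth_mktuple.
  by rewrite mulrC -[in RHS](gez0_abs (HK y yr j)).
have Q0 : Q = 0.
  pose T1 := Num.max T (\sum_(j < N) `|tnth x j|).
  apply: (@poly_eq0_large _ T1) => t; rewrite gt_max => /andP[Tt xt].
  rewrite QE ?fT ?mul0r// => j; rewrite tnth_mktuple gt_eqF//.
  have xj : `|tnth x j| <= \sum_(j < N) `|tnth x j|.
    by rewrite (bigD1 j)//= lerDl sumr_ge0.
  have := ler_norm (- tnth x j); rewrite normrN => nx.
  have t0 : 0 < t by apply: le_lt_trans xt; apply: sumr_ge0.
  have : t <= t * j.+1%:R by rewrite -[leLHS]mulr1 ler_pM2l// ler1n.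
  lra.
have rx : ray x 0 = x.
  by apply: eq_from_tnth => j; rewrite tnth_mktuple mul0r addr0.
have := QE 0; rewrite rx Q0 horner0 => /(_ x0)/esym/eqP.
rewrite mulf_eq0 => /orP[/eqP//|/prodf_eq0[j _]].
by rewrite expf_eq0 (negPf (x0 j)) andbF.
Qed.

End Laurent.

(** * Determinants of function values *)

Section Determinants.
Variable R : comNzRingType.

Lemma det_row_diff n (F : nat -> 'I_n -> R) :
  \det (\matrix_(i < n, j < n) (F i j - (if (i.+1 < n)%N then F i.+1 j else 0))) =
  \det (\matrix_(i < n, j < n) F i j).
Proof.
pose U : 'M[R]_n := \matrix_(i, k) ((k == i)%:R - (k == i.+1 :> nat)%:R).
have -> : \matrix_(i < n, j < n) (F i j - (if (i.+1 < n)%N then F i.+1 j else 0)) =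
    U *m \matrix_(i < n, j < n) F i j.
  apply/matrixP => i j; rewrite !mxE.
  under eq_bigr do rewrite !mxE mulrBl.
  rewrite sumrB; congr (_ - _).
    by rewrite (bigD1 i)//= eqxx mul1r big1 ?addr0// => k /negPf->; rewrite mul0r.
  case: ltnP => ni.
    rewrite (bigD1 (Ordinal ni))//= eqxx mul1r big1 ?addr0// => k.
    by rewrite -val_eqE /= => /negPf->; rewrite mul0r.
  rewrite big1// => k _; rewrite (_ : (k == i.+1 :> nat) = false) ?mul0r//.
  by apply/negP => /eqP e; have := ltn_ord k; rewrite e ltnNge ni.
rewrite det_mulmx (_ : \det U = 1) ?mul1r// -det_tr det_trig.
  by rewrite big1// => i _; rewrite !mxE eqxx -[i in i == _]/(nat_of_ord i) ltn_eqF// subr0.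
apply/is_trig_mxP => i j ij; rewrite !mxE.
rewrite -val_eqE /= ltn_eqF// ltn_eqF ?subrr//.
exact: ltnW.
Qed.

Lemma det_row_expand n B (Q : 'I_n -> pred 'I_B) (c : 'I_n -> 'I_B -> R)
    (psi : nat -> 'I_n -> R) :
  \det (\matrix_(i < n, j < n) \sum_(b < B | Q i b) c i b * psi b j) =
  \sum_(f in family Q) (\prod_i c i (f i)) * \det (\matrix_(i < n, j < n) psi (f i) j).
Proof.
rewrite /determinant.
under eq_bigr => s _.
  under eq_bigr do rewrite mxE.
  rewrite (bigA_distr_big_dep Q (fun i b => c i b * psi b (s i))) mulr_sumr.
  over.
rewrite exchange_big; apply: eq_bigr => f _; rewrite mulr_sumr.
apply: eq_bigr => s _; rewrite big_split /= mulrCA; congr (_ * (_ * _)).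
by apply: eq_bigr => i _; rewrite mxE.
Qed.

(** A change of basis reduces the case of a graded sequence of polynomials to
    the Vandermonde determinant. *)
Lemma det_graded_polys n (p : nat -> {poly R}) (x : nat -> R) :
  (forall i, size (p i) = i.+1) ->
  \det (\matrix_(i < n, j < n) (p i).[x j]) =
  \prod_(i < n) lead_coef (p i) * \prod_(i < n) \prod_(j < n | (i < j)%N) (x j - x i).
Proof.
move=> sp; pose A : 'M[R]_n := \matrix_(i, k) (p i)`_k.
have -> : \matrix_(i < n, j < n) (p i).[x j] =
    A *m Vandermonde n (\row_(j < n) x j).
  apply/matrixP => i j; rewrite !mxE.
  rewrite (@horner_coef_wide _ n); last by rewrite sp.
  by apply: eq_bigr => k _; rewrite !mxE.
rewrite det_mulmx det_Vandermonde det_trig.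
  congr (_ * _).
    by apply: eq_bigr => i _; rewrite mxE lead_coefE sp.
  by apply: eq_bigr => i _; apply: eq_bigr => j _; rewrite !mxE.
by apply/is_trig_mxP => i j ij; rewrite mxE nth_default// sp.
Qed.

(** Coefficients of the iterated divided differences of the polynomial with
    coefficients [f], of degree less than [B], at the nodes [y]. *)
Fixpoint ddcoef (B : nat) (y f : nat -> R) (r : nat) : nat -> R :=
  if r is r'.+1 then
    fun i => \sum_(k < B | (i < k)%N) ddcoef B y f r' k * y r' ^+ (k - i.+1)
  else f.

Definition ddval B y f r x := \sum_(k < B) ddcoef B y f r k * x ^+ k.

Lemma ddval_step B y f r x :
  ddval B y f r x = ddval B y f r (y r) + (x - y r) * ddval B y f r.+1 x.
Proof.
apply/eqP; rewrite addrC -subr_eq; apply/eqP.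
rewrite /ddval -sumrB /=.
under [in RHS]eq_bigr do rewrite mulr_suml.
rewrite (exchange_big_dep xpredT)//= mulr_sumr; apply: eq_bigr => k _.
rewrite -mulrBr subrXX mulrCA; congr (_ * _).
under [in RHS]eq_bigr do rewrite -mulrA.
rewrite -mulr_sumr; congr (_ * _).
rewrite (reindex_inj rev_ord_inj) /=.
rewrite -(big_ord_widen B (fun i => y r ^+ (k - i.+1) * x ^+ i)) ?(ltnW (ltn_ord k))//.
apply: eq_bigr => i _; rewrite mulrC; congr (_ ^+ _ * _ ^+ _).
by have := ltn_ord i; lia.
Qed.

Lemma ddval_newton B y f x n :
  ddval B y f 0 x = \sum_(r < n) ddval B y f r (y r) * \prod_(s < r) (x - y s) +
    \prod_(s < n) (x - y s) * ddval B y f n x.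
Proof.
elim: n => [|n IH]; first by rewrite !big_ord0 add0r mul1r.
rewrite IH [ddval B y f n x]ddval_step !big_ord_recr /=; ring.
Qed.

(** Newton interpolation divides the determinant by the Vandermonde product
    without leaving the ring generated by the nodes and the coefficients. *)
Lemma det_newton n B (y : nat -> R) (f : nat -> nat -> R) :
  \det (\matrix_(i < n, j < n) \sum_(k < B) f i k * y j ^+ k) =
  \det (\matrix_(i < n, r < n) ddval B y (f i) r (y r)) *
  \prod_(j < n) \prod_(s < j) (y j - y s).
Proof.
pose T : 'M[R]_n := \matrix_(r, j) \prod_(s < r) (y j - y s).
have -> : \matrix_(i < n, j < n) \sum_(k < B) f i k * y j ^+ k =
    (\matrix_(i < n, r < n) ddval B y (f i) r (y r)) *m T.
  apply/matrixP => i j; rewrite !mxE.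
  have := ddval_newton B y (f i) (y j) n; rewrite {1}/ddval /= => ->.
  rewrite (_ : \prod_(s < n) (y j - y s) = 0).
    rewrite mul0r addr0.
    by apply: eq_bigr => r _; rewrite !mxE.
  by rewrite (bigD1 j)//= subrr mul0r.
rewrite det_mulmx; congr (_ * _); rewrite -det_tr det_trig.
  by apply: eq_bigr => j _; rewrite !mxE.
apply/is_trig_mxP => i j ij; rewrite !mxE.
by rewrite (bigD1 (Ordinal ij))//= subrr mul0r.
Qed.

End Determinants.

(** * The characters as determinants of orthogonal polynomials *)

Section Characters.
Variables (R : realType) (G : gtype).

Notation eps := (epsilon R G).

(** The character determinants are built from the Chebyshev polynomials of the
    fourth (type B), second (type C) and first (type D) kind, as polynomials in
    [z + z^-1], which is twice the cosine when [z] is on the unit circle. *)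
Definition lead1 : R := if G is typeD then 2^-1 else 1.
Definition dconst : R := if G is typeD then 2 else 1.
Definition hsgn : R := if G is typeD then 1 else -1.

Fixpoint chp (m : nat) : {poly R} :=
  match m with
  | 0 => 1
  | m'.+1 =>
    match m' with
    | 0 => lead1 *: 'X + (if G is typeB then 1 else 0)%:P
    | m''.+1 => 'X * chp m' - chp m''
    end
  end.

Lemma chpSS m : chp m.+2 = 'X * chp m.+1 - chp m. Proof. by []. Qed.

Lemma lead1_gt0 : 0 < lead1. Proof. by rewrite /lead1; case: G; lra. Qed.

Lemma dconst_gt0 : 0 < dconst. Proof. by rewrite /dconst; case: G; lra. Qed.

Lemma size_chp m : size (chp m) = m.+1.
Proof.
suff : size (chp m) = m.+1 /\ size (chp m.+1) = m.+2 by case.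
elim: m => [|m [IH1 IH2]].
  split; first by rewrite size_poly1.
  have sL : size (lead1 *: 'X) = 2 by rewrite size_scale ?size_polyX// gt_eqF// lead1_gt0.
  by rewrite /= size_polyDl sL// ltnS size_polyC_leq1.
have sX : size ('X * chp m.+1) = m.+3.
  by rewrite mulrC size_mulX ?IH2// -size_poly_gt0 IH2.
by split=> //; rewrite chpSS size_polyDl sX// size_polyN IH1.
Qed.

Definition hyp (a x : R) : R := x `^ a + hsgn * x `^ (- a).

Lemma powR_add (x a b : R) : 0 < x -> x `^ (a + b) = x `^ a * x `^ b.
Proof. by move=> x0; rewrite powRD// (gt_eqF x0) implybT. Qed.

Lemma hypE k (x : R) : 0 < x ->
  hyp (k%:R + eps) x = x ^+ k * x `^ eps + hsgn * (x ^+ k * x `^ eps)^-1.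
Proof. by move=> x0; rewrite /hyp powRN powR_add// powR_mulrn// ltW. Qed.

Lemma chp_hyp m (x : R) : 0 < x ->
  (chp m).[x + x^-1] * hyp eps x = hyp (m%:R + eps) x.
Proof.
move=> x0; have xn : x != 0 by rewrite gt_eqF.
have c0 : 0 < x `^ eps by exact: powR_gt0.
have cn : x `^ eps != 0 by rewrite gt_eqF.
have E0 : hyp eps x = x `^ eps + hsgn * (x `^ eps)^-1 by rewrite /hyp powRN.
suff : (chp m).[x + x^-1] * hyp eps x = hyp (m%:R + eps) x /\
    (chp m.+1).[x + x^-1] * hyp eps x = hyp (m.+1%:R + eps) x by case.
elim: m => [|m [IH1 IH2]].
  split; first by rewrite hornerC mul1r add0r.
  rewrite hypE// E0 expr1 /= !hornerE /lead1 /hsgn /epsilon.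
  case: G c0 cn {E0} => /=.
  - move=> c0 cn; have c2 : x `^ 2^-1 * x `^ 2^-1 = x.
      rewrite -powR_add// (_ : 2^-1 + 2^-1 = 1); last by field.
      by rewrite powRr1// ltW.
    set c := x `^ 2^-1 in c0 cn c2 *; by rewrite -c2; field; rewrite cn.
  - by rewrite powRr1 ?ltW// => *; field; rewrite xn.
  - by rewrite powRr0 => *; field; rewrite xn.
split=> //; rewrite chpSS !hornerE mulrBl IH1 -mulrA IH2 !hypE// !exprS.
have xm : x ^+ m != 0 by rewrite expf_neq0.
by field; rewrite xm xn cn.
Qed.

Lemma hyp_eps_neq0 (x : R) : 0 < x -> x != 1 -> hyp eps x != 0.
Proof.
move=> x0 x1; have c0 : 0 < x `^ eps by exact: powR_gt0.
rewrite /hyp powRN /hsgn /epsilon; case: G c0 => /= c0.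
- have c2 : x `^ 2^-1 * x `^ 2^-1 = x.
    rewrite -powR_add// (_ : 2^-1 + 2^-1 = 1); last by field.
    by rewrite powRr1// ltW.
  apply: contra_neq x1; rewrite mulN1r => /subr0_eq e.
  by rewrite -c2 {1}e mulVf// gt_eqF.
- rewrite powRr1 ?ltW// mulN1r; apply: contra_neq x1 => /subr0_eq e.
  have : x * x = 1 by rewrite {1}e mulVf// gt_eqF.
  by move=> xx; nra.
- by rewrite powRr0 invr1 mulr1; lra.
Qed.

Definition rowl N (l : GT N) (i : nat) : nat := (nth 0%N (val l) i + (N - i.+1))%N.

Lemma rowlE N (l : GT N) (i : 'I_N) : rowl l i = (part l i + (N - i.+1))%N.
Proof. by rewrite /rowl /part (tnth_nth 0%N). Qed.

Lemma char_entryE N (l : GT N) (i : 'I_N) (x : R) : 0 < x -> x != 1 ->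
  char_entry G l i x = dconst * (chp (rowl l i)).[x + x^-1].
Proof.
move=> x0 x1; have h0 := hyp_eps_neq0 x0 x1.
have -> : (chp (rowl l i)).[x + x^-1] = hyp ((rowl l i)%:R + eps) x / hyp eps x.
  by rewrite -chp_hyp// mulfK.
move: h0; rewrite rowlE /char_entry /hyp /dconst /hsgn /epsilon; case: G => /= h0.
- by rewrite mul1r !mulN1r.
- by rewrite mul1r !mulN1r !powRN powRr1// ltW.
- by rewrite !mul1r !addr0 oppr0 powRr0; field.
Qed.

Definition uz (z : R) : R := z + z^-1.

Definition chdet N (l : GT N) (z : N.-tuple R) : R :=
  \det (\matrix_(i < N, j < N) (chp (rowl l i)).[uz (tnth z j)]).

Lemma char_detE N (l : GT N) (z : N.-tuple R) :
  (forall j, 0 < tnth z j /\ tnth z j != 1) ->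
  char_det G l z = dconst ^+ N * chdet l z.
Proof.
move=> z01; rewrite /char_det /chdet -detZ; congr (\det _).
apply/matrixP => i j; rewrite !mxE; have [z0 z1] := z01 j.
exact: char_entryE.
Qed.

Lemma is_laurent_uz N (j : 'I_N) : is_laurent (fun z : N.-tuple R => uz (tnth z j)).
Proof.
apply: eq_is_laurent (is_laurentD (is_laurent_var R j 1) (is_laurent_var R j (-1))).
by move=> z _; rewrite expr1z exprN1.
Qed.

Lemma is_laurent_poly N (p : {poly R}) (j : 'I_N) :
  is_laurent (fun z : N.-tuple R => p.[uz (tnth z j)]).
Proof.
have := @is_laurent_sum _ N _ (index_enum 'I_(size p)) xpredT
  (fun k z => p`_k * uz (tnth z j) ^+ k)
  (fun k => is_laurentZ _ (is_laurentX k (is_laurent_uz j))).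
by apply: eq_is_laurent => z _; rewrite horner_coef.
Qed.

Lemma is_laurent_chdet N (l : GT N) : is_laurent (chdet l).
Proof. by apply: is_laurent_det => i j; exact: is_laurent_poly. Qed.

Lemma is_laurent_Vs N : is_laurent (@Vs R N).
Proof.
apply: is_laurent_prod => i; apply: is_laurent_prod => j.
apply: eq_is_laurent (is_laurentB (is_laurent_uz i) (is_laurent_uz j)) => z _.
by rewrite /uz opprD !addrA.
Qed.

Lemma VsE N (z : N.-tuple R) :
  Vs z = \prod_(i < N) \prod_(j < N | (i < j)%N) (uz (tnth z i) - uz (tnth z j)).
Proof.
apply: eq_bigr => i _; apply: eq_bigr => j _.
by rewrite /uz opprD !addrA.
Qed.

(** Newton interpolation at the points [z_j + z_j^-1] exhibits the quotient of
    the determinant by [Vs] as a polynomial in these points. *)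
Lemma is_char_exists N (l : GT N) : exists p : laurent R N, is_char G l p.
Proof.
pose y (z : N.-tuple R) (r : nat) := uz (nth 0 z r).
have yE z (j : 'I_N) : y z j = uz (tnth z j) by rewrite /y (tnth_nth 0).
pose B := (\max_(i < N) (rowl l i).+1)%N.
have HB (i : 'I_N) : (size (chp (rowl l i)) <= B)%N.
  by rewrite size_chp (@leq_bigmax _ (fun i : 'I_N => (rowl l i).+1)).
pose D z := \det (\matrix_(i < N, r < N) ddval B (y z) (fun k => (chp (rowl l i))`_k) r (y z r)).
pose sg : R := \prod_(i < N) \prod_(j < N | (i < j)%N) -1.
have lau_y (r : 'I_N) : is_laurent (fun z => y z r).
  by apply: eq_is_laurent (is_laurent_uz r) => z _; rewrite yE.
have lau_dd (f : nat -> R) r : (r < N)%N ->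
    forall k, is_laurent (fun z => ddcoef B (y z) f r k).
  elim: r => [|r IH] rN k; first exact: is_laurent_cst.
  apply: is_laurent_sum => i; apply: is_laurentM; first exact/IH/ltnW.
  exact: is_laurentX (lau_y (Ordinal (ltnW rN))).
have lau_D : is_laurent (fun z => sg^-1 * dconst ^+ N * D z).
  apply: is_laurentZ; apply: is_laurent_det => i r; apply: is_laurent_sum => k.
  by apply: is_laurentM; [exact: lau_dd|exact: is_laurentX].
have [p pE] := laurent_of_is_laurent lau_D; exists p => z z01 Vz.
rewrite pE; last by move=> j; have [z0 _] := z01 j; rewrite gt_eqF.
rewrite char_detE//.
pose T := \prod_(j < N) \prod_(s < j) (y z j - y z s).
have VT : Vs z = sg * T.
  rewrite VsE /sg /T.
  transitivity (\prod_(i < N) \prod_(j < N | (i < j)%N) (-1 * (y z j - y z i))).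
    apply: eq_bigr => i _; apply: eq_bigr => j _.
    by rewrite !yE mulN1r opprB.
  under eq_bigr do rewrite big_split /=.
  rewrite big_split /=; congr (_ * _).
  rewrite (exchange_big_dep xpredT)//=; apply: eq_bigr => j _.
  by rewrite -(big_ord_widen N (fun i => y z j - y z i) (ltnW (ltn_ord j))).
have DT : chdet l z = D z * T.
  rewrite /D /T -(det_newton N B (y z) (fun i k => (chp (rowl l i))`_k)); congr (\det _).
  apply/matrixP => i j; rewrite !mxE yE.
  exact: (horner_coef_wide _ (HB i)).
move: Vz; rewrite VT DT mulf_eq0 negb_or => /andP[sg0 T0].
by field; rewrite sg0 T0.
Qed.

Lemma chi_is_char N (l : GT N) : is_char G l (chi R G l).
Proof.
rewrite /chi; case: xgetP => [p -> //|np].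
by have [p /np] := is_char_exists l.
Qed.

Lemma uz_sub (a b : R) : a != 0 -> b != 0 -> uz a - uz b = (a - b) * (1 - (a * b)^-1).
Proof. by move=> a0 b0; rewrite /uz; field; rewrite a0 b0. Qed.

Lemma uz_inj_gt1 (a b : R) : 1 < a -> 1 < b -> a != b -> uz a - uz b != 0.
Proof.
move=> a1 b1 ab.
have a0 : a != 0 by rewrite gt_eqF//; lra.
have b0 : b != 0 by rewrite gt_eqF//; lra.
rewrite uz_sub//.
rewrite mulf_eq0 !subr_eq0 negb_or ab /= eq_sym invr_eq1 gt_eqF//; nra.
Qed.

Lemma ray_large N (x : N.-tuple R) c : exists T, forall t, T < t ->
  (forall j, c < tnth (ray x t) j) /\
  (forall i j : 'I_N, (i < j)%N -> tnth (ray x t) i < tnth (ray x t) j).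
Proof.
pose s := \sum_(j < N) `|tnth x j|.
have s0 : 0 <= s by exact: sumr_ge0.
have xs j : - s <= tnth x j <= s.
  by rewrite -ler_norml /s (bigD1 j)//= lerDl sumr_ge0.
exists (2 * s + `|c|) => t; have c0 := normr_ge0 c; have cc := ler_norm c => tT.
split=> [j|i j ij]; rewrite !tnth_mktuple.
  have := xs j; have : t <= t * j.+1%:R by rewrite ler_peMr ?ler1n//; lra.
  by move=> ? /andP[? ?]; lra.
have /andP[? ?] := xs j; have /andP[? ?] := xs i.
have : t * i.+1%:R + t <= t * j.+1%:R.
  have t0 : 0 <= t by lra.
  by rewrite -[X in _ + X]mulr1 -mulrDr natr1 ler_wpM2l// ler_nat.
lra.
Qed.

Lemma Vs_neq0 N (z : N.-tuple R) : (forall j, 1 < tnth z j) ->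
  (forall i j : 'I_N, (i < j)%N -> tnth z i < tnth z j) -> Vs z != 0.
Proof.
move=> z1 zlt; rewrite VsE; apply/prodf_neq0 => i _; apply/prodf_neq0 => j ij.
by rewrite uz_inj_gt1// (lt_eqF (zlt _ _ ij)).
Qed.

Lemma chi_at_Vs N (l : GT N) (z : N.-tuple R) : nonzero z ->
  chi_at G l z * Vs z = dconst ^+ N * chdet l z.
Proof.
move=> z0; apply/eqP; rewrite -subr_eq0; apply/eqP.
pose f z := chi_at G l z * Vs z - dconst ^+ N * chdet l z.
have lf : is_laurent f.
  apply: is_laurentB; last exact/is_laurentZ/is_laurent_chdet.
  by apply: is_laurentM; [exact: is_laurent_eval|exact: is_laurent_Vs].
apply: (laurent_ray0 lf z0).
have [T HT] := ray_large z 1; exists T => t /HT[r1 rlt].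
have V0 := Vs_neq0 r1 rlt.
have r01 j : 0 < tnth (ray z t) j /\ tnth (ray z t) j != 1.
  by have := r1 j; split; [lra|rewrite gt_eqF].
by rewrite /f /chi_at chi_is_char// char_detE//; field.
Qed.

End Characters.

(** * Branching of the characters *)

Arguments chp : simpl never.

Section Branching.
Variables (R : realType) (G : gtype).

(** The weights of the Christoffel-Darboux kernel: the inverse squared norms of
    the polynomials, up to a common factor. *)
Definition cd_weight (m : nat) : R := if m is 0 then lead1 R G else 1.

Lemma cd_weight_gt0 m : 0 < cd_weight m. Proof. by case: m => //=; exact: lead1_gt0. Qed.

Local Notation p m := (chp R G m).

Lemma christoffel_darboux a (x Y : R) :
  (p a.+1).[x] * (p a).[Y] - (p a).[x] * (p a.+1).[Y] =
  (x - Y) * \sum_(m < a.+1) cd_weight m * (p m).[Y] * (p m).[x].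
Proof.
elim: a => [|a IH].
  by rewrite big_ord1 /chp /= !hornerE /=; ring.
by rewrite big_ord_recr /= mulrDr -IH chpSS !(hornerD, hornerN, hornerM, hornerX); ring.
Qed.

Section Step.
Variables (n : nat) (L : nat -> nat) (x : nat -> R) (Y : R).
Local Notation B := (L 0).
Hypothesis xY : x n = Y.
Hypothesis L_decr : forall i, (i < n)%N -> (L i.+1 < L i)%N.
Hypothesis pY : forall m, (p m).[Y] != 0.

Definition ext (a : {ffun 'I_n -> 'I_(L 0)}) (i : nat) : nat :=
  if insub i is Some k then a k else 0%N.

Lemma extE (a : {ffun 'I_n -> 'I_(L 0)}) (i : 'I_n) : ext a i = a i.
Proof. by rewrite /ext valK. Qed.

(** The branching takes two half-steps, as is usual in types B, C and D: the row
    [a] interlaces with [L], and the row [m] interlaces with [a]. *)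
Definition upper (i : 'I_n) (b : 'I_B) : bool := (L i.+1 <= b < L i)%N.

Definition lower (a : {ffun 'I_n -> 'I_B}) (i : 'I_n) (b : 'I_B) : bool :=
  (b <= a i)%N && ((i.+1 < n)%N ==> (ext a i.+1 < b)%N).

Definition interlacing (c : {ffun 'I_n -> 'I_B} * {ffun 'I_n -> 'I_B}) : bool :=
  (c.1 \in family upper) && (c.2 \in family (lower c.1)).

Definition branch_weight (c : {ffun 'I_n -> 'I_B} * {ffun 'I_n -> 'I_B}) : R :=
  \prod_i (((p (c.1 i)).[Y] * (p (c.1 i).+1).[Y])^-1 *
           (cd_weight (c.2 i) * (p (c.2 i)).[Y])).

Lemma L_mono i j : (i <= j)%N -> (j <= n)%N -> (L j <= L i)%N.
Proof.
elim: j => [|j IH]; first by rewrite leqn0 => /eqP->.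
rewrite leq_eqVlt => /orP[/eqP->//|ij] jn.
by rewrite (leq_trans (ltnW (L_decr jn)))// IH// ltnW.
Qed.

Lemma sum_interval (f : nat -> R) lo hi : (lo <= hi)%N -> (hi <= B)%N ->
  \sum_(b < B | (lo <= b < hi)%N) f b = \sum_(lo <= b < hi) f b.
Proof.
move=> lh hB; rewrite big_geq_mkord.
rewrite (big_ord_widen_cond B (fun b => (lo <= b)%N))//.
Qed.

Definition cdsum a (u : R) := \sum_(m < a.+1) cd_weight m * (p m).[Y] * (p m).[u].

Lemma det_cdsum (a : {ffun 'I_n -> 'I_B}) : a \in family upper ->
  \det (\matrix_(i < n, j < n) cdsum (a i) (x j)) =
  \sum_(m in family (lower a)) (\prod_i (cd_weight (m i) * (p (m i)).[Y])) *
    \det (\matrix_(i < n, j < n) (p (m i)).[x j]).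
Proof.
move=> /familyP aU.
rewrite -(det_row_expand (lower a) (fun _ m => cd_weight m * (p m).[Y])
  (fun m (j : 'I_n) => (p m).[x j])).
have -> : \matrix_(i < n, j < n) cdsum (a i) (x j) =
    \matrix_(i < n, j < n) cdsum (ext a i) (x j).
  by apply/matrixP => i j; rewrite !mxE extE.
rewrite -(det_row_diff (fun i (j : 'I_n) => cdsum (ext a i) (x j))); congr (\det _).
apply/matrixP => i j; rewrite !mxE extE.
pose g m := cd_weight m * (p m).[Y] * (p m).[x j].
have gE b : (b < B)%N -> cdsum b (x j) = \sum_(0 <= m < b.+1) g m.
  by move=> _; rewrite big_mkord.
rewrite gE ?ltn_ord//.
case: ifP => ni; last first.
  rewrite subr0 -(@sum_interval g)//.
  by apply: eq_bigl => m; rewrite /lower ni andbT ltnS.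
have a1 : (ext a i.+1 < a i)%N.
  rewrite (extE a (Ordinal ni)); have := aU i; have := aU (Ordinal ni).
  by rewrite !unfold_in /upper /= => /andP[_ h1] /andP[h2 _]; exact: leq_trans h1 h2.
rewrite gE; last exact: ltn_trans a1 (ltn_ord _).
have -> : \sum_(0 <= m < (a i).+1) g m = \sum_(0 <= m < (ext a i.+1).+1) g m +
    \sum_((ext a i.+1).+1 <= m < (a i).+1) g m.
  by apply: big_cat_nat => //; rewrite ltnS ltnW.
rewrite [X in X - _ = _]addrC addrK -(@sum_interval g)//; last by rewrite ltnW.
by apply: eq_bigl => m; rewrite /lower ni /= ltnS andbC.
Qed.

Lemma ratio_step a (u : R) :
  (p a.+1).[u] / (p a.+1).[Y] - (p a).[u] / (p a).[Y] =
  ((p a).[Y] * (p a.+1).[Y])^-1 * cdsum a u * (u - Y).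
Proof.
rewrite -mulrA [cdsum _ _ * _]mulrC -christoffel_darboux.
by field; rewrite !pY.
Qed.

(** Once each row is divided by its value at [Y], the last column is constant,
    and differences of consecutive rows leave only its last entry. These
    differences telescope over single steps in the degree, each of which is a
    Christoffel-Darboux sum with positive coefficients; differences of
    consecutive rows restrict the range of that sum to disjoint intervals. *)
Lemma det_branch :
  \det (\matrix_(i < n.+1, j < n.+1) (p (L i)).[x j]) =
  (\prod_(i < n.+1) (p (L i)).[Y]) * (\prod_(j < n) (x j - Y)) *
  \sum_(c | interlacing c) branch_weight c *
    \det (\matrix_(i < n, j < n) (p (c.2 i)).[x j]).
Proof.
pose F i (j : 'I_n.+1) := (p (L i)).[x j] / (p (L i)).[Y].
have -> : \matrix_(i < n.+1, j < n.+1) (p (L i)).[x j] =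
    diag_mx (\row_i (p (L i)).[Y]) *m \matrix_(i < n.+1, j < n.+1) F i j.
  apply/matrixP => i j; rewrite mul_diag_mx !mxE /F mulrCA mulfV ?pY//.
  by rewrite mulr1.
rewrite det_mulmx det_diag -mulrA; congr (_ * _).
  by apply: eq_bigr => i _; rewrite mxE.
rewrite -(det_row_diff F) (expand_det_col _ ord_max) (bigD1 ord_max)//= big1; last first.
  move=> i im; rewrite !mxE; have ni : (i < n)%N.
    by rewrite ltn_neqAle -ltnS ltn_ord andbT; move: im; rewrite -val_eqE.
  by rewrite ltnS ni /F xY !divff ?subrr ?mul0r ?pY.
rewrite addr0 !mxE ltnn subr0 /F xY divff ?pY// mul1r /cofactor /=.
rewrite addnn -signr_odd odd_double mul1r.
set A := row' _ _.
have -> : A = (\matrix_(i < n, j < n) \sum_(b < B | upper i b)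
    ((p b).[Y] * (p b.+1).[Y])^-1 * cdsum b (x j)) *m
    diag_mx (\row_(j < n) (x j - Y)).
  apply/matrixP => i j; rewrite mul_mx_diag !mxE !lift_max ltnS ltn_ord.
  rewrite mulr_suml.
  under [RHS]eq_bigr do rewrite -ratio_step.
  rewrite (sum_interval (fun b => (p b.+1).[x j] / (p b.+1).[Y] - (p b).[x j] / (p b).[Y])).
  - by rewrite telescope_sumr// ltnW// L_decr.
  - by rewrite ltnW// L_decr.
  - by rewrite L_mono// ltnW.
rewrite det_mulmx det_diag mulrC; congr (_ * _).
  by apply: eq_bigr => j _; rewrite mxE.
rewrite (det_row_expand upper (fun _ b => ((p b).[Y] * (p b.+1).[Y])^-1)
  (fun b (j : 'I_n) => cdsum b (x j))).
transitivity (\sum_(a in family upper) \sum_(m in family (lower a))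
    (\prod_i ((p (a i)).[Y] * (p (a i).+1).[Y])^-1) *
    ((\prod_i (cd_weight (m i) * (p (m i)).[Y])) *
      \det (\matrix_(i < n, j < n) (p (m i)).[x j]))).
  by apply: eq_bigr => a aU; rewrite -mulr_sumr -det_cdsum.
rewrite pair_big_dep /=; apply: eq_bigr => -[a m] _ /=.
by rewrite mulrA /branch_weight [in RHS]big_split.
Qed.

End Step.
End Branching.

(** * Strictly decreasing rows *)

Section Rows.
Variable N : nat.

Lemma sorted_geq_nseq0 : sorted geq (nseq_tuple N 0%N).
Proof. by rewrite /=; elim: N => // -[|k]//=. Qed.

(** The inverse of [rowl] on strictly decreasing rows. *)
Definition GT_of_row (m : nat -> nat) : GT N :=
  insubd (exist _ (nseq_tuple N 0%N) sorted_geq_nseq0 : GT N)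
    [tuple (m i - (N - i.+1))%N | i < N].

Lemma rowl_decr (l : GT N) i : (i.+1 < N)%N -> (rowl l i.+1 < rowl l i)%N.
Proof.
move=> iN; rewrite /rowl.
have /(sortedP 0%N)/(_ i) : sorted geq (val l) by case: (l).
by rewrite size_tuple => /(_ iN) /=; lia.
Qed.

Lemma rowl_lt (l : GT N) i j : (i < j)%N -> (j < N)%N -> (rowl l j < rowl l i)%N.
Proof.
elim: j => [//|j IH]; rewrite ltnS leq_eqVlt => /orP[/eqP->|ij] jN; first exact: rowl_decr.
by apply: ltn_trans (rowl_decr l jN) _; apply: IH => //; exact: ltnW.
Qed.

Lemma rowl_GT_of_row m i : (forall i, (i.+1 < N)%N -> (m i.+1 < m i)%N) -> (i < N)%N ->
  rowl (GT_of_row m) i = m i.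
Proof.
move=> mdec iN.
have mlow k : forall i, (i + k.+1 = N)%N -> (k <= m i)%N.
  elim: k => [//|k IH] j jk.
  have := mdec j; have := IH j.+1; lia.
have nthE j : (j < N)%N ->
    nth 0%N [tuple (m i - (N - i.+1))%N | i < N] j = (m j - (N - j.+1))%N.
  move=> jN; have := nth_mktuple (fun i : 'I_N => (m i - (N - i.+1))%N) 0%N (Ordinal jN).
  by [].
have s : sorted geq [tuple (m i - (N - i.+1))%N | i < N].
  apply/(sortedP 0%N) => j; rewrite size_tuple => jN.
  rewrite !nthE//; last exact: ltnW.
  have := mdec j jN; lia.
rewrite /rowl /GT_of_row insubdK// nthE//.
have := mlow (N - i.+1)%N i; lia.
Qed.

Lemma rowl_inj (l l' : GT N) : (forall i, (i < N)%N -> rowl l i = rowl l' i) -> l = l'.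
Proof.
move=> e; apply/val_inj/eq_from_tnth => i; have := e i (ltn_ord i).
by rewrite /rowl !(tnth_nth 0%N) => /addIn.
Qed.

Lemma det_delta_rows (R : realType) (l l' : GT N) :
  \det (\matrix_(i < N, j < N) (rowl l i == rowl l' j)%:R) = (l == l')%:R :> R.
Proof.
case: eqP => [<-|ne].
  rewrite (_ : \matrix_(i, j) _ = 1%:M) ?det1//; apply/matrixP => i j; rewrite !mxE.
  congr (_%:R); congr nat_of_bool; apply/eqP/eqP => [e|->//]; apply: val_inj => /=.
  case: (ltngtP i j) => // h; exfalso.
    by have := rowl_lt l h (ltn_ord j); rewrite e ltnn.
  by have := rowl_lt l h (ltn_ord i); rewrite e ltnn.
pose s (k : GT N) := [seq rowl k i | i <- iota 0 N].
have ss k : sorted gtn (s k).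
  apply/(sortedP 0%N) => i; rewrite size_map size_iota => iN.
  rewrite !(nth_map 0%N) ?size_iota ?nth_iota ?add0n//; try exact: ltnW.
  exact: rowl_decr.
have us k : uniq (s k).
  apply: (sorted_uniq _ _ (ss k)) => [a b c|a]; rewrite /gtn/= ?ltnn// => h1 h2.
  exact: ltn_trans h2 h1.
have [sub|/allPn[a]] := boolP (all (mem (s l')) (s l)).
  case: ne; have [|_ e] := uniq_min_size (us l) (allP sub); first by rewrite !size_map.
  have E : s l = s l'.
    apply: (irr_sorted_eq _ _ (ss l) (ss l') e) => [b c d|b]; rewrite /gtn/= ?ltnn// => h1 h2.
    exact: ltn_trans h2 h1.
  apply: rowl_inj => i iN; have := congr1 (nth 0%N ^~ i) E.
  by rewrite !(nth_map 0%N) ?size_iota// nth_iota.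
move=> /mapP[i]; rewrite mem_iota add0n => /andP[_ iN] -> nin.
rewrite (expand_det_row _ (Ordinal iN)) big1// => j _; rewrite !mxE /=.
case: eqP => [e|_]; last by rewrite mul0r.
case/negP: nin; rewrite /= e; apply/mapP; exists (nat_of_ord j) => //.
by rewrite mem_iota add0n /=.
Qed.

End Rows.

(** * The links *)

Section Links.
Variables (R : realType) (G : gtype) (q : R).
Hypothesis q01 : 0 < q < 1.

Notation eps := (epsilon R G).
Local Notation p m := (chp R G m).

Let q0 : 0 < q. Proof. by case/andP: q01. Qed.
Let q1 : q < 1. Proof. by case/andP: q01. Qed.

Lemma eps_ge0 : 0 <= eps. Proof. by rewrite /epsilon; case: G; lra. Qed.

Definition node (j : nat) : R := uz (q `^ (j%:R + eps)).

(** Twice the hyperbolic cosine (type D) or sine (types B and C) of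
    [s t log (1 / q)]. The symmetry in [s] and [t] is the source of the duality
    between degrees and nodes. *)
Definition sh (s t : R) : R := q `^ (- (s * t)) + hsgn R G * q `^ (s * t).

Lemma shC s t : sh s t = sh t s. Proof. by rewrite /sh mulrC. Qed.

Lemma chp_sh m j : (p m).[node j] * sh eps (j%:R + eps) = sh (m%:R + eps) (j%:R + eps).
Proof.
have x0 : 0 < q `^ (j%:R + eps) by exact: powR_gt0.
have E s : sh s (j%:R + eps) = hsgn R G * hyp G s (q `^ (j%:R + eps)).
  rewrite /sh /hyp -!powRrM mulrN (mulrC s) /hsgn.
  by case: G; ring.
by rewrite !E mulrCA chp_hyp.
Qed.

Lemma sh_gt0 (m j : nat) : 0 < sh (m%:R + eps) (j%:R + eps).
Proof.
rewrite /sh /hsgn.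
have e1 (t : R) : 0 < t -> q `^ t < 1.
  move=> t0; have := @gt0_ltr_powR R t t0 q 1.
  by rewrite !nnegrE powR1 ler01 (ltW q0) => /(_ isT isT q1).
have pos : 0 < eps -> 0 < q `^ (- ((m%:R + eps) * (j%:R + eps))) -
    q `^ ((m%:R + eps) * (j%:R + eps)).
  move=> e0; set t := _ * _.
  have t0 : 0 < t by rewrite mulr_gt0// ltr_wpDl.
  have qt := e1 _ t0; have qt0 : 0 < q `^ t by exact: powR_gt0.
  by rewrite powRN subr_gt0 (lt_trans qt)// invf_gt1.
move: pos; rewrite /epsilon; case: G => pos.
- by rewrite mulN1r pos//; lra.
- by rewrite mulN1r pos//; lra.
- by rewrite mul1r addr_gt0// powR_gt0.
Qed.

Definition alpha (m : nat) : R := sh eps (m%:R + eps).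

Lemma alpha_gt0 m : 0 < alpha m.
Proof. by have := sh_gt0 0 m; rewrite add0r. Qed.

Lemma chp_node_gt0 m j : 0 < (p m).[node j].
Proof.
by rewrite -(pmulr_lgt0 _ (alpha_gt0 j)) /alpha chp_sh sh_gt0.
Qed.

(** Degree and node can be exchanged, so determinants at the nodes are of
    Vandermonde type in the degrees. *)
Lemma chp_duality m j : (p m).[node j] * alpha j = (p j).[node m] * alpha m.
Proof. by rewrite /alpha !chp_sh shC. Qed.

Lemma node_lt i j : (i < j)%N -> node i < node j.
Proof.
move=> ij; rewrite /node; set a := q `^ (i%:R + eps); set b := q `^ (j%:R + eps).
have a0 : 0 < a by exact: powR_gt0.
have b0 : 0 < b by exact: powR_gt0.
have bE : b = a * q ^+ (j - i).
  rewrite /b -(powR_mulrn _ (ltW q0)) -powR_add//; congr (q `^ _).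
  by rewrite natrB ?ltW//; [ring|exact: ltnW].
have qji : q ^+ (j - i) < 1 by rewrite exprn_ilt1 ?ltW// subn_eq0 -ltnNge.
have a1 : a <= 1.
  rewrite /a -[leRHS](powRr0 q); apply: ger_powR; first by rewrite q0 ltW.
  by rewrite addr_ge0 ?eps_ge0.
have ba : b < a by rewrite bE gtr_pMr.
have ab1 : a * b < 1 by nra.
rewrite -subr_gt0 uz_sub ?gt_eqF// nmulr_rgt0 ?subr_lt0//.
by rewrite invf_gt1 ?mulr_gt0// mulrC.
Qed.

Lemma node_inj i j : node i = node j -> i = j.
Proof.
by case: (ltngtP i j) => // /node_lt h e; rewrite e ltxx in h.
Qed.

Lemma det_nodes n (m : nat -> nat) :
  \det (\matrix_(i < n, j < n) (p (m i)).[node j]) * \prod_(j < n) alpha j =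
  (\prod_(i < n) lead_coef (p i)) *
  ((\prod_(i < n) alpha (m i)) *
   \prod_(i < n) \prod_(j < n | (i < j)%N) (node (m j) - node (m i))).
Proof.
transitivity (\det (\matrix_(i < n, j < n) (p (m i)).[node j] *m
    diag_mx (\row_(j < n) alpha j))).
  rewrite det_mulmx det_diag; congr (_ * _).
  by apply: eq_bigr => j _; rewrite mxE.
rewrite (_ : _ *m _ = diag_mx (\row_(i < n) alpha (m i)) *m
  (\matrix_(i < n, j < n) (p i).[node (m j)])^T); last first.
  apply/matrixP => i j; rewrite mul_mx_diag mul_diag_mx !mxE chp_duality.
  by rewrite mulrC.
rewrite det_mulmx det_diag det_tr.
rewrite (det_graded_polys _ (fun j => node (m j)))//; last exact: size_chp.
rewrite mulrCA; congr (_ * (_ * _)).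
by apply: eq_bigr => i _; rewrite mxE.
Qed.

Lemma lead_chp_neq0 i : lead_coef (p i) != 0.
Proof. by rewrite lead_coef_eq0 -size_poly_gt0 size_chp. Qed.

Lemma det_nodes_neq0 n (m : nat -> nat) :
  (forall i j, (i < j)%N -> (j < n)%N -> m i != m j) ->
  \det (\matrix_(i < n, j < n) (p (m i)).[node j]) != 0.
Proof.
move=> minj; have := det_nodes n m; apply: contra_eq_neq => ->; rewrite mul0r eq_sym.
rewrite !mulf_neq0//.
- by apply/prodf_neq0 => i _; exact: lead_chp_neq0.
- by apply/prodf_neq0 => i _; rewrite gt_eqF// alpha_gt0.
- apply/prodf_neq0 => i _; apply/prodf_neq0 => j ij; rewrite subr_eq0.
  by apply: contraNneq (minj i j ij (ltn_ord j)) => /node_inj ->.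
Qed.

Lemma uz_qpoint n (j : 'I_n) : uz (tnth (qpoint G q n) j) = node j.
Proof. by rewrite tnth_mktuple. Qed.

Lemma nonzero_qpoint n : nonzero (qpoint G q n).
Proof. by move=> j; rewrite tnth_mktuple gt_eqF// powR_gt0. Qed.

Lemma Vs_qpoint_neq0 n : Vs (qpoint G q n) != 0.
Proof.
rewrite VsE; apply/prodf_neq0 => i _; apply/prodf_neq0 => j ij.
by rewrite !uz_qpoint subr_eq0 lt_eqF// node_lt.
Qed.

Lemma chdet_qpoint n (l : GT n) :
  chdet G l (qpoint G q n) = \det (\matrix_(i < n, j < n) (p (rowl l i)).[node j]).
Proof.
by congr (\det _); apply/matrixP => i j; rewrite !mxE uz_qpoint.
Qed.

Lemma chi_qpoint_neq0 n (l : GT n) : chi_at G l (qpoint G q n) != 0.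
Proof.
have H := chi_at_Vs G l (@nonzero_qpoint n).
apply: contraTneq (Vs_qpoint_neq0 n) => c0; move: H; rewrite c0 mul0r => /esym/eqP.
rewrite mulf_eq0 expf_eq0 gt_eqF ?dconst_gt0// andbF /= chdet_qpoint.
rewrite (negPf (det_nodes_neq0 _))// => i j ij jn.
by rewrite gtn_eqF// rowl_lt.
Qed.

Lemma tnth_rcons_widen n (x : n.-tuple R) y (i : 'I_n) :
  tnth [tuple of rcons x y] (widen_ord (leqnSn n) i) = tnth x i.
Proof. by rewrite !(tnth_nth 0) /= nth_rcons size_tuple ltn_ord. Qed.

Lemma tnth_rcons_max n (x : n.-tuple R) y : tnth [tuple of rcons x y] ord_max = y.
Proof. by rewrite (tnth_nth 0) /= nth_rcons size_tuple ltnn eqxx. Qed.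

Lemma nonzero_rcons n (x : n.-tuple R) y : nonzero x -> y != 0 ->
  nonzero [tuple of rcons x y].
Proof.
move=> x0 y0 j; rewrite (tnth_nth 0) /= nth_rcons size_tuple.
case: ltngtP => [jn|jn|_]//; last by have := ltn_ord j; rewrite ltnS leqNgt jn.
by rewrite -(tnth_nth 0 x (Ordinal jn)).
Qed.

Lemma Vs_rcons n (x : n.-tuple R) y :
  Vs [tuple of rcons x y] = Vs x * \prod_(j < n) (uz (tnth x j) - uz y).
Proof.
rewrite !VsE big_ord_recr /= [X in _ * X]big1 ?mulr1; last first.
  by move=> j nj; have := ltn_ord j; rewrite ltnS leqNgt nj.
rewrite -big_split /=; apply: eq_bigr => i _.
rewrite big_mkcond big_ord_recr /= ltn_ord tnth_rcons_max tnth_rcons_widen.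
congr (_ * _); rewrite -big_mkcond /=; apply: eq_bigr => j _.
by rewrite tnth_rcons_widen.
Qed.

Lemma is_laurent_rcons n (f : n.+1.-tuple R -> R) (y : R) : is_laurent f -> y != 0 ->
  is_laurent (fun x : n.-tuple R => f [tuple of rcons x y]).
Proof.
move=> [r fr] y0.
have lx j (a : int) : is_laurent (fun x : n.-tuple R => nth 0 (rcons x y) j ^ a).
  case: (ltnP j n) => jn.
    apply: eq_is_laurent (is_laurent_var R (Ordinal jn) a) => x _.
    by rewrite nth_rcons size_tuple jn (tnth_nth 0).
  apply: eq_is_laurent (is_laurent_cst n ((if j == n then y else 0) ^ a)) => x _.
  by rewrite nth_rcons size_tuple ltnNge jn.
have := @is_laurent_sum _ n _ r xpredT
  (fun t x => t.1 * \prod_(j < n.+1) nth 0 (rcons x y) j ^ tnth t.2 j).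
have lt t : is_laurent (fun x : n.-tuple R =>
    t.1 * \prod_(j < n.+1) nth 0 (rcons x y) j ^ tnth t.2 j).
  by apply: is_laurentZ; apply: is_laurent_prod => j; exact: lx.
move=> /(_ lt); apply: eq_is_laurent => x x0; rewrite fr; last exact: nonzero_rcons.
apply: eq_bigr => t _; congr (_ * _); apply: eq_bigr => j _.
by rewrite (tnth_nth 0 [tuple of rcons x y]).
Qed.

Section LinkRow.
Variables (n : nat) (l : GT n.+1).

Local Notation conf := ({ffun 'I_n -> 'I_(rowl l 0)} * {ffun 'I_n -> 'I_(rowl l 0)})%type.
Local Notation Y := (node n).

Lemma row_decr i : (i < n)%N -> (rowl l i.+1 < rowl l i)%N.
Proof. by move=> ni; apply: rowl_decr. Qed.

Lemma lower_decr (c : conf) i : interlacing (L := rowl l) c -> (i.+1 < n)%N ->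
  (ext c.2 i.+1 < ext c.2 i)%N.
Proof.
move=> /andP[_ /familyP cL] ni.
have := cL (Ordinal ni); have := cL (Ordinal (ltnW ni)); rewrite !unfold_in /lower /= ni.
rewrite (extE c.2 (Ordinal ni)) (extE c.2 (Ordinal (ltnW ni))) (extE c.1 (Ordinal ni)).
by move=> /andP[_ h1] /andP[h2 _]; exact: leq_ltn_trans h2 h1.
Qed.

Definition low_GT (c : conf) : GT n := GT_of_row n (ext c.2).

Lemma rowl_low_GT (c : conf) (i : 'I_n) : interlacing (L := rowl l) c ->
  rowl (low_GT c) i = c.2 i.
Proof.
move=> cI; rewrite rowl_GT_of_row ?extE// => k kn.
exact: lower_decr.
Qed.

(** Both sides are Laurent polynomials, so it suffices to compare them far out on
    a ray, where the formula with determinants applies. *)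
Lemma chi_branch (x : n.-tuple R) : nonzero x ->
  chi_at G l [tuple of rcons x (q `^ (n%:R + eps))] =
  dconst R G * \prod_(i < n.+1) (p (rowl l i)).[Y] *
  \sum_(c : conf | interlacing (L := rowl l) c)
    branch_weight G Y c * chi_at G (low_GT c) x.
Proof.
set y := q `^ (n%:R + eps); have y0 : 0 < y by exact: powR_gt0.
have yn : y != 0 by rewrite gt_eqF.
move=> x0; apply/eqP; rewrite -subr_eq0; apply/eqP.
pose f (x : n.-tuple R) := chi_at G l [tuple of rcons x y] -
  dconst R G * \prod_(i < n.+1) (p (rowl l i)).[Y] *
  \sum_(c : conf | interlacing (L := rowl l) c)
    branch_weight G Y c * chi_at G (low_GT c) x.
have lf : is_laurent f.
  apply: is_laurentB; first exact: is_laurent_rcons (is_laurent_eval _) yn.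
  apply: is_laurentZ; apply: is_laurent_sum => c; apply: is_laurentZ.
  exact: is_laurent_eval.
apply: (laurent_ray0 lf x0).
have [T HT] := ray_large x (1 + y + y^-1); exists T => t /HT[r1 rlt].
have yi0 : 0 < y^-1 by rewrite invr_gt0.
set z := ray x t in r1 rlt *.
have z1 j : 1 < tnth z j by have := r1 j; lra.
have z0 : nonzero z by move=> j; rewrite gt_eqF//; have := z1 j; lra.
have V0 := Vs_neq0 z1 rlt.
have zy j : uz (tnth z j) - uz y != 0.
  rewrite uz_sub ?z0// mulf_neq0//.
    by rewrite subr_eq0 gt_eqF//; have := r1 j; lra.
  rewrite subr_eq0 eq_sym invr_eq1 gt_eqF//.
  rewrite -ltr_pdivrMr// mul1r; have := r1 j; lra.
have W0 : Vs [tuple of rcons z y] != 0.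
  by rewrite Vs_rcons mulf_neq0//; apply/prodf_neq0.
have E1 := chi_at_Vs G l (nonzero_rcons z0 yn).
pose xx j := uz (nth 0 (rcons z y) j).
have xxn : xx n = Y by rewrite /xx nth_rcons size_tuple ltnn eqxx.
have E2 : chdet G l [tuple of rcons z y] =
    \det (\matrix_(i < n.+1, j < n.+1) (p (rowl l i)).[xx j]).
  congr (\det _); apply/matrixP => i j; rewrite !mxE.
  by rewrite (tnth_nth 0).
have pY m : (p m).[Y] != 0 by rewrite gt_eqF// chp_node_gt0.
rewrite (det_branch xxn row_decr pY) in E2.
have E3 : \prod_(j < n) (xx j - Y) = \prod_(j < n) (uz (tnth z j) - uz y).
  apply: eq_bigr => j _; rewrite /xx nth_rcons size_tuple ltn_ord.
  by rewrite (tnth_nth 0).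
rewrite E3 in E2; apply: (mulIf W0); rewrite mul0r mulrBl E1 E2 Vs_rcons.
set A := \prod_(i < n.+1) _; set D := \prod_(j < n) _.
have E4 : Vs z * (\sum_(c : conf | interlacing (L := rowl l) c)
      branch_weight G Y c * chi_at G (low_GT c) z) =
    dconst R G ^+ n * \sum_(c : conf | interlacing (L := rowl l) c)
      branch_weight G Y c * \det (\matrix_(i < n, j < n) (p (c.2 i)).[xx j]).
  rewrite !mulr_sumr; apply: eq_bigr => c cI.
  rewrite mulrCA [Vs z * _]mulrC chi_at_Vs// mulrCA; congr (_ * (_ * _)).
  congr (\det _); apply/matrixP => i j; rewrite !mxE rowl_low_GT//.
  by rewrite /xx nth_rcons size_tuple ltn_ord (tnth_nth 0).
move: E4; set S1 := (X in Vs z * X = _); set S2 := (X in _ = _ * X) => E4.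
transitivity (dconst R G ^+ n.+1 * (A * D * S2) - dconst R G * A * S1 * (Vs z * D)).
  by [].
transitivity (dconst R G * A * D * (dconst R G ^+ n * S2 - Vs z * S1)).
  by rewrite exprS; ring.
by rewrite E4 subrr mulr0.
Qed.

Lemma rcons_qpoint :
  [tuple of rcons (qpoint G q n) (q `^ (n%:R + eps))] = qpoint G q n.+1.
Proof.
apply: eq_from_tnth => j; rewrite tnth_mktuple (tnth_nth 0) /= nth_rcons size_tuple card_ord.
case: ltngtP => [jn|jn|->//].
- by rewrite -(tnth_nth 0 (qpoint G q n) (Ordinal jn)) tnth_mktuple.
- by have := ltn_ord j; rewrite ltnS leqNgt jn.
Qed.

(** The point functionals given by the inverse of the matrix of node values are
    dual to the orthogonal polynomials; applied in each variable, they extract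
    the coefficient of a given determinant. *)
Lemma chdet_free (A : {fset GT n}) (d : GT n -> R) :
  (forall x : n.-tuple R, nonzero x -> \sum_(mu <- A) d mu * chdet G mu x = 0) ->
  forall mu0, mu0 \in A -> d mu0 = 0.
Proof.
move=> H mu0 mA.
pose D := (\max_(mu <- A) \max_(i < n) (rowl mu i).+1)%N.
have rD mu (i : 'I_n) : mu \in A -> (rowl mu i < D)%N.
  move=> muA; apply: (@leq_trans (\max_(i < n) (rowl mu i).+1)%N).
    exact: (@leq_bigmax _ (fun i : 'I_n => (rowl mu i).+1)).
  have muA' : mu \in enum_fset A by [].
  exact: (@leq_bigmax_seq _ _ xpredT (fun mu => (\max_(i < n) (rowl mu i).+1)%N) mu muA').
pose P : 'M[R]_D := \matrix_(m, r) (p m).[node r].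
have Pu : P \in unitmx.
  rewrite unitmxE unitfE; apply: (det_nodes_neq0 (m := id)) => i j ij _.
  by rewrite ltn_eqF.
have PW (i : nat) (j : nat) (hi : (i < D)%N) (hj : (j < D)%N) :
    \sum_(r < D) invmx P r (Ordinal hj) * (p i).[node r] = (i == j)%:R.
  have /matrixP/(_ (Ordinal hi) (Ordinal hj)) := mulmxV Pu; rewrite !mxE -val_eqE /= => <-.
  by apply: eq_bigr => r _; rewrite !mxE mulrC.
pose w (j : 'I_n) (r : 'I_D) : R := invmx P r (Ordinal (rD mu0 j mA)).
have ext0 mu : mu \in A -> \sum_(k in family (fun _ : 'I_n => xpredT : pred 'I_D))
    (\prod_j w j (k j)) * \det (\matrix_(i < n, j < n) (p (rowl mu j)).[node (k i)]) =
    (mu == mu0)%:R.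
  move=> muA.
  rewrite -(det_row_expand (fun _ => xpredT) w
    (fun r (j : 'I_n) => (p (rowl mu j)).[node r])).
  rewrite -det_delta_rows -det_tr; congr (\det _); apply/matrixP => i j; rewrite !mxE.
  by rewrite /w (PW _ _ (rD mu i muA)).
have : \sum_(k in family (fun _ : 'I_n => xpredT : pred 'I_D)) (\prod_j w j (k j)) *
    \sum_(mu <- A) d mu *
      \det (\matrix_(i < n, j < n) (p (rowl mu j)).[node (k i)]) = 0.
  apply: big1 => k _.
  rewrite [X in _ * X](_ : _ = 0) ?mulr0//.
  transitivity (\sum_(mu <- A) d mu * chdet G mu
      [tuple q `^ ((k j : nat)%:R + eps) | j < n]).
    apply: eq_bigr => mu _; congr (_ * _); rewrite -det_tr; congr (\det _).
    by apply/matrixP => i j; rewrite !mxE tnth_mktuple.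
  by apply: H => j; rewrite tnth_mktuple gt_eqF// powR_gt0.
under eq_bigr do rewrite mulr_sumr.
rewrite exchange_big /=.
under eq_big_seq => mu muA.
  under eq_bigr do rewrite mulrCA.
  rewrite -mulr_sumr ext0//.
  over.
rewrite (big_fsetD1 mu0)//= eqxx mulr1 big_seq big1 ?addr0// => mu /fsetD1P[/negPf-> _].
by rewrite mulr0.
Qed.

Lemma link_row_unique c1 c2 : is_link_row G q l c1 -> is_link_row G q l c2 -> c1 = c2.
Proof.
move=> H1 H2; apply/fsfunP => mu0.
pose A := (finsupp c1 `|` finsupp c2)%fset.
have [m0|] := boolP (mu0 \in A); last first.
  by rewrite inE negb_or => /andP[/fsfun_dflt-> /fsfun_dflt->].
pose X (mu : GT n) := chi_at G mu (qpoint G q n).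
have wide (c : {fsfun GT n -> R with 0}) (x : n.-tuple R) : (finsupp c `<=` A)%fset ->
    \sum_(mu <- finsupp c) c mu * (chi_at G mu x / X mu) =
    \sum_(mu <- A) c mu * (chi_at G mu x / X mu).
  move=> cA; apply: big_fset_incl => // mu _ /fsfun_dflt ->.
  by rewrite mul0r.
have := @chdet_free A (fun mu => (c1 mu - c2 mu) / X mu).
move=> /(_ _ mu0 m0) H; suff : (c1 mu0 - c2 mu0) / X mu0 = 0.
  move/eqP; rewrite mulf_eq0 invr_eq0 (negPf (chi_qpoint_neq0 mu0)) orbF subr_eq0.
  by move/eqP.
apply: H => x x0.
have : \sum_(mu <- A) (c1 mu - c2 mu) * (chi_at G mu x / X mu) = 0.
  under eq_bigr do rewrite mulrBl.
  rewrite sumrB -!wide ?fsubsetUl ?fsubsetUr//.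
  by rewrite -H1// -H2// subrr.
move/(congr1 (fun s => s * Vs x)); rewrite mul0r mulr_suml => E.
have dn : dconst R G ^+ n != 0 by rewrite expf_neq0// gt_eqF// dconst_gt0.
apply: (mulfI dn); rewrite mulr0; apply: etrans E.
rewrite mulr_sumr; apply: eq_bigr => mu _.
have := chi_at_Vs G mu x0 => e; rewrite mulrCA -e; ring.
Qed.

(** Up to a factor common to all configurations, the branching weight times the
    value of the character of the lower row at the [q]-point. *)
Definition conf_weight (c : conf) : R :=
  branch_weight G Y c * ((\prod_i alpha (c.2 i)) *
    \prod_(i < n) \prod_(j < n | (i < j)%N) (node (c.2 i) - node (c.2 j))).

Lemma chi_qpoint : exists k, forall c : conf, interlacing (L := rowl l) c ->
  chi_at G (low_GT c) (qpoint G q n) = k * ((\prod_i alpha (c.2 i)) *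
    \prod_(i < n) \prod_(j < n | (i < j)%N) (node (c.2 i) - node (c.2 j))).
Proof.
pose sg : R := \prod_(i < n) \prod_(j < n | (i < j)%N) -1.
exists (dconst R G ^+ n / Vs (qpoint G q n) * (\prod_(i < n) lead_coef (p i)) /
  (\prod_(j < n) alpha j) * sg) => c cI.
have a0 : \prod_(j < n) alpha j != 0.
  by apply/prodf_neq0 => j _; rewrite gt_eqF// alpha_gt0.
have V0 := Vs_qpoint_neq0 n.
have := chi_at_Vs G (low_GT c) (@nonzero_qpoint n).
move/(canRL (mulfK V0)) => ->.
rewrite chdet_qpoint.
have /(canRL (mulfK a0)) -> := det_nodes n (rowl (low_GT c)).
have -> : \prod_(i < n) \prod_(j < n | (i < j)%N)
    (node (rowl (low_GT c) j) - node (rowl (low_GT c) i)) =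
    sg * \prod_(i < n) \prod_(j < n | (i < j)%N) (node (c.2 i) - node (c.2 j)).
  rewrite -big_split /=; apply: eq_bigr => i _; rewrite -big_split /=.
  by apply: eq_bigr => j _; rewrite !rowl_low_GT// mulN1r opprB.
have -> : \prod_(i < n) alpha (rowl (low_GT c) i) = \prod_i alpha (c.2 i).
  by apply: eq_bigr => i _; rewrite rowl_low_GT.
by field; rewrite a0 V0.
Qed.

(** The link is the distribution of the lower row of a random configuration. *)
Lemma link_sum (g : GT n -> R) :
  \sum_(mu <- finsupp (link G q l)) link G q l mu * g mu =
  (\sum_(c : conf | interlacing (L := rowl l) c) conf_weight c * g (low_GT c)) /
  \sum_(c : conf | interlacing (L := rowl l) c) conf_weight c.
Proof.
have [k kE] := chi_qpoint.
set X := chi_at G l (qpoint G q n.+1).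
have X0 : X != 0 := chi_qpoint_neq0 l.
pose K := dconst R G * \prod_(i < n.+1) (p (rowl l i)).[Y] / X.
pose w (c : conf) := K * (branch_weight G Y c * chi_at G (low_GT c) (qpoint G q n)).
pose r := [seq c <- index_enum conf | interlacing (L := rowl l) c].
have [row [_ rowE]] := fsfun_of_family r w low_GT.
have rowP : is_link_row G q l row.
  move=> x x0; rewrite rowE chi_branch// -/X big_filter.
  rewrite mulrAC -/K mulr_sumr; apply: eq_bigr => c _; rewrite /w.
  have := chi_qpoint_neq0 (low_GT c) => h; field; exact: h.
have -> : link G q l = row.
  rewrite /link; case: xgetP => [c -> cP|/(_ row)/(_ rowP)//].
  exact: link_row_unique.
rewrite rowE big_filter.
set S := \sum_(c | _) conf_weight c.
have wE c : interlacing (L := rowl l) c -> w c = K * k * conf_weight c.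
  by move=> cI; rewrite /w /conf_weight kE//; ring.
have KS : K * k * S = 1.
  have := chi_branch (@nonzero_qpoint n); rewrite rcons_qpoint -/X => E.
  have kS : k * S = \sum_(c : conf | interlacing (L := rowl l) c)
      branch_weight G Y c * chi_at G (low_GT c) (qpoint G q n).
    by rewrite mulr_sumr; apply: eq_bigr => c cI; rewrite kE// /conf_weight; ring.
  by rewrite -mulrA kS /K mulrAC -E divff.
have S0 : S != 0 by apply: contra_eq_neq KS => ->; rewrite mulr0 eq_sym oner_neq0.
apply: (canRL (mulfK S0)); rewrite mulr_suml -[RHS]mul1r -KS.
rewrite -[K * k * S * _]mulrA mulr_sumr mulr_sumr.
apply: eq_bigr => c cI; rewrite wE//; ring.
Qed.

End LinkRow.
End Links.

(** * Estimates for the weights *)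

Section Estimates.
Variables (R : realType) (G : gtype) (q : R).
Hypothesis q01 : 0 < q < 1.

Notation eps := (epsilon R G).
Local Notation p m := (chp R G m).
Local Notation node := (node G q).
Local Notation alpha := (alpha G q).

Let q0 : 0 < q. Proof. by case/andP: q01. Qed.
Let q1 : q < 1. Proof. by case/andP: q01. Qed.

Let q1le : q <= 1 := ltW q1.

Let ele1 (x : R) k : 0 < x -> x <= 1 -> x ^+ k <= 1.
Proof. by move=> x0 x1; rewrite exprn_ile1// ltW. Qed.

Let ege0 (x : R) k : 0 < x -> 0 <= x ^+ k.
Proof. by move=> x0; rewrite exprn_ge0// ltW. Qed.

Let mul_le1 (x y : R) : 0 < x -> 0 < y -> x <= 1 -> y <= 1 -> x * y <= 1.
Proof. by move=> x0 y0 x1 y1; rewrite mulr_ile1// ltW. Qed.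

Definition qeps : R := q `^ eps.

Let s0 : 0 < qeps. Proof. exact: powR_gt0. Qed.
Let s1 : qeps <= 1.
Proof.
rewrite -[leRHS](powRr0 q); apply: ger_powR; last exact: eps_ge0.
by rewrite q0 ltW.
Qed.

Lemma powR_node k : q `^ (k%:R + eps) = q ^+ k * qeps.
Proof. by rewrite powR_add// powR_mulrn// ltW. Qed.

(** Twice the hyperbolic cosine or sine of [log (1 / x)], as in [sh]. *)
Definition hcosh (x : R) : R := x^-1 + hsgn R G * x.

Lemma sh_hcosh k t : sh G q (k%:R + eps) t = hcosh ((q `^ t) ^+ k * (q `^ t) `^ eps).
Proof.
have w0 : 0 < q `^ t by exact: powR_gt0.
by rewrite /sh /hcosh powRN [_ * t]mulrC powRrM powR_add// powR_mulrn// ltW.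
Qed.

Lemma hcosh_growth (x z : R) : 0 < x <= 1 -> 0 < z <= 1 ->
  hcosh x <= 2 * z * hcosh (x * z).
Proof.
move=> /andP[x0 x1] /andP[z0 z1]; rewrite /hcosh invfM.
have -> : 2 * z * (x^-1 * z^-1 + hsgn R G * (x * z)) =
    2 * x^-1 + hsgn R G * (2 * (x * z ^+ 2)) by field; rewrite gt_eqF// gt_eqF.
have xi : x <= x^-1 by rewrite (le_trans x1)// invf_ge1.
have z2 : x * z ^+ 2 <= x by rewrite ler_piMr ?(ltW x0)// ele1.
have z20 : 0 <= x * z ^+ 2 by rewrite mulr_ge0 ?ege0// ltW.
by rewrite /hsgn; case: G; lra.
Qed.

Lemma hcosh_decr (x z : R) : 0 < x <= 1 -> 0 < z <= 1 -> hcosh x <= hcosh (x * z).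
Proof.
move=> /andP[x0 x1] /andP[z0 z1]; rewrite /hcosh invfM.
have xi : 1 <= x^-1 by rewrite invf_ge1.
have zi : 1 <= z^-1 by rewrite invf_ge1.
have zz : z^-1 * z = 1 by rewrite mulVf// gt_eqF.
by rewrite /hsgn; case: G; nra.
Qed.

(** The constant bounding the growth of [alpha] by that of [qeps ^- m]; in type
    D the weights [alpha] are constant. *)
Definition calpha : R := if G is typeD then 1 else (1 - (qeps `^ eps) ^+ 2)^-1.

Let A0 : 0 < qeps `^ eps. Proof. exact: powR_gt0. Qed.

Let A1 : if G is typeD then true else qeps `^ eps < 1.
Proof.
have H : 0 < eps -> qeps `^ eps < 1.
  move=> e0; have lt1 t : 0 < t -> q `^ t < 1.
    move=> t0; have := @gt0_ltr_powR R t t0 q 1.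
    by rewrite !nnegrE powR1 ler01 (ltW q0) => /(_ isT isT q1).
  by rewrite /qeps -powRrM lt1// mulr_gt0.
by move: H; rewrite /epsilon; case: G => // H; apply: H; lra.
Qed.

Lemma calpha_ge1 : 1 <= calpha.
Proof.
rewrite /calpha; move: A0 A1; case: G => // a0 a1.
  by rewrite invf_ge1 ?subr_gt0 ?exprn_ilt1 ?(ltW a0)// gerBl ege0.
by rewrite invf_ge1 ?subr_gt0 ?exprn_ilt1 ?(ltW a0)// gerBl ege0.
Qed.

Lemma alphaE m : alpha m = hcosh (qeps ^+ m * qeps `^ eps).
Proof. by rewrite /alpha shC sh_hcosh. Qed.

Lemma alpha_growth b m : alpha m * qeps ^+ (m - b) <= calpha * alpha b.
Proof.
have A01 : 0 < qeps `^ eps <= 1.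
  rewrite A0 -[leRHS](powRr0 qeps); apply: ger_powR; first by rewrite s0 s1.
  exact: eps_ge0.
have xk k : 0 < qeps ^+ k * qeps `^ eps <= 1.
  case/andP: A01 => _ a1; rewrite mulr_gt0 ?exprn_gt0//=.
  by rewrite mul_le1 ?exprn_gt0// ele1.
have zk k : 0 < qeps ^+ k <= 1 by rewrite exprn_gt0//= ele1.
have ab : 0 < alpha b by exact: alpha_gt0.
case: (leqP m b) => mb.
  rewrite (eqP (_ : (m - b == 0)%N)) ?subn_eq0// expr0 mulr1.
  apply: (@le_trans _ _ (alpha b)); last by rewrite ler_peMl ?calpha_ge1// ltW.
  rewrite !alphaE -(subnK mb) exprD -mulrA [_ * (qeps ^+ m * _)]mulrC.
  exact: hcosh_decr.
rewrite !alphaE -{1}(subnK (ltnW mb)) exprD -mulrA [qeps ^+ (m - b) * _]mulrC.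
set x := qeps ^+ b * _; set z := qeps ^+ (m - b).
have /andP[x0 x1] := xk b; have /andP[z0 z1] := zk (m - b)%N.
rewrite -/x in x0 x1; rewrite -/z in z0 z1.
have xA : x <= qeps `^ eps by rewrite /x ler_piMl ?(ltW A0)// ele1.
rewrite /hcosh invfM.
have -> : (x^-1 * z^-1 + hsgn R G * (x * z)) * z = x^-1 + hsgn R G * (x * z ^+ 2).
  by field; rewrite gt_eqF// gt_eqF.
have z2 : x * z ^+ 2 <= x by rewrite ler_piMr ?(ltW x0)// ele1.
have z20 : 0 <= x * z ^+ 2 by rewrite mulr_ge0 ?ege0// ltW.
have aux : qeps `^ eps < 1 -> x^-1 - x * z ^+ 2 <= (1 - (qeps `^ eps) ^+ 2)^-1 * (x^-1 - x).
  move=> a1; apply: (@le_trans _ _ x^-1); first by lra.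
  have d0 : 0 < 1 - (qeps `^ eps) ^+ 2 by rewrite subr_gt0 exprn_ilt1 ?(ltW A0).
  rewrite mulrC ler_pdivlMr// -(ler_pM2l x0) !mulrA mulfV ?gt_eqF// mul1r mulrBr mulfV ?gt_eqF//.
  by rewrite lerB// -expr2 lerXn2r ?nnegrE// ltW.
by move: A1 aux; rewrite /hsgn /calpha; case: G => a1 aux; [have := aux a1|have := aux a1|]; lra.
Qed.

Lemma chp_growth n k k' : (k <= k')%N ->
  (p k).[node n] <= 2 * (q ^+ n * qeps) ^+ (k' - k) * (p k').[node n].
Proof.
move=> kk; rewrite -(ler_pM2r (alpha_gt0 G q01 n)) -[leRHS]mulrA.
rewrite !chp_sh// !sh_hcosh powR_node.
set w := q ^+ n * qeps.
have w01 : 0 < w <= 1.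
  by rewrite mulr_gt0 ?exprn_gt0//= mul_le1 ?exprn_gt0// ele1.
have /andP[w0 w1] := w01.
have c0 : 0 < w `^ eps by exact: powR_gt0.
have c1 : w `^ eps <= 1.
  rewrite -[leRHS](powRr0 w); apply: ger_powR => //; exact: eps_ge0.
have -> : w ^+ k' * w `^ eps = w ^+ k * w `^ eps * w ^+ (k' - k).
  by rewrite mulrAC -exprD subnKC.
apply: hcosh_growth.
  by rewrite mulr_gt0 ?exprn_gt0//= mul_le1 ?exprn_gt0// ele1.
by rewrite exprn_gt0//= ele1.
Qed.

Lemma node_diffE k' k : (k' <= k)%N -> node k - node k' =
  (q ^+ k * qeps)^-1 * ((1 - q ^+ (k - k')) * (1 - q ^+ (k - k') * (q ^+ k' * qeps) ^+ 2)).
Proof.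
move=> kk; rewrite /node /uz !powR_node.
have -> : q ^+ k * qeps = q ^+ (k - k') * (q ^+ k' * qeps).
  by rewrite mulrA -exprD subnK.
set B := q ^+ k' * qeps; set z := q ^+ _.
have B0 : B != 0 by rewrite gt_eqF// mulr_gt0// exprn_gt0.
have z0 : z != 0 by rewrite expf_neq0// gt_eqF.
by field; rewrite B0 z0.
Qed.

Let B01 k : 0 < q ^+ k * qeps <= 1.
Proof.
by rewrite mulr_gt0 ?exprn_gt0//= mul_le1 ?exprn_gt0// ele1.
Qed.

Lemma node_diff_ub k' k : (k' <= k)%N -> node k - node k' <= (q ^+ k * qeps)^-1.
Proof.
move=> kk; rewrite node_diffE//; have /andP[b0 b1] := B01 k'; have /andP[c0 _] := B01 k.
have z0 : 0 <= q ^+ (k - k') by exact: ege0.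
have z1 : q ^+ (k - k') <= 1 by exact: ele1.
have b2 : 0 <= (q ^+ k' * qeps) ^+ 2 by exact: ege0.
have b21 : (q ^+ k' * qeps) ^+ 2 <= 1 by exact: ele1.
rewrite ler_piMr ?invr_ge0 ?(ltW c0)//.
set z := q ^+ _ in z0 z1 *; set b := _ ^+ 2 in b2 b21 *.
have zb0 : 0 <= z * b by rewrite mulr_ge0.
have zb1 : z * b <= 1 by rewrite mulr_ile1.
by rewrite mulr_ile1; lra.
Qed.

Lemma node_diff_lb k' k : (k' <= k)%N ->
  (q ^+ k * qeps)^-1 * (1 - q ^+ (k - k')) ^+ 2 <= node k - node k'.
Proof.
move=> kk; rewrite node_diffE//; have /andP[b0 b1] := B01 k'; have /andP[c0 _] := B01 k.
have z0 : 0 <= q ^+ (k - k') by exact: ege0.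
have z1 : q ^+ (k - k') <= 1 by exact: ele1.
have b21 : (q ^+ k' * qeps) ^+ 2 <= 1 by exact: ele1.
rewrite ler_wpM2l ?invr_ge0 ?(ltW c0)// expr2 ler_wpM2l ?subr_ge0//.
by rewrite lerB// ler_piMr.
Qed.

(** A difference of nodes is comparable to the larger node, up to a factor that
    depends only on the gap between the two indices. *)
Lemma node_diff_ratio k k' b b' d : (k' <= k)%N -> (0 < d)%N -> (d <= b - b')%N ->
  node k - node k' <=
  (q ^+ (k - b))^-1 * (1 - q ^+ d) ^- 2 * (node b - node b').
Proof.
move=> kk d0 db.
have bb : (b' <= b)%N by rewrite ltnW// -subn_gt0 (leq_trans d0).
apply: le_trans (node_diff_ub kk) _.
have /andP[kb0 _] := B01 k; have /andP[bb0 _] := B01 b.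
have qd : q ^+ d < 1 by rewrite exprn_ilt1 ?(ltW q0)// -lt0n.
have e0 : 0 < (1 - q ^+ d) ^+ 2 by rewrite exprn_gt0// subr_gt0.
have lb : (q ^+ b * qeps)^-1 <= (1 - q ^+ d) ^- 2 * (node b - node b').
  rewrite [leRHS]mulrC ler_pdivlMr//; apply: le_trans (node_diff_lb bb).
  rewrite ler_wpM2l ?invr_ge0 ?(ltW bb0)// lerXn2r ?nnegrE ?subr_ge0 ?(ltW qd)//.
    exact: ele1.
  by rewrite lerB// ler_wiXn2l// ltW.
rewrite -mulrA; have kb1 : 0 < q ^+ (k - b) by rewrite exprn_gt0.
apply: le_trans (ler_wpM2l _ lb); last by rewrite invr_ge0 ltW.
rewrite -invfM lef_pV2 ?posrE ?mulr_gt0 ?exprn_gt0//.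
rewrite mulrA -exprD ler_wpM2r ?(ltW s0)//.
by apply: ler_wiXn2l; rewrite ?(ltW q0)// addnC -leq_subLR.
Qed.

(** The part of the weight of a configuration that depends on one row only. *)
Definition row_factor n (a m : nat) : R :=
  ((p a).[node n] * (p a.+1).[node n])^-1 * (cd_weight R G m * (p m).[node n]) * alpha m.

Lemma row_factor_gt0 n a m : 0 < row_factor n a m.
Proof.
have pn k : 0 < (p k).[node n] by exact: chp_node_gt0.
rewrite mulr_gt0 ?alpha_gt0// mulr_gt0//; first by rewrite invr_gt0 mulr_gt0.
by rewrite mulr_gt0// cd_weight_gt0.
Qed.

Lemma cd_weight_le2 m b : cd_weight R G m <= 2 * cd_weight R G b.
Proof. by rewrite /cd_weight /lead1; case: m b G => [|m] [|b] []; lra. Qed.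

(** The ratios of polynomial values decay like powers of [w = q ^ (n + eps)],
    once for each unit of distance from the reference pair [(b, b)]. The node
    differences with the later rows can grow by up to [q ^- (n - i.+1)] for each
    unit of [m - b], and [alpha] by [q ^- eps]; a decay of [q ^ (i.+1)] per unit
    remains. *)
Lemma row_factor_bound n i a m b : (i < n)%N -> (b <= a)%N -> (m <= a)%N ->
  row_factor n a m * (q ^+ (m - b))^-1 ^+ (n - i.+1) <=
  8 * calpha * (q ^+ i.+1) ^+ ((a - m) + (a - b)) * row_factor n b b.
Proof.
move=> ni ba ma.
set pm := (p m).[node n]; set pa := (p a).[node n].
set pa' := (p a.+1).[node n]; set pb := (p b).[node n]; set pb' := (p b.+1).[node n].
have pm0 : 0 < pm by exact: chp_node_gt0.
have pa0 : 0 < pa by exact: chp_node_gt0.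
have pa'0 : 0 < pa' by exact: chp_node_gt0.
have pb0 : 0 < pb by exact: chp_node_gt0.
have pb'0 : 0 < pb' by exact: chp_node_gt0.
have al0 := alpha_gt0 G q01 b; have am0 := alpha_gt0 G q01 m.
have cb0 := cd_weight_gt0 R G b; have cm0 := cd_weight_gt0 R G m.
set w := q ^+ n * qeps.
have w0 : 0 < w by case/andP: (B01 n).
set E := ((a - m) + (a - b))%N; set d := (m - b)%N; set k := (n - i.+1)%N.
have h1 : pm / pa <= 2 * w ^+ (a - m) by rewrite ler_pdivrMr//; exact: chp_growth.
have h2 : pb' / pa' <= 2 * w ^+ (a - b).
  by rewrite ler_pdivrMr//; have := @chp_growth n b.+1 a.+1 ba; rewrite subSS.
have h3 : alpha m / alpha b <= calpha / qeps ^+ d.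
  rewrite ler_pdivrMr// mulrAC ler_pdivlMr ?exprn_gt0//; exact: alpha_growth.
have h4 : cd_weight R G m / cd_weight R G b <= 2 by rewrite ler_pdivrMr// cd_weight_le2.
have qd0 : 0 < q ^+ d by rewrite exprn_gt0.
have sd0 : 0 < qeps ^+ d by rewrite exprn_gt0.
have hbb : row_factor n b b = cd_weight R G b * alpha b / pb'.
  by rewrite /row_factor -/pb -/pb'; field; rewrite gt_eqF// gt_eqF.
pose rt := (cd_weight R G m / cd_weight R G b) * (pm / pa) * (pb' / pa') * (alpha m / alpha b).
have ham : row_factor n a m = rt * row_factor n b b.
  rewrite /rt hbb /row_factor -/pm -/pa -/pa'; field.
  by rewrite !gt_eqF.
have nk : (n = i.+1 + k)%N by rewrite /k subnKC.
have dE : (d <= E)%N by rewrite /d /E (leq_trans (leq_sub2r b ma)) ?leq_addl.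
have expo : w ^+ E / qeps ^+ d * (q ^+ d)^-1 ^+ k <= (q ^+ i.+1) ^+ E.
  rewrite exprVn -mulrA -invfM ler_pdivrMr ?mulr_gt0 ?exprn_gt0//.
  rewrite /w exprMn mulrCA mulrC ler_pM ?ege0 ?exprn_gt0//.
    by apply: ler_wiXn2l; rewrite ?(ltW s0).
  rewrite -!exprM -exprD; apply: ler_wiXn2l; rewrite ?(ltW q0)//.
  by rewrite [X in (_ <= X * _)%N]nk mulnDl leq_add2l mulnC leq_mul2l dE orbT.
rewrite ham.
have step : rt <= 8 * calpha * (w ^+ E / qeps ^+ d).
  rewrite (_ : 8 * calpha * _ = 2 * (2 * w ^+ (a - m)) * (2 * w ^+ (a - b)) *
    (calpha / qeps ^+ d)); last first.
    by rewrite /E exprD; field; rewrite gt_eqF.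
  have nn x y : 0 < x -> 0 < y -> 0 <= x / y :> R by move=> x0 y0; rewrite divr_ge0 ?ltW.
  have n1 := nn _ _ cm0 cb0; have n2 := nn _ _ pm0 pa0; have n3 := nn _ _ pb'0 pa'0.
  have n12 := mulr_ge0 n1 n2.
  apply: (ler_pM (mulr_ge0 n12 n3) (nn _ _ am0 al0) _ h3).
  apply: (ler_pM n12 n3 _ h2).
  exact: (ler_pM n1 n2 h4 h1).
rewrite mulrAC ler_wpM2r ?(ltW (row_factor_gt0 _ _ _))//.
apply: (@le_trans _ _ (8 * calpha * (w ^+ E / qeps ^+ d) * (q ^+ d)^-1 ^+ k)).
  by rewrite ler_wpM2r ?exprn_ge0 ?invr_ge0 ?(ltW qd0).
rewrite -mulrA ler_wpM2l// mulr_ge0//; exact: le_trans ler01 calpha_ge1.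
Qed.

End Estimates.

(** ** Geometric sums and products *)

Section Geometric.
Variables (R : realType) (q : R).
Hypothesis q01 : 0 < q < 1.

Let q0 : 0 < q. Proof. by case/andP: q01. Qed.
Let q1 : 0 < 1 - q. Proof. by case/andP: q01; rewrite subr_gt0. Qed.

Lemma geo_sum_le m : \sum_(k < m) q ^+ k <= (1 - q)^-1.
Proof.
rewrite -[leRHS]mul1r ler_pdivlMr// mulrC.
have := subrX1 q m; rewrite -opprB -[q - 1]opprB mulNr => /oppr_inj <-.
by rewrite gerBl exprn_ge0// ltW.
Qed.

Lemma geo_gap_right i n : \sum_(j < n | (i < j)%N) q ^+ (j - i) <= (1 - q)^-1.
Proof.
rewrite -(big_geq_mkord i.+1 n xpredT (fun j => q ^+ (j - i))) -(add0n i.+1) big_addn.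
rewrite big_mkord; apply: le_trans (geo_sum_le (n - i.+1)).
apply: ler_sum => k _; rewrite addnS subSn ?leq_addl// addnK exprS.
by rewrite ler_piMl ?exprn_ge0 ?(ltW q0)//; case/andP: q01 => _ /ltW.
Qed.

Lemma geo_gap_left j n : (j <= n)%N ->
  \sum_(i < n | (i < j)%N) q ^+ (j - i) <= (1 - q)^-1.
Proof.
move=> jn; rewrite -(big_ord_widen n (fun i => q ^+ (j - i)) jn).
apply: le_trans (geo_sum_le j); rewrite (reindex_inj rev_ord_inj) /=.
apply: ler_sum => k _; rewrite subKn ?ltn_ord// exprS.
by rewrite ler_piMl ?exprn_ge0 ?(ltW q0)//; case/andP: q01 => _ /ltW.
Qed.

Lemma prod_le_expR (I : finType) (P : pred I) (f g : I -> R) s :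
  (forall i, P i -> 0 <= f i <= expR (g i)) -> \sum_(i | P i) g i <= s ->
  \prod_(i | P i) f i <= expR s.
Proof.
move=> fg gs; apply: le_trans (_ : \prod_(i | P i) expR (g i) <= _).
  exact: ler_prod.
by rewrite -(big_morph expR (@expRD R) (@expR0 R)) ler_expR.
Qed.

Lemma gap_factor_le k : (0 < k)%N ->
  0 <= (1 - q ^+ k) ^- 2 <= expR (2 / (1 - q) * q ^+ k).
Proof.
move=> k0; have qk0 : 0 < q ^+ k by rewrite exprn_gt0.
have qkq : q ^+ k <= q.
  have ql : q <= 1 by rewrite -subr_ge0 ltW.
  by case: k k0 {qk0} => // k _; rewrite exprS ler_piMr ?exprn_ile1 ?(ltW q0).
have d1 := q1; have d0 : 0 < 1 - q ^+ k by lra.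
have inv_le : (1 - q ^+ k)^-1 <= expR (q ^+ k / (1 - q)).
  apply: le_trans (expR_ge1Dx _).
  apply: (@le_trans _ _ (1 + q ^+ k / (1 - q ^+ k))); last first.
    by rewrite lerD2l ler_wpM2l ?(ltW qk0)// lef_pV2 ?posrE// lerB.
  by rewrite le_eqVlt; apply/orP; left; apply/eqP; field; rewrite gt_eqF.
rewrite -exprVn exprn_ge0 ?invr_ge0 ?(ltW d0)//=.
have -> : 2 / (1 - q) * q ^+ k = q ^+ k / (1 - q) + q ^+ k / (1 - q).
  by field; rewrite gt_eqF.
by rewrite expRD expr2 ler_pM ?invr_ge0 ?(ltW d0).
Qed.

Definition gapK : R := expR (2 / (1 - q) * (1 - q)^-1).

Lemma gapK_ge1 : 1 <= gapK.
Proof. by rewrite -expR0 ler_expR mulr_ge0 ?divr_ge0 ?invr_ge0 ?ltW. Qed.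

Lemma prod_gap_right i n :
  \prod_(j < n | (i < j)%N) (1 - q ^+ (j - i)) ^- 2 <= gapK.
Proof.
apply: (@prod_le_expR _ _ _ (fun j : 'I_n => 2 / (1 - q) * q ^+ (j - i))).
  by move=> j ij; rewrite gap_factor_le ?subn_gt0.
by rewrite -mulr_sumr ler_wpM2l ?geo_gap_right// divr_ge0 ?ltW.
Qed.

Lemma prod_gap_left j n : (j <= n)%N ->
  \prod_(i < n | (i < j)%N) (1 - q ^+ (j - i)) ^- 2 <= gapK.
Proof.
move=> jn; apply: (@prod_le_expR _ _ _ (fun i : 'I_n => 2 / (1 - q) * q ^+ (j - i))).
  by move=> i ij; rewrite gap_factor_le ?subn_gt0.
by rewrite -mulr_sumr ler_wpM2l ?geo_gap_left// divr_ge0 ?ltW.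
Qed.

End Geometric.

(** One row of a configuration is a pair [m <= a], [b <= a], which pays [r] to
    the power of its distance from the reference pair [(b, b)]; leaving the
    reference pair costs a factor of order [r] in total. *)
Section PairSums.
Variables (R : realType) (r : R) (B b : nat).
Hypothesis r01 : 0 < r < 1.
Hypothesis bB : (b < B)%N.

Definition at_base (a m : nat) : bool := (a == b) && (m == b).

Lemma pair_sum_base (x : R) :
  \sum_(a < B | (b <= a)%N) \sum_(m < B | (m <= a)%N)
    (if at_base a m then x else 0) = x.
Proof.
rewrite (bigD1 (Ordinal bB))//= [X in _ + X]big1 ?addr0; last first.
  move=> a /andP[_ ab]; rewrite big1// => m _; rewrite /at_base.
  by rewrite -[a == b :> nat]/(a == Ordinal bB) (negPf ab).
rewrite (bigD1 (Ordinal bB))//= [X in _ + X]big1 ?addr0; last first.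
  move=> m /andP[_ mb]; rewrite /at_base.
  by rewrite -[m == b :> nat]/(m == Ordinal bB) (negPf mb) andbF.
by rewrite /at_base !eqxx.
Qed.

Lemma pair_sum_le :
  \sum_(a < B | (b <= a)%N) \sum_(m < B | (m <= a)%N)
    (if at_base a m then 0 else r ^+ ((a - m) + (a - b))) <= 2 * r / (1 - r) ^+ 2.
Proof.
have /andP[r0 r1] := r01; have d0 : 0 < 1 - r by lra.
have all : \sum_(a < B | (b <= a)%N) \sum_(m < B | (m <= a)%N)
    r ^+ ((a - m) + (a - b)) <= (1 - r) ^- 2.
  apply: (@le_trans _ _ (\sum_(a < B | (b <= a)%N) (1 - r)^-1 * r ^+ (a - b))).
    apply: ler_sum => a _; under eq_bigr do rewrite exprD.
    rewrite -mulr_suml ler_wpM2r ?exprn_ge0 ?(ltW r0)//.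
    rewrite -(big_ord_widen_cond B xpredT (fun m => r ^+ (a - m)) (ltn_ord a)).
    apply: le_trans (geo_sum_le r01 a.+1).
    rewrite (reindex_inj rev_ord_inj) /=; apply: ler_sum => m _.
    by rewrite subSS subKn// -ltnS.
  rewrite -mulr_sumr -exprVn expr2 ler_wpM2l ?invr_ge0 ?(ltW d0)//.
  rewrite -(big_geq_mkord b B xpredT (fun a => r ^+ (a - b))) -{1}(add0n b) big_addn.
  by under eq_bigr do rewrite addnK; rewrite big_mkord; exact: geo_sum_le.
have : \sum_(a < B | (b <= a)%N) \sum_(m < B | (m <= a)%N)
    (if at_base a m then 0 else r ^+ ((a - m) + (a - b))) + 1 =
  \sum_(a < B | (b <= a)%N) \sum_(m < B | (m <= a)%N) r ^+ ((a - m) + (a - b)).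
  rewrite -[X in _ + X](pair_sum_base 1) -big_split; apply: eq_bigr => a _ /=.
  rewrite -big_split; apply: eq_bigr => m _ /=; rewrite /at_base.
  case: andP => [[/eqP-> /eqP->]|_]; last by rewrite addr0.
  by rewrite !subnn expr0 add0r.
move/(canRL (addrK 1)) => ->; apply: (@le_trans _ _ ((1 - r) ^- 2 - 1)).
  by rewrite lerB.
rewrite ler_pdivlMr ?exprn_gt0// mulrBl mul1r mulVf ?expf_neq0 ?gt_eqF//.
have := sqr_ge0 r; rewrite !expr2; lra.
Qed.

End PairSums.

(** * Rows are stable under one link *)

Section Stability.
Variables (R : realType) (G : gtype) (q : R).
Hypothesis q01 : 0 < q < 1.

Local Notation node := (node G q).
Local Notation alpha := (alpha G q).
Local Notation K := (gapK q).

Let q0 : 0 < q. Proof. by case/andP: q01. Qed.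
Let q1 : q < 1. Proof. by case/andP: q01. Qed.

Definition stepC : R := 8 * calpha G q * (K * K).

Definition stepD : R := stepC * (2 / (1 - q) ^+ 2).

Lemma stepC_ge0 : 0 <= stepC.
Proof.
have c1 := calpha_ge1 G q01; have k1 := gapK_ge1 q01.
by rewrite /stepC !mulr_ge0//; lra.
Qed.

Lemma stepD_ge0 : 0 <= stepD.
Proof.
by rewrite /stepD mulr_ge0 ?stepC_ge0// divr_ge0// exprn_ge0// subr_ge0 ltW.
Qed.

Section Row.
Variables (n : nat) (l : GT n.+1).

Local Notation conf := ({ffun 'I_n -> 'I_(rowl l 0)} * {ffun 'I_n -> 'I_(rowl l 0)})%type.
Local Notation base i := (rowl l i.+1).
Local Notation valid := (interlacing (L := rowl l)).

Lemma base_lt (i : nat) : (i < n)%N -> (base i < rowl l 0)%N.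
Proof. by move=> ni; apply: rowl_lt. Qed.

Definition base_ffun : {ffun 'I_n -> 'I_(rowl l 0)} :=
  [ffun i => Ordinal (base_lt (ltn_ord i))].

(** The configuration that deletes the largest part of [l] and keeps all the
    others; the weights of all configurations are compared with its weight. *)
Definition base_conf : conf := (base_ffun, base_ffun).

Lemma base_ffunE i : base_ffun i = base i :> nat.
Proof. by rewrite ffunE. Qed.

Lemma base_conf_valid : valid base_conf.
Proof.
apply/andP; split; apply/familyP => i; rewrite unfold_in /upper /lower /= base_ffunE.
  by rewrite leqnn (rowl_decr l (i := i) (ltn_ord i)).
rewrite leqnn /=; apply/implyP => ni.
by rewrite (extE _ (Ordinal ni)) base_ffunE (rowl_decr l (i := i.+1) ni).
Qed.

Lemma base_gap i j : (i <= j)%N -> (j < n)%N -> (j - i <= base i - base j)%N.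
Proof.
elim: j => [|j IH]; first by rewrite leqn0 => /eqP->.
rewrite leq_eqVlt => /orP[/eqP->|ij] jn; first by rewrite !subnn.
have h1 := rowl_decr l (i := j.+1) jn; have h2 := IH ij (ltnW jn).
have h3 : (base j <= base i)%N.
  have := ij; rewrite leq_eqVlt => /orP[/eqP->//|lt].
  by apply: ltnW; apply: rowl_lt => //; exact: ltnW.
rewrite subSn//.
by apply: leq_ltn_trans h2 _; apply: ltn_sub2l => //; exact: leq_trans h1 h3.
Qed.

Lemma base_decr (i j : 'I_n) : (i < j)%N -> (base j < base i)%N.
Proof. by move=> ij; apply: (@rowl_lt _ l i.+1 j.+1) => //; exact: ltn_ord. Qed.

Lemma low_lt (c : conf) (i j : 'I_n) : valid c -> (i < j)%N -> (c.2 j < c.2 i)%N.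
Proof.
move=> cV; rewrite -!(extE c.2); case: j => j jn /=; move: jn.
elim: j => [//|j IH] jn; rewrite ltnS leq_eqVlt => /orP[/eqP e|ij].
  by rewrite e; exact: (lower_decr cV jn).
by apply: ltn_trans (lower_decr cV jn) _; apply: IH ij; exact: ltnW.
Qed.

Lemma valid_bounds (c : conf) (i : 'I_n) : valid c -> (base i <= c.1 i)%N /\ (c.2 i <= c.1 i)%N.
Proof.
move=> /andP[/familyP/(_ i) h1 /familyP/(_ i) h2]; move: h1 h2.
by rewrite !unfold_in /upper /lower => /andP[-> _] /andP[-> _].
Qed.

Lemma conf_weightE (c : conf) : conf_weight G q c =
  (\prod_i row_factor G q n (c.1 i) (c.2 i)) *
  \prod_(i < n) \prod_(j < n | (i < j)%N) (node (c.2 i) - node (c.2 j)).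
Proof. by rewrite /conf_weight /branch_weight mulrA -big_split. Qed.

Lemma conf_weight_gt0 (c : conf) : valid c -> 0 < conf_weight G q c.
Proof.
move=> cV; rewrite conf_weightE mulr_gt0//.
  by apply: prodr_gt0 => i _; exact: row_factor_gt0.
apply: prodr_gt0 => i _; apply: prodr_gt0 => j ij; rewrite subr_gt0.
exact/node_lt/low_lt.
Qed.

Definition moved (c : conf) (i : 'I_n) : bool := ~~ at_base (base i) (c.1 i) (c.2 i).

(** The price of row [i]: the relative weight of a configuration is at most the
    product of the prices of its rows. *)
Definition step_cost (i a m : nat) : R :=
  if at_base (base i) a m then 1
  else stepC * (q ^+ i.+1) ^+ ((a - m) + (a - base i)).

Lemma pair_bound (c : conf) (i j : 'I_n) : valid c -> (i < j)%N ->
  0 <= node (c.2 i) - node (c.2 j) <=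
  (q ^+ (c.2 i - base i))^-1 *
  ((if moved c i then (1 - q ^+ (j - i)) ^- 2 else 1) *
   (if moved c j then (1 - q ^+ (j - i)) ^- 2 else 1)) *
  (node (base i) - node (base j)).
Proof.
move=> cV ij; rewrite subr_ge0 ltW ?node_lt ?low_lt//=.
have ji0 : (0 < j - i)%N by rewrite subn_gt0.
have b0 : 0 <= node (base i) - node (base j).
  by rewrite subr_ge0 ltW// node_lt// base_decr.
have g0 : 0 <= (q ^+ (c.2 i - base i))^-1 by rewrite invr_ge0 exprn_ge0 ?(ltW q0).
set x := (1 - q ^+ (j - i)) ^- 2.
have qk : q ^+ (j - i) < 1 by rewrite exprn_ilt1 ?(ltW q0)// -lt0n.
have qk0 : 0 < q ^+ (j - i) by rewrite exprn_gt0.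
have x1 : 1 <= x.
  rewrite /x -exprVn exprn_ege1// invf_ge1; lra.
have main : node (c.2 i) - node (c.2 j) <=
    (q ^+ (c.2 i - base i))^-1 * x * (node (base i) - node (base j)).
  apply: node_diff_ratio => //; first by rewrite ltnW// low_lt.
  by apply: base_gap => //; exact: ltnW.
have gen (D g y D' : R) : 0 <= g -> 0 <= D' -> x <= y -> D <= g * x * D' ->
    D <= g * y * D'.
  move=> pg pD xy; move/le_trans; apply.
  by apply: ler_wpM2r => //; apply: ler_wpM2l.
have big := gen _ _ _ _ g0 b0 _ main.
case mi: (moved c i).
  apply: big; case: (moved c j); rewrite ?mulr1//.
  by apply: ler_peMr => //; apply: le_trans x1.
case mj: (moved c j); first by apply: big; rewrite mul1r.
move/negbFE: mi => /andP[_ /eqP->]; move/negbFE: mj => /andP[_ /eqP->].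
by rewrite subnn expr0 invr1 !mul1r.
Qed.

(** A pair of rows contributes a gap factor only if one of them has moved; it is
    charged to the rows that moved, each of which collects at most the
    convergent product [gapK] from the rows before it and from those after it. *)
Lemma conf_weight_le (c : conf) : valid c ->
  conf_weight G q c <= conf_weight G q base_conf *
    \prod_(i < n) step_cost i (c.1 i) (c.2 i).
Proof.
move=> cV; rewrite !conf_weightE /=.
pose V := \prod_(i < n) \prod_(j < n | (i < j)%N) (node (base i) - node (base j)).
have -> : \prod_(i < n) \prod_(j < n | (i < j)%N)
    (node (base_ffun i) - node (base_ffun j)) = V.
  by apply: eq_bigr => i _; apply: eq_bigr => j _; rewrite !base_ffunE.
have V0 : 0 <= V.
  apply: prodr_ge0 => i _; apply: prodr_ge0 => j ij.
  by rewrite subr_ge0 ltW// node_lt// base_decr.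
pose x (i j : nat) := (1 - q ^+ (j - i)) ^- 2.
pose kk i := if moved c i then K else 1.
pose gg (i : 'I_n) := (q ^+ (c.2 i - base i))^-1.
have g0 i : 0 <= gg i by rewrite invr_ge0 exprn_ge0 ?(ltW q0).
have k1 := gapK_ge1 q01.
have kk0 i : 0 <= kk i by rewrite /kk; case: ifP => _; lra.
have x0 (i j : nat) : 0 <= x i j.
  by rewrite /x -exprVn exprn_ge0// invr_ge0 subr_ge0 exprn_ile1 ?ltW.
have pairs : \prod_(i < n) \prod_(j < n | (i < j)%N) (node (c.2 i) - node (c.2 j)) <=
    (\prod_(i < n) (gg i ^+ (n - i.+1) * (kk i * kk i))) * V.
  apply: (@le_trans _ _ (\prod_(i < n) \prod_(j < n | (i < j)%N)
    (gg i * ((if moved c i then x i j else 1) * (if moved c j then x i j else 1)) *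
      (node (base i) - node (base j))))).
    apply: ler_prod => i _; apply/andP; split.
      by apply: prodr_ge0 => j ij; have /andP[] := pair_bound cV ij.
    by apply: ler_prod => j ij; exact: pair_bound.
  under eq_bigr do rewrite big_split big_split big_split /=.
  rewrite !big_split /=; rewrite ler_wpM2r//.
  have -> : \prod_(i < n) \prod_(j < n | (i < j)%N) gg i = \prod_(i < n) gg i ^+ (n - i.+1).
    by apply: eq_bigr => i _; rewrite -(big_geq_mkord i.+1 n xpredT (fun=> gg i)) prodr_const_nat.
  rewrite ler_wpM2l ?prodr_ge0// => [i _|]; first exact: exprn_ge0.
  apply: ler_pM.
  - by apply: prodr_ge0 => i _; apply: prodr_ge0 => j _; case: ifP.
  - by apply: prodr_ge0 => i _; apply: prodr_ge0 => j _; case: ifP.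
  - apply: ler_prod => i _; rewrite /kk; case: ifP => _.
      by rewrite prodr_ge0 ?prod_gap_right.
    by rewrite big1 ?lexx ?ler01.
  rewrite (exchange_big_dep xpredT)//=; apply: ler_prod => j _; rewrite /kk; case: ifP => _.
    by rewrite prodr_ge0 ?prod_gap_left// ltnW.
  by rewrite big1 ?lexx ?ler01.
have h0 : 0 <= \prod_i row_factor G q n (c.1 i) (c.2 i).
  by apply: prodr_ge0 => i _; rewrite ltW ?row_factor_gt0.
apply: le_trans (ler_wpM2l h0 pairs) _.
rewrite mulrA [leRHS]mulrAC; apply: ler_wpM2r => //; rewrite -!big_split /=.
apply: ler_prod => i _; apply/andP; split.
  by rewrite mulr_ge0 ?(ltW (row_factor_gt0 _ q01 _ _ _))// mulr_ge0 ?exprn_ge0// mulr_ge0.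
have [ba ma] := valid_bounds i cV.
rewrite base_ffunE /step_cost /kk /moved.
case E: (at_base _ _ _) => /=.
  move/andP: E => [/eqP-> /eqP e]; rewrite /gg e subnn expr0 invr1 expr1n.
  by rewrite !mulr1.
have := @row_factor_bound _ G _ q01 n i _ _ _ (ltn_ord i) ba ma; rewrite -/(gg i) => H.
have KK : 0 <= K * K by rewrite mulr_ge0; lra.
have := ler_wpM2r KK H; rewrite -[leLHS]mulrA => H2; apply: le_trans H2 _.
by rewrite le_eqVlt /stepC; apply/orP; left; apply/eqP; ring.
Qed.

(** Forgetting that the rows of a configuration constrain each other decouples
    them, and the sum over configurations factors. *)
Lemma sum_valid_le (F : 'I_n -> nat -> nat -> R) : (forall i a m, 0 <= F i a m) ->
  \sum_(c : conf | valid c) \prod_i F i (c.1 i) (c.2 i) <=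
  \prod_(i < n) \sum_(a < rowl l 0 | (base i <= a)%N)
    \sum_(m < rowl l 0 | (m <= a)%N) F i a m.
Proof.
move=> F0; pose Q1 (i : 'I_n) (a : 'I_(rowl l 0)) := (base i <= a)%N.
pose Q2 (a : {ffun 'I_n -> 'I_(rowl l 0)}) (i : 'I_n) (m : 'I_(rowl l 0)) := (m <= a i)%N.
have -> : \prod_(i < n) \sum_(a < rowl l 0 | (base i <= a)%N)
    \sum_(m < rowl l 0 | (m <= a)%N) F i a m =
  \sum_(a in family Q1) \sum_(m in family (Q2 a)) \prod_i F i (a i) (m i).
  rewrite (bigA_distr_big_dep Q1 (fun i a => \sum_(m < rowl l 0 | (m <= a)%N) F i a m)).
  apply: eq_bigr => a _.
  by rewrite (bigA_distr_big_dep (Q2 a) (fun i m => F i (a i) m)).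
rewrite pair_big_dep /= big_mkcond [leRHS]big_mkcond /=.
apply: ler_sum => -[a m] _ /=; case: ifP => [cV|_]; last first.
  by case: ifP => // _; exact: prodr_ge0.
rewrite ifT//; apply/andP; split; apply/familyP => i; rewrite unfold_in /Q1 /Q2.
  by case: (valid_bounds i cV).
by case: (valid_bounds i cV).
Qed.

Local Notation r i := (q ^+ (nat_of_ord i).+1).

Let r01 (i : 'I_n) : 0 < r i < 1.
Proof. by rewrite exprn_gt0//= exprn_ilt1 ?(ltW q0). Qed.

Lemma moved_cost_le (i : 'I_n) :
  \sum_(a < rowl l 0 | (base i <= a)%N) \sum_(m < rowl l 0 | (m <= a)%N)
    (if at_base (base i) a m then 0 else step_cost i a m) <= stepD * r i.
Proof.
have e a m : (if at_base (base i) a m then 0 else step_cost i a m) =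
    stepC * (if at_base (base i) a m then 0 else r i ^+ ((a - m) + (a - base i))).
  by rewrite /step_cost; case: (at_base _ _ _); rewrite ?mulr0.
under eq_bigr do under eq_bigr do rewrite e.
under eq_bigr do rewrite -mulr_sumr.
rewrite -mulr_sumr /stepD -mulrA ler_wpM2l ?stepC_ge0//.
apply: le_trans (pair_sum_le (r01 i) (base_lt (ltn_ord i))) _.
have /andP[h0 h1] := r01 i.
have rq : r i <= q by rewrite exprS ler_piMr ?exprn_ile1 ?(ltW q0) ?(ltW q1).
rewrite [leRHS]mulrAC ler_wpM2l ?mulr_ge0 ?(ltW h0)//.
rewrite lef_pV2 ?posrE ?exprn_gt0 ?subr_gt0//.
by rewrite lerXn2r ?nnegrE ?subr_ge0 ?(ltW q1) ?(ltW h1)// lerB.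
Qed.

Lemma step_cost_ge0 i a m : 0 <= step_cost i a m.
Proof.
rewrite /step_cost; case: ifP => // _.
by rewrite mulr_ge0 ?stepC_ge0// !exprn_ge0// ltW.
Qed.

Lemma total_cost_le (i : 'I_n) :
  \sum_(a < rowl l 0 | (base i <= a)%N) \sum_(m < rowl l 0 | (m <= a)%N)
    step_cost i a m <= 1 + stepD * r i.
Proof.
have /(lerD (lexx 1)) := moved_cost_le i; apply: le_trans.
rewrite -[X in X + _](pair_sum_base (base_lt (ltn_ord i)) (1 : R)) -big_split.
apply: ler_sum => a _; rewrite -big_split; apply: ler_sum => m _ /=.
by rewrite /step_cost; case: (at_base _ _ _); rewrite ?addr0 ?add0r.
Qed.

Definition totalC : R := stepD * (1 - q)^-1.

Lemma prod_total_le : \prod_(i < n) (1 + stepD * r i) <= expR totalC.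
Proof.
apply: (@prod_le_expR _ _ _ _ (fun i : 'I_n => stepD * r i)) => [i _|].
  rewrite expR_ge1Dx andbT addr_ge0// mulr_ge0 ?stepD_ge0//.
  by have /andP[/ltW] := r01 i.
rewrite -mulr_sumr ler_wpM2l ?stepD_ge0//.
apply: le_trans (geo_sum_le q01 n); apply: ler_sum => i _.
by rewrite exprS ler_piMl ?exprn_ge0 ?(ltW q0) ?(ltW q1).
Qed.

Local Notation W c := (conf_weight G q (l := l) c).
Local Notation W0 := (conf_weight G q (base_conf : conf)).
Local Notation S := (\sum_(c : conf | valid c) W c).

Lemma W0_gt0 : 0 < W0. Proof. exact/conf_weight_gt0/base_conf_valid. Qed.

Lemma W0_le_sum : W0 <= S.
Proof.
rewrite (bigD1 (base_conf : conf)) ?base_conf_valid//= lerDl.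
by apply: sumr_ge0 => c /andP[cV _]; rewrite ltW ?conf_weight_gt0.
Qed.

Lemma sum_le_W0 : S <= W0 * expR totalC.
Proof.
have H : S <= \sum_(c : conf | valid c) W0 * \prod_(i < n) step_cost i (c.1 i) (c.2 i).
  by apply: ler_sum => c; exact: conf_weight_le.
apply: le_trans H _.
rewrite -mulr_sumr ler_wpM2l ?(ltW W0_gt0)//.
apply: le_trans (sum_valid_le (fun i a m => step_cost_ge0 i a m)) _.
apply: le_trans prod_total_le; apply: ler_prod => i _.
rewrite total_cost_le andbT; apply: sumr_ge0 => a _; apply: sumr_ge0 => m _.
exact: step_cost_ge0.
Qed.

Lemma sum_moved_le (j : 'I_n) :
  \sum_(c : conf | valid c) W c * (moved c j)%:R <=
  W0 * (stepD * r j * expR totalC).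
Proof.
pose F (i : 'I_n) a m := if i == j then
  (if at_base (base i) a m then 0 else step_cost i a m) else step_cost i a m.
have F0 i a m : 0 <= F i a m.
  rewrite /F; case: ifP => _; last exact: step_cost_ge0.
  by case: ifP => // _; exact: step_cost_ge0.
have H : \sum_(c : conf | valid c) W c * (moved c j)%:R <=
    \sum_(c : conf | valid c) W0 * \prod_i F i (c.1 i) (c.2 i).
  apply: ler_sum => c cV; case mj: (moved c j); last first.
    by rewrite mulr0 mulr_ge0 ?(ltW W0_gt0)// prodr_ge0.
  rewrite mulr1; apply: le_trans (conf_weight_le cV) _.
  rewrite le_eqVlt; apply/orP; left; apply/eqP; congr (_ * _).
  apply: eq_bigr => i _; rewrite /F; case: eqP => // ->.
  by move: mj; rewrite /moved => /negbTE ->.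
apply: le_trans H _.
rewrite -mulr_sumr ler_wpM2l ?(ltW W0_gt0)//.
apply: le_trans (sum_valid_le F0) _.
have /andP[/ltW rj0 _] := r01 j.
have d0 := stepD_ge0.
apply: (@le_trans _ _ (stepD * r j * \prod_(i < n) (1 + stepD * r i))); last first.
  by apply: ler_wpM2l; [exact: mulr_ge0|exact: prod_total_le].
have f0 (i : 'I_n) : 0 <= \sum_(a < rowl l 0 | (base i <= a)%N)
    \sum_(m < rowl l 0 | (m <= a)%N) F i a m.
  by apply: sumr_ge0 => a _; apply: sumr_ge0 => m _.
have t1 (i : 'I_n) : 1 <= 1 + stepD * r i.
  by rewrite lerDl mulr_ge0//; have /andP[/ltW] := r01 i.
rewrite (bigD1 j)//= [X in _ <= _ * X](bigD1 j)//= mulrA; apply: ler_pM => //.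
- by apply: prodr_ge0 => i _.
- apply: (@le_trans _ _ (stepD * r j)).
    by rewrite /F eqxx; exact: moved_cost_le.
  by apply: ler_peMr; [exact: mulr_ge0|exact: t1].
apply: ler_prod => i /negPf ij; rewrite f0 /= /F ij; exact: total_cost_le.
Qed.

End Row.

Definition last_parts (s n : nat) (l : GT n) : seq nat := drop (n - s) (val l).

Lemma last_parts_low n (l : GT n.+1) s c : (s <= n)%N ->
  interlacing (L := rowl l) c ->
  (forall i : 'I_n, (n - s <= i)%N -> c.2 i = rowl l i.+1 :> nat) ->
  last_parts s (low_GT c) = last_parts s l.
Proof.
move=> sn cV cb; rewrite /last_parts.
apply: (@eq_from_nth _ 0%N); first by rewrite !size_drop !size_tuple; lia.
move=> k; rewrite size_drop size_tuple subKn// => ks; rewrite !nth_drop.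
have kn : (n - s + k < n)%N by lia.
have h1 := rowl_low_GT (Ordinal kn) cV; have h2 := cb (Ordinal kn) (leq_addr _ _).
move: h1; rewrite h2 /rowl /= subSS subSn// addSn => /addIn.
by [].
Qed.

Section Tail.
Variables (n s : nat) (l : GT n.+1).
Hypothesis sn : (s <= n)%N.

Local Notation conf := ({ffun 'I_n -> 'I_(rowl l 0)} * {ffun 'I_n -> 'I_(rowl l 0)})%type.
Local Notation valid := (interlacing (L := rowl l)).
Local Notation W c := (conf_weight G q (l := l) c).
Local Notation S := (\sum_(c : conf | valid c) W c).

Let S0 : 0 < S. Proof. exact: lt_le_trans (W0_gt0 l) (W0_le_sum l). Qed.

Definition tail_prob : R :=
  \sum_(mu <- finsupp (link G q l)) link G q l mu * (last_parts s mu == last_parts s l)%:R.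

Lemma tail_probE : tail_prob =
  (\sum_(c : conf | valid c) W c * (last_parts s (low_GT c) == last_parts s l)%:R) / S.
Proof.
rewrite /tail_prob.
by rewrite (link_sum G q01 l (fun mu => (last_parts s mu == last_parts s l)%:R)).
Qed.

Lemma tail_prob_ge_base : expR (- totalC) <= tail_prob.
Proof.
rewrite tail_probE ler_pdivlMr// expRN mulrC ler_pdivrMr ?expR_gt0//.
apply: le_trans (sum_le_W0 l) _; rewrite ler_wpM2r ?expR_ge0//.
rewrite (bigD1 (base_conf l)) ?base_conf_valid//= last_parts_low ?base_conf_valid//.
  rewrite eqxx mulr1 lerDl; apply: sumr_ge0 => c /andP[cV _].
  by rewrite mulr_ge0// ltW ?conf_weight_gt0.
by move=> i _; exact: base_ffunE.
Qed.

(** A union bound over the last [s] rows: if none of them has moved, then the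
    last parts are unchanged. *)
Lemma tail_prob_ge_linear :
  1 - stepD * expR totalC * (1 - q)^-1 * q ^+ (n - s) <= tail_prob.
Proof.
have W0S := W0_le_sum l; have W00 := W0_gt0 l.
rewrite tail_probE -(ler_pM2r S0) -[leRHS]mulrA mulVf ?gt_eqF// mulr1.
have compl : S - \sum_(c : conf | valid c) W c * (last_parts s (low_GT c) == last_parts s l)%:R <=
    \sum_(j < n | (n - s <= j)%N) \sum_(c : conf | valid c) W c * (moved c j)%:R.
  rewrite exchange_big /= -sumrB; apply: ler_sum => c cV.
  have w0 := ltW (conf_weight_gt0 cV).
  have nn : 0 <= \sum_(j < n | (n - s <= j)%N) W c * (moved c j)%:R.
    by apply: sumr_ge0 => j _; rewrite mulr_ge0.
  case: eqP => [_|ne]; first by rewrite mulr1 subrr.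
  rewrite mulr0 subr0.
  have [j /andP[js mj]] : exists j : 'I_n, (n - s <= j)%N && moved c j.
    apply/existsP; apply: contraT; rewrite negb_exists => /forallP nm; case: ne.
    apply: last_parts_low => // i si; have := nm i; rewrite si /= negbK.
    by move=> /andP[_ /eqP].
  rewrite (bigD1 j)//= mj mulr1 lerDl; apply: sumr_ge0 => i _.
  by rewrite mulr_ge0.
have bound : \sum_(j < n | (n - s <= j)%N) \sum_(c : conf | valid c) W c * (moved c j)%:R <=
    conf_weight G q (base_conf l) * (stepD * expR totalC * ((1 - q)^-1 * q ^+ (n - s))).
  apply: (@le_trans _ _ (\sum_(j < n | (n - s <= j)%N) conf_weight G q (base_conf l) *
    (stepD * expR totalC * q ^+ j.+1))).
    apply: ler_sum => j _; rewrite [stepD * _ * q ^+ _]mulrAC; exact: sum_moved_le.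
  rewrite -mulr_sumr -mulr_sumr; apply: ler_wpM2l; first exact: ltW.
  apply: ler_wpM2l; first by rewrite mulr_ge0 ?stepD_ge0 ?expR_ge0.
  have -> : \sum_(j < n | (n - s <= j)%N) q ^+ j.+1 = \sum_(n - s <= j < n) q ^+ j.+1.
    by rewrite big_geq_mkord.
  rewrite -{1}(add0n (n - s)%N) big_addn big_mkord subKn//.
  rewrite mulrC -ler_pdivrMl ?exprn_gt0// mulr_sumr.
  apply: le_trans (geo_sum_le q01 s); apply: ler_sum => k _.
  rewrite -addSn exprD mulrCA mulVf ?gt_eqF ?exprn_gt0// mulr1 exprS.
  by rewrite ler_piMl ?exprn_ge0 ?(ltW q0) ?(ltW q1).
have T0 : 0 <= stepD * expR totalC * ((1 - q)^-1 * q ^+ (n - s)).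
  have i0 : 0 <= (1 - q)^-1 by rewrite invr_ge0 subr_ge0 ltW.
  have p0 : 0 <= q ^+ (n - s) by rewrite exprn_ge0 ?(ltW q0).
  exact: mulr_ge0 (mulr_ge0 stepD_ge0 (expR_ge0 _)) (mulr_ge0 i0 p0).
have := ler_wpM2r T0 W0S; rewrite mulrBl mul1r.
have -> : stepD * expR totalC * (1 - q)^-1 * q ^+ (n - s) * S =
  S * (stepD * expR totalC * ((1 - q)^-1 * q ^+ (n - s))) by ring.
lra.
Qed.

End Tail.

Definition tailC : R := 2 * (stepD * expR totalC * (1 - q)^-1 + 1) * (1 + totalC).

Lemma totalC_ge0 : 0 <= totalC.
Proof. by rewrite /totalC mulr_ge0 ?stepD_ge0// invr_ge0 subr_ge0 ltW. Qed.

Lemma tailC_gt0 : 0 < tailC.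
Proof.
have h := totalC_ge0.
have h2 : 0 <= stepD * expR totalC * (1 - q)^-1.
  have i0 : 0 <= (1 - q)^-1 by rewrite invr_ge0 subr_ge0 ltW.
  exact: mulr_ge0 (mulr_ge0 stepD_ge0 (expR_ge0 _)) i0.
by rewrite /tailC !mulr_gt0//; lra.
Qed.

(** The linear bound is useful where it is at least 1/2; elsewhere the uniform
    bound is, because the exponent is bounded below there. *)
Lemma tail_prob_ge n s (l : GT n.+1) : (s <= n)%N ->
  expR (- (tailC * q ^+ (n - s))) <= tail_prob s l.
Proof.
move=> sn; have t0 := totalC_ge0.
set x := (stepD * expR totalC * (1 - q)^-1) * q ^+ (n - s).
have qk0 : 0 < q ^+ (n - s) by rewrite exprn_gt0.
have h2 : 0 <= stepD * expR totalC * (1 - q)^-1.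
  have i0 : 0 <= (1 - q)^-1 by rewrite invr_ge0 subr_ge0 ltW.
  exact: mulr_ge0 (mulr_ge0 stepD_ge0 (expR_ge0 _)) i0.
have x0 : 0 <= x by rewrite mulr_ge0// ltW.
have cx : 2 * x * (1 + totalC) <= tailC * q ^+ (n - s).
  rewrite /tailC /x [leRHS]mulrAC ler_wpM2r; nra.
case: (lerP x 2^-1) => xh.
  have H := tail_prob_ge_linear l sn; apply: (le_trans _ H); rewrite -/x.
  apply: (@le_trans _ _ (expR (- (2 * x)))).
    by rewrite ler_expR lerN2; have := mulr_ge0 x0 t0; lra.
  have y0 : 0 < 1 + 2 * x by lra.
  have e1 : 1 + 2 * x <= expR (2 * x) by exact: expR_ge1Dx.
  rewrite expRN; apply: (@le_trans _ _ (1 + 2 * x)^-1).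
    by rewrite lef_pV2 ?posrE ?expR_gt0.
  rewrite -[leLHS]mul1r ler_pdivrMr//; nra.
have H := tail_prob_ge_base l sn; apply: (le_trans _ H); rewrite ler_expR lerN2.
by have := mulr_ge0 x0 t0; nra.
Qed.

End Stability.

(** * The boundary of the graph *)

Section Graph.
Variables (R : realType) (q : R) (G : gtype).
Hypothesis q01 : 0 < q < 1.

Definition level (n : nat) : choiceType := GT n.+1.

Definition row n (l : level n.+1) : {fsfun level n -> R with 0} := link G q l.

Lemma row_ge0 n (l : level n.+1) mu : 0 <= row l mu.
Proof.
have := link_sum G q01 l (fun nu => (nu == mu)%:R).
rewrite (@sum_row1 _ _ row n l (fun nu => (nu == mu)%:R) mu); last first.
  by move=> nu /negPf ->.
rewrite eqxx mulr1 /row => ->.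
have W0 c : interlacing (L := rowl l) c -> 0 <= conf_weight G q c.
  by move=> cV; rewrite ltW// conf_weight_gt0.
rewrite divr_ge0//; last exact: sumr_ge0.
by apply: sumr_ge0 => c cV; rewrite mulr_ge0// W0.
Qed.

Lemma row_sum1 n (l : level n.+1) : \sum_(mu <- finsupp (row l)) row l mu = 1.
Proof.
have := link_sum G q01 l (fun=> 1).
under eq_bigr do rewrite mulr1.
under [X in _ = X / _]eq_bigr do rewrite mulr1.
rewrite divff// gt_eqF//.
exact: lt_le_trans (W0_gt0 G q01 l) (W0_le_sum G q01 l).
Qed.

Definition level_tail (s n : nat) (l : level n) : seq nat := last_parts s l.

Lemma level_tail_inj n (l l' : level n) :
  level_tail n.+1 l = level_tail n.+1 l' -> l = l'.
Proof. by rewrite /level_tail /last_parts subnn !drop0 => /val_inj/val_inj. Qed.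

Lemma level_tail_row n s (l : level n.+1) : (s <= n.+1)%N ->
  expR (- (tailC G q * q ^+ (n.+1 - s))) <=
  \sum_(mu <- finsupp (row l)) row l mu * (level_tail s mu == level_tail s l)%:R.
Proof. exact: tail_prob_ge. Qed.

Definition level_enum (i : nat) : option {n & level n} :=
  if @choice.unpickle (nat * seq nat)%type i is Some (n, s) then
    if insub s is Some t then
      omap (Tagged level) (insub (t : n.+1.-tuple nat) : option (level n))
    else None
  else None.

Lemma level_enumP (x : {n & level n}) : exists i, level_enum i = Some x.
Proof.
case: x => n l; exists (choice.pickle (n, val (val l))).
by rewrite /level_enum choice.pickleK valK /= valK.
Qed.

Lemma links_ker n d (l : GT (d + n).+1) (mu : GT n.+1) :
  links G q l mu = @ker _ level row (d + n) n l mu.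
Proof.
elim: d l => [|d IH] l; first by rewrite ker_diag.
rewrite [RHS](@ker_top _ level row (d + n) n)//; last exact: leq_addl.
by apply: eq_bigr => nu _; rewrite -IH.
Qed.

Lemma coherentP (M : system R) : coherent G q M <-> coh row M.
Proof.
split=> [[M1 Mh]|[M1 Mh]]; split=> n; first exact: M1.
- move=> mu; split; last exact: Mh.
  by move=> l; rewrite mulr_ge0 ?row_ge0//; case: (M1 n.+1).
- exact: M1.
- by move=> mu; have [] := Mh n mu.
Qed.

Lemma minimal_boundaryP (M : system R) : minimal_boundary G q M <-> extreme row M.
Proof.
have ext (M1 M2 : system R) : M1 = M2 <-> forall n mu, M1 n mu = M2 n mu.
  split=> [->//|e]; apply: functional_extensionality_dep => n.
  by apply/funext => mu.
split=> [[/coherentP cM H]|[cM H]]; split=> //; try exact/coherentP.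
  move=> M1 M2 t /coherentP c1 /coherentP c2 t01 ME.
  by have [/ext e1 /ext e2] := H _ _ _ c1 c2 t01 ME.
move=> M1 M2 t /coherentP c1 /coherentP c2 t01 ME.
by have [e1 e2] := H _ _ _ c1 c2 t01 ME; split; apply/ext.
Qed.

Lemma martin_boundaryP (M : system R) : martin_boundary G q M <-> martin row M.
Proof.
split=> [[/coherentP cM [lam H]]|[cM [lam H]]]; split=> //; try exact/coherentP.
  exists lam => n mu; rewrite -(cvg_shiftn n).
  by have := H n mu; under eq_fun do rewrite links_ker.
exists lam => n mu; under eq_fun do rewrite links_ker.
by have := H n mu; rewrite -(cvg_shiftn n).
Qed.

End Graph.

Theorem theorem6p6 (R : realType) (q : R) (hq : 0 < q < 1) (G : gtype) :
  minimal_boundary G q = martin_boundary G q.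
Proof.
have Pge := @row_ge0 R q G hq; have P1 := @row_sum1 R q G hq.
apply/seteqP; split=> M.
  move=> /(minimal_boundaryP G hq) exM; apply/(martin_boundaryP G hq).
  exact: (extreme_martin Pge P1 (@level_enumP) exM).
move=> /(martin_boundaryP G hq) mM; apply/(minimal_boundaryP G hq).
exact: (martin_extreme Pge P1 (tailC_gt0 G hq) hq (@level_tail_inj)
  (@level_tail_row R q G hq) mM).
Qed.
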